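(* A graph $G$ is a Sterboul--Deming graph if and only if its reduced form $\mathcal{R}(G)$ is a Sterboul--Deming graph.
   Context: All graphs are finite, undirected and simple. For a graph $G$, the Gallai--Edmonds sets are: $D(G)$, the set of vertices missed by some maximum matching of $G$; $A(G)$, the set of vertices not in $D(G)$ that have a neighbor in $D(G)$; and $C(G)=V(G)\setminus(D(G)\cup A(G))$. Reduced form: let $D_1,\dots,D_k$ be the nontrivial components (those with more than one vertex) of the induced subgraph $G[D(G)]$. The graph $\mathcal{R}(G)$ is obtained from $G$ by deleting all vertices of $D_1,\dots,D_k$, adding $k$ pairwise disjoint new triangles $T_1,\dots,T_k$ (copies of $K_3$ on new vertices), choosing one vertex $t_i$ in each $T_i$, and adding all edges $t_ix$ with $x\in N_G(D_i)\cap A(G)$, for $i=1,\dots,k$; here $N_G(D_i)$ is the set of vertices having a neighbor in $D_i$. Let $M$ be a matching of a graph $G$. A path (or walk) is $M$-alternating if, of any two consecutive edges, exactly one belongs to $M$; an $mm$-$M$-path is an $M$-alternating path whose first and last edges are in $M$. An $M$-blossom is an odd cycle of length $2k+1$ with exactly $k$ edges in $M$; its base is the unique vertex of the cycle not covered by those $k$ edges. An $M$-Tflower consists of an $M$-blossom together with an $M$-stem, i.e. an $M$-alternating path of even length (possibly zero) connecting the base of the blossom to a vertex not saturated by $M$ in $G$, where the base is the only common vertex of the blossom and the stem. An $M$-Tposy consists of two $M$-blossoms joined by an $mm$-$M$-path whose endpoints are the bases of the two blossoms, such that no internal vertex of the path lies in the blossoms and the intersection of the two blossoms is either empty or an $mm$-$M$-path.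 Define $SD(G)$ as the set of vertices $v$ of $G$ for which there is a maximum matching $M$ of $G$ such that $v$ lies in an $M$-Tflower or an $M$-Tposy, and $KE(G)=V(G)\setminus SD(G)$. A graph $G$ is a Sterboul--Deming graph if $KE(G)=\emptyset$. *)

(* Defs.v *)
From mathcomp Require Import all_boot.
From mathcomp Require Import boolp.

Set Implicit Arguments.
Unset Strict Implicit.
Unset Printing Implicit Defensive.

Record sgraph := SGraph {
  vertex :> finType;
  adj : rel vertex;
  adj_sym : symmetric adj;
  adj_irrefl : irreflexive adj }.

Section Matchings.
Variable G : sgraph.
Implicit Types (M : {set {set G}}) (c p : seq G) (x y v b : G) (K : {set G}).

Definition edges : {set {set G}} :=
  [set [set u.1; u.2] | u : G * G & adj u.1 u.2].

Definition matching M := (M \subset edges) && trivIset M.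

Definition maximum_matching M :=
  matching M &&
  [forall M' : {set {set G}}, matching M' ==> (#|M'| <= #|M|)].

Definition saturated M v := v \in cover M.

Definition gallai_D : {set G} :=
  [set v | [exists M : {set {set G}},
              maximum_matching M && ~~ saturated M v]].

Definition nbhd K : {set G} := [set x | [exists y in K, adj x y]].

Definition gallai_A : {set G} := nbhd gallai_D :\: gallai_D.

Definition adj_in K : rel G := [rel x y | [&& x \in K, y \in K & adj x y]].

Definition components K : {set {set G}} :=
  [set [set y in K | connect (adj_in K) x y] | x in K].

Definition nontrivial_D_components : {set {set G}} :=
  [set K in components gallai_D | 1 < #|K|].

(* The path with vertices x :: p is given by its first vertex x and the
   sequence p of the following ones; its length is size p. *)
Definition simple_path x p := path (@adj G) x p && uniq (x :: p).

Definition path_edges x p : seq {set G} :=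
  pairmap (fun y z => [set y; z]) x p.

Definition cycle_edges c : seq {set G} :=
  if c is x :: p then path_edges x (rcons p x) else [::].

Definition alternating M x p :=
  sorted (fun f g : {set G} => (f \in M) (+) (g \in M)) (path_edges x p).

Definition mm_path M x p :=
  [&& simple_path x p, alternating M x p, p != [::],
      head set0 (path_edges x p) \in M & last set0 (path_edges x p) \in M].

Definition blossom M c :=
  [&& 2 < size c, ucycleb (@adj G) c, odd (size c)
    & count (mem M) (cycle_edges c) == (size c)./2].

Definition base M c b :=
  (b \in c) && all (fun f : {set G} => (f \in M) ==> (b \notin f)) (cycle_edges c).

Definition stem M b p :=
  [&& simple_path b p, alternating M b p, ~~ odd (size p)
    & ~~ saturated M (last b p)].

Definition tflower M c b p :=
  [&& blossom M c, base M c b, stem M b p & ~~ has (mem c) p].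

(* Intersections are taken as subgraphs, i.e. for vertices and for edges. *)
Definition tposy_intersection M c1 c2 : Prop :=
  (forall v, v \in c1 -> v \notin c2) \/
  (exists x p,
     [/\ mm_path M x p,
         forall v, (v \in x :: p) = (v \in c1) && (v \in c2) &
         forall f : {set G}, (f \in path_edges x p) =
           (f \in cycle_edges c1) && (f \in cycle_edges c2)]).

(* behead (belast x p) lists the internal vertices of the path x :: p. *)
Definition tposy M c1 c2 x p : Prop :=
  [/\ blossom M c1 && base M c1 x,
      blossom M c2 && base M c2 (last x p),
      mm_path M x p,
      {in behead (belast x p), forall v, (v \notin c1) && (v \notin c2)} &
      tposy_intersection M c1 c2].

Definition in_tflower M v : Prop :=
  exists c b p, tflower M c b p /\ v \in c ++ b :: p.

Definition in_tposy M v : Prop :=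
  exists c1 c2 x p, tposy M c1 c2 x p /\ v \in c1 ++ c2 ++ x :: p.

Definition SD : {set G} :=
  [set v | `[< exists M, maximum_matching M /\
                         (in_tflower M v \/ in_tposy M v) >]].

Definition KE : {set G} := ~: SD.

Definition sterboul_deming : Prop := KE = set0.

End Matchings.

Section ReducedForm.
Variable G : sgraph.

Definition kept_vertex : finType :=
  {x : G | x \notin cover (nontrivial_D_components G)}.

Definition D_component : finType :=
  {K : {set G} | K \in nontrivial_D_components G}.

(* The vertices inr (K, i), i : 'I_3, form the triangle replacing the component
   K of G[D(G)]; its chosen vertex t_K is inr (K, ord0). *)
Definition reduced_vertex : finType := (kept_vertex + D_component * 'I_3)%type.

Definition attached (x : kept_vertex) (u : D_component * 'I_3) : bool :=
  (u.2 == ord0) && (val x \in nbhd (val u.1) :&: gallai_A G).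

Definition reduced_adj : rel reduced_vertex := fun u w =>
  match u, w with
  | inl x, inl y => adj (val x) (val y)
  | inr s, inr t => (s.1 == t.1) && (s.2 != t.2)
  | inl x, inr t => attached x t
  | inr s, inl y => attached y s
  end.

Lemma reduced_adj_sym : symmetric reduced_adj.
Proof.
move=> [x|s] [y|t] //=; first exact: adj_sym.
by rewrite eq_sym (eq_sym s.2).
Qed.

Lemma reduced_adj_irrefl : irreflexive reduced_adj.
Proof. by move=> [x|s] /=; rewrite ?adj_irrefl ?eqxx ?andbF. Qed.

Definition reduced_form : sgraph := SGraph reduced_adj_sym reduced_adj_irrefl.

End ReducedForm.

(* Main.v *)
(* A matching is handled as the involution m exchanging the ends of its edges.
   Write D, A, C for the Gallai--Edmonds sets.  The proof compares SD(G) and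
   SD(R(G)) separately on nontrivial components of G[D], on the rest of D and A,
   and on C.

   A vertex of D with a neighbour in D is always the base of a blossom of some
   maximum matching missing it, hence lies in SD.

   Call an independent set I good for m if m matches every neighbour of I into I.
   Following alternating paths shows that no Tflower or Tposy of m meets a good I
   or its neighbourhood.  Conversely, if x in D \/ A is not in SD, then the
   component of x in the bipartite graph between A and the components of G[D]
   contains only trivial components, and these form a set that is good for every
   maximum matching.  Both notions ignore nontrivial components of G[D], and by
   Gallai--Edmonds the maximum matchings of G and R(G) correspond to each other
   outside these components.

   A vertex v of C can only lie in a Tposy.  Walking along the Tposy away from v
   one either stays in C or leaves C for good through a vertex of A; such a vertex
   a is "live": it is adjacent to no good set, and from a an alternating path
   inside A and D reaches a blossom of a nontrivial component of G[D].  So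
   v in SD(G) depends only on G[C], on the edges from C to A and on the live
   vertices, all of which are the same for G and R(G). *)

From mathcomp Require Import all_boot perm.
From mathcomp Require Import boolp zify.
Require Import Defs.

Set Implicit Arguments.
Unset Strict Implicit.
Unset Printing Implicit Defensive.

(** * Alternating paths of two involutions *)

(** A Tposy through C may run through nontrivial components of G[D], whose interior the reduction
    destroys, so it cannot be carried over as a whole. Only its part inside C is copied; the ends
    outside C are rebuilt in the other graph from the liveness of the exit vertices. Two rebuilt
    ends may collide, and then they are merged into a single blossom. A Tposy contained in C is
    copied together with the intersection of its blossoms.

    SD asks for some maximum matching, so keeping a vertex out of SD takes a set that is good for
    all maximum matchings at once; this is why reachability has to be moved from one maximum
    matching to another by exchanges. Liveness, in contrast, refers to a single matching, because a
    Tposy only restricts the sets good for its own matching.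

    The comparison of two graphs is one-directional: Tposies are pushed forward and good sets are
    pulled back. It is instantiated once in each direction. The Gallai--Edmonds facts are derived
    for matchings of G[S] with [S] variable, so that deleting A changes no type. *)

Section AlternatingOrbit.
Variables (T : finType) (f g : T -> T) (y : T).
Hypotheses (fK : involutive f) (gK : involutive g) (gy : g y = y).

(* The sequence y, f y, g (f y), f (g (f y)), ... *)
Fixpoint alt_orbit i := if i is j.+1 then (if odd j then g else f) (alt_orbit j) else y.

Lemma alt_orbitS i : alt_orbit i.+1 = (if odd i then g else f) (alt_orbit i).
Proof. by []. Qed.
Arguments alt_orbit : simpl never.

(** Undoing the last step of a repetition turns it into an earlier one: the preceding vertex equals
    a path neighbour of the repeated vertex. At index 0, where there is no predecessor, [gy] takes
    its place. *)
Lemma alt_orbit_inj_upto h : (forall i, i < h -> alt_orbit i.+1 != alt_orbit i) ->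
  forall i j, i < j -> j <= h -> alt_orbit i != alt_orbit j.
Proof.
move=> ne i j; elim: j i => // j IHj i ij jh; apply/eqP => e.
have jlt : j < h by lia.
move: ij; rewrite ltnS leq_eqVlt => /orP[/eqP ij|ij].
  by move: (ne _ jlt); rewrite -ij in e *; rewrite -e eqxx.
have prev : alt_orbit j = (if odd j then g else f) (alt_orbit i).
  by rewrite e alt_orbitS; case: (odd j); rewrite ?fK ?gK.
case: i e ij prev => [|i] e ij prev.
  case oj : (odd j) prev => prev.
    by have := IHj 0 ij (ltnW jlt); rewrite prev -[alt_orbit 0]/y gy eqxx.
  have j1 : j = 1 \/ 1 < j by lia.
  case: j1 => [j1|j1]; first by rewrite j1 in oj.
  by have := IHj 1 j1 (ltnW jlt); rewrite prev eqxx.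
case oij : (odd i == odd j).
  have ij' : i < j by lia.
  have := IHj i ij' (ltnW jlt); rewrite prev alt_orbitS.
  by rewrite -(eqP oij); case: (odd i); rewrite ?fK ?gK eqxx.
have ij2 : i.+2 < j by move/negbT: oij; move: ij; lia.
have := IHj i.+2 ij2 (ltnW jlt); rewrite prev [alt_orbit i.+2]alt_orbitS /=.
have -> : odd j = ~~ odd i by move/negbT: oij; case: (odd i); case: (odd j).
by rewrite eqxx.
Qed.

(** Pigeonhole: a path that never stalls would list [#|T|.+1] distinct points. [h] is the first
    stall. *)
Lemma alt_orbit_stops : exists h, alt_orbit h.+1 = alt_orbit h /\
  forall i j, i < j -> j <= h -> alt_orbit i != alt_orbit j.
Proof.
have ex : exists h, alt_orbit h.+1 == alt_orbit h.
  apply/not_existsP => /= ne.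
  have inj := @alt_orbit_inj_upto #|T| (fun i _ => introN idP (ne i)).
  have /leq_card : injective (fun i : 'I_#|T|.+1 => alt_orbit i).
    move=> i j /eqP e; apply/val_inj/eqP => /=.
    case: (ltngtP i j) e => // ij; first by rewrite (negPf (inj _ _ ij _)) // -ltnS.
    by rewrite eq_sym (negPf (inj _ _ ij _)) // -ltnS.
  by rewrite card_ord ltnn.
exists (ex_minn ex); case: ex_minnP => h /eqP eh hmin; split=> //.
apply: alt_orbit_inj_upto => i ih; apply/negP => /hmin; lia.
Qed.

(** The path stalls because the next involution fixes its last vertex, and the parity of [h] tells
    which one. For odd [h] both ends are fixed by [g]: this is an augmenting path for [g]. *)
Lemma alt_orbitP : exists h, 
  let Z := [set alt_orbit i | i : 'I_h.+1] in
  [/\ forall i j, i < j -> j <= h -> alt_orbit i != alt_orbit j,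
      forall i, i <= h -> alt_orbit i \in Z,
      forall z, z \in Z -> exists2 i, i <= h & z = alt_orbit i,
      forall z, z \in Z -> (f z \in Z) && (g z \in Z) &
      if odd h then h != 0 /\ forall z, z \in Z ->
         (f z != z) /\ ((g z == z) = (z == y) || (z == alt_orbit h))
      else forall z, z \in Z ->
         ((f z == z) = (z == alt_orbit h)) /\ ((g z == z) = (z == y))].
Proof.
have [h [stop inj]] := alt_orbit_stops; exists h => Z.
have inZ i : i <= h -> alt_orbit i \in Z.
  by move=> ih; apply/imsetP; exists (Ordinal (ih : i < h.+1)).
have Zin z : z \in Z -> exists2 i, i <= h & z = alt_orbit i.
  by case/imsetP => i _ ->; exists i => //; rewrite -ltnS.
have neq i j : i <= h -> j <= h -> (alt_orbit i == alt_orbit j) = (i == j).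
  move=> ih jh; case: (ltngtP i j) => [ij|ij|->]; last by rewrite eqxx.
    by rewrite (negPf (inj _ _ ij jh)).
  by rewrite eq_sym (negPf (inj _ _ ij ih)).
have stepf i : i <= h -> f (alt_orbit i) = 
    if odd i then alt_orbit i.-1 else if i == h then alt_orbit i else alt_orbit i.+1.
  case: (odd i) / boolP => oi ih; first by case: i oi ih => //= i /negPf oi _;
    rewrite alt_orbitS oi fK.
  case: eqP => [e|_]; last by rewrite alt_orbitS (negPf oi).
  by rewrite e in oi *; rewrite -[RHS]stop alt_orbitS (negPf oi).
have stepg i : i <= h -> g (alt_orbit i) = 
    if ~~ odd i then alt_orbit i.-1 else if i == h then alt_orbit i else alt_orbit i.+1.
  case: (odd i) / boolP => oi ih /=.
    by case: eqP => [e|_]; [rewrite e in oi *;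
      rewrite -[RHS]stop alt_orbitS oi | rewrite alt_orbitS oi].
  by case: i oi ih => //= i; rewrite negbK => oi _; rewrite alt_orbitS oi gK.
split=> //.
- move=> z /Zin[i ih ->]; rewrite stepf // stepg //.
  by apply/andP; split; case: (odd i);
    rewrite ?[if true then _ else _]/= ?[if ~~ _ then _ else _]/=;
    try (apply: inZ; lia); case: (altP (i =P h)) => ?; apply: inZ; lia.
- case oh : (odd h).
    split; first by case: h oh {stop inj Z inZ Zin neq stepf stepg}.
    move=> z /Zin[i ih ->]; rewrite stepf // stepg // -[y]/(alt_orbit 0).
    by split; case oi : (odd i); case: (altP (i =P h)) => e /=; rewrite ?neq; lia.
  move=> z /Zin[i ih ->]; rewrite stepf // stepg // -[y]/(alt_orbit 0).
  by split; case oi : (odd i); case: (altP (i =P h)) => e /=; rewrite ?neq; lia.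
Qed.

End AlternatingOrbit.

Arguments alt_orbit : simpl never.

(** * Matchings as involutions *)

Section PartnerFunctions.
Variable G : sgraph.
Implicit Types (S Z : {set G}) (m n : G -> G) (x y z : G).

(** A matching of the induced subgraph G[S]; the exposed vertices are the fixed points, and
    everything outside [S] is fixed too. *)
Definition matchfun S m := [/\ involutive m, forall x, m x != x -> adj x (m x)
  & forall x, m x != x -> x \in S].

Definition free S m := [set x in S | m x == x].

Definition maxmatch S m :=
  matchfun S m /\ forall n, matchfun S n -> #|free S m| <= #|free S n|.

Definition missable S x := x \in S /\ exists2 m, maxmatch S m & m x = x.

Definition switch Z m n x := if x \in Z then n x else m x.

Lemma adj_neq x y : @adj G x y -> x != y.
Proof. by move=> xy; apply/eqP => e; rewrite e adj_irrefl in xy. Qed.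

Lemma matchfun_switch S Z m n : matchfun S m -> matchfun S n ->
  (forall z, z \in Z -> (m z \in Z) && (n z \in Z)) -> matchfun S (switch Z m n).
Proof.
move=> [mK madj mS] [nK nadj nS] clo; split=> x; rewrite /switch.
- case xZ : (x \in Z); first by case/andP: (clo _ xZ) => _ ->; rewrite nK.
  case mxZ: (m x \in Z); last by rewrite mK.
  by case/andP: (clo _ mxZ); rewrite mK xZ.
- by case: ifP => _; [apply: nadj | apply: madj].
- by case: ifP => _; [apply: nS | apply: mS].
Qed.

Lemma card_free_switch S Z m n :
  #|free S (switch Z m n)| + #|free S m :&: Z| = #|free S m| + #|free S n :&: Z|.
Proof.
rewrite -(cardsID Z (free S (switch Z m n))) -(cardsID Z (free S m)).
have -> : free S (switch Z m n) :&: Z = free S n :&: Z.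
  by apply/setP => x; rewrite !inE /switch; case: (x \in Z); rewrite ?andbF.
have -> : free S (switch Z m n) :\: Z = free S m :\: Z.
  by apply/setP => x; rewrite !inE /switch; case: (x \in Z).
lia.
Qed.

(** For odd [h] the path joins two vertices exposed by [n], so switching changes the numbers of
    exposed vertices by two; for even [h] each matching trades one exposed vertex for another.
    Maximality is not assumed, so that the lemma can also compare maximum matchings of G and of G -
    a. *)
Lemma alternating_switch S m n y : matchfun S m -> matchfun S n -> n y = y -> y \in S ->
  exists h Z, let x := alt_orbit m n y in
  [/\ forall i j, i < j -> j <= h -> x i != x j,
      forall i, i <= h -> x i \in Z,
      forall z, z \in Z -> exists2 i, i <= h & z = x i,
      forall z, z \in Z -> (m z \in Z) && (n z \in Z) &
      if odd h then
        [/\ #|free S (switch Z n m)|.+2 = #|free S n|,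
            #|free S (switch Z m n)| = #|free S m| + 2 &
            forall z, z \in Z ->
            (m z != z) /\ ((n z == z) = (z == y) || (z == x h))]
      else [/\ #|free S (switch Z m n)| = #|free S m|,
               #|free S (switch Z n m)| = #|free S n| &
               forall z, z \in Z -> ((m z == z) = (z == x h)) /\ ((n z == z) = (z == y))]].
Proof.
move=> mm nn ny yS; have [mK madj mS] := mm; have [nK nadj nS] := nn.
have [h /=] := alt_orbitP mK nK ny; set Z := [set _ | _ : _].
set x := alt_orbit m n y; case=> inj inZ Zin clo fixed; exists h, Z; split=> //.
have x0 : x 0 = y by [].
have xS i : i <= h -> x i \in S.
  case: i => [|i] ih; first by rewrite x0.
  have: x i != x i.+1 by apply: inj.
  rewrite /x alt_orbitS -/x; case: (odd i) => ne.
    by apply: nS; rewrite nK.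
  by apply: mS; rewrite mK.
have yZ : y \in Z by rewrite -x0; apply: inZ.
have hZ : x h \in Z by apply: inZ.
have E1 := card_free_switch S Z m n; have E2 := card_free_switch S Z n m.
case: (odd h) fixed => [[h0 fixed]|fixed].
  have Em : free S m :&: Z = set0.
    apply/setP => z; rewrite !inE; case zZ : (z \in Z); last by rewrite andbF.
    by rewrite (negPf (fixed _ zZ).1) andbF.
  have En : free S n :&: Z = [set y; x h].
    apply/setP => z; rewrite !inE; case zZ : (z \in Z); last first.
      by rewrite andbF; apply/esym/norP; split; apply/eqP => e; rewrite e ?yZ ?hZ in zZ.
    rewrite (fixed _ zZ).2 andbT andb_idl // => /orP[]/eqP->//.
    exact: xS.
  rewrite Em En cards0 cards2 -{1 2}x0 inj ?lt0n // in E1 E2.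
  by split=> //; lia.
have Em : free S m :&: Z = [set x h].
  apply/setP => z; rewrite !inE; case zZ : (z \in Z); last first.
    by rewrite andbF; apply/esym/eqP => e; rewrite e hZ in zZ.
  by rewrite (fixed _ zZ).1 andbT andb_idl // => /eqP->; exact: xS.
have En : free S n :&: Z = [set y].
  apply/setP => z; rewrite !inE; case zZ : (z \in Z); last first.
    by rewrite andbF; apply/esym/eqP => e; rewrite e yZ in zZ.
  by rewrite (fixed _ zZ).2 andbT andb_idl // => /eqP->.
by rewrite Em En !cards1 in E1 E2; split=> //; lia.
Qed.

Lemma maxmatch_switch S m n y : maxmatch S m -> maxmatch S n -> n y = y -> y \in S ->
  exists h Z, let x := alt_orbit m n y in
  [/\ ~~ odd h, forall i j, i < j -> j <= h -> x i != x j,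
      forall i, i <= h -> x i \in Z,
      forall z, z \in Z -> exists2 i, i <= h & z = x i &
      [/\ forall z, z \in Z -> (m z \in Z) && (n z \in Z),
          forall z, z \in Z -> ((m z == z) = (z == x h)) /\ ((n z == z) = (z == y)) &
          maxmatch S (switch Z m n)]].
Proof.
move=> [mm mmin] [nn nmin] ny yS.
have [h [Z [inj inZ Zin clo]]] := alternating_switch mm nn ny yS.
have clo' z : z \in Z -> (n z \in Z) && (m z \in Z) by rewrite andbC => /clo.
case: ifP => [oh [c _ _]|oh [c _ fixed]].
  have := nmin _ (matchfun_switch nn mm clo'); lia.
exists h, Z; split=> //; first by rewrite oh.
split=> //; split; first exact: matchfun_switch.
by move=> p /mmin; rewrite c.
Qed.

(** Meant for an exposed [x]. If [y] is exposed too, the third test never applies and the result is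
    an augmentation, so one definition serves both cases. *)
Definition rematch m x y z :=
  if z == x then y else if z == y then x else if z == m y then z else m z.

Lemma matchfun_rematch S m x y : matchfun S m -> m x = x -> x \in S -> y \in S ->
  adj x y -> matchfun S (rematch m x y).
Proof.
move=> [mK madj mS] mx xS yS xy; have nxy := adj_neq xy.
split=> z; rewrite /rematch.
- have := mK z; have := mK y; move/eqP: nxy => nxy.
  case: (z =P x) => zx; [|case: (z =P y) => zy; [|case: (z =P m y) => zmy]];
    by repeat case: eqP => [?|?]; congruence.
- case: (altP (z =P x)) => [->|zx] //.
  case: (altP (z =P y)) => [->|zy]; first by rewrite adj_sym.
  by case: ifP; rewrite ?eqxx // => _; apply: madj.
- case: (altP (z =P x)) => [->|zx] //.
  case: (altP (z =P y)) => [->|zy] //.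
  by case: ifP; rewrite ?eqxx // => _; apply: mS.
Qed.

(** An exposed [y] would allow an augmentation. Otherwise the set of exposed vertices only trades
    [x] for [m y]. *)
Lemma exchange S m x y : maxmatch S m -> m x = x -> x \in S -> y \in S ->
  adj x y -> m y != y /\ maxmatch S (rematch m x y).
Proof.
move=> [mm mmin] mx xS yS xy; have nxy := adj_neq xy.
have mr := matchfun_rematch mm mx xS yS xy; have [mK _ mS] := mm.
case: (altP (m y =P y)) => my.
  have E : free S m = x |: (y |: free S (rematch m x y)).
    apply/setP => z; rewrite !inE /rematch my.
    case: (altP (z =P x)) => [->|zx]; first by rewrite xS mx eqxx.
    by case: (altP (z =P y)) => [->|zy] //; rewrite yS my eqxx.
  have := mmin _ mr; rewrite E cardsU1 cardsU1 !inE /rematch eqxx.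
  by rewrite [y == x]eq_sym (negPf nxy) eqxx /= ?andbF /=; lia.
split=> //; split=> // n /mmin; suff -> : #|free S m| = #|free S (rematch m x y)| by [].
have myx : m y != x by apply/eqP => e; move: nxy; rewrite -(mK y) e mx eqxx.
have myS : m y \in S by apply: mS; rewrite mK eq_sym.
have E : x |: free S (rematch m x y) = m y |: free S m.
  apply/setP => z; rewrite !inE /rematch.
  case: (altP (z =P x)) => [->|zx]; first by rewrite xS mx eqxx orbT.
  case: (altP (z =P y)) => [->|zy].
    by rewrite [y == m y]eq_sym (negPf my) /= [x == y](negPf nxy) andbF.
  by case: (altP (z =P m y)) => [->|//]; rewrite myS eqxx.
have /eqP := congr1 (fun A : {set G} => #|A|) E; rewrite !cardsU1 !inE /rematch eqxx.
rewrite mK [y == m y]eq_sym (negPf my) [y == x]eq_sym (negPf nxy) !andbF /=.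
by rewrite !add1n eqSS => /eqP.
Qed.

Lemma exchangeE S m x y : maxmatch S m -> m x = x -> x \in S -> y \in S -> adj x y ->
  exists n, [/\ maxmatch S n, n (m y) = m y, n x = y, n y = x
    & forall z, z != x -> z != y -> z != m y -> n z = m z].
Proof.
move=> mm mx xS yS xy; have [my mr] := exchange mm mx xS yS xy.
have nxy := adj_neq xy; have [[mK _ _] _] := mm.
exists (rematch m x y); rewrite /rematch; split=> //.
- have /negPf -> : m y != x by apply/eqP => e; move: nxy; rewrite -(mK y) e mx eqxx.
  by rewrite (negPf my) eqxx.
- by rewrite eqxx.
- by rewrite eq_sym (negPf nxy) eqxx.
- by move=> z /negPf -> /negPf -> /negPf ->.
Qed.

(** The exposed vertex moves along the path two places at a time, by one exchange along an edge of
    [m]. The invariant is that the current matching still agrees with [n] beyond the exposed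
    vertex. *)
Lemma missable_even S m n y h : maxmatch S m -> maxmatch S n -> n y = y -> y \in S ->
  let x := alt_orbit m n y in
  (forall i j, i < j -> j <= h -> x i != x j) ->
  forall k, k.*2 <= h -> missable S (x k.*2).
Proof.
move=> mm nn ny yS x inj k.
have [[mK madj mS] _] := mm; have [[nK nadj nS] _] := nn.
have xS i : i <= h -> x i \in S.
  case: i => [|i] ih //.
  have: x i != x i.+1 by apply: inj.
  rewrite /x alt_orbitS -/x; case: (odd i) => ne.
    by apply: nS; rewrite nK.
  by apply: mS; rewrite mK.
suff P : k.*2 <= h -> exists n', [/\ maxmatch S n', n' (x k.*2) = x k.*2
    & forall j, k.*2 < j -> j <= h -> n' (x j) = n (x j)].
  by move=> kh; split; [exact: xS | have [n' [? ? _]] := P kh; exists n'].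
elim: k => [|k IH] kh; first by exists n.
have [|n' [mn' nx' nj]] := IH; first by lia.
have e1 : x k.*2.+1 = m (x k.*2) by rewrite /x alt_orbitS odd_double.
have e2 : x k.*2.+2 = n (x k.*2.+1) by rewrite /x alt_orbitS /= odd_double.
have a1 : adj (x k.*2) (x k.*2.+1).
  by rewrite e1; apply: madj; rewrite -e1 eq_sym inj //; lia.
have [||n'' [mn'' f _ _ oth]] := exchangeE mn' nx' _ _ a1; rewrite ?xS; try lia.
rewrite nj in f oth; try lia; rewrite -e2 in f oth; exists n''; split=> //.
move=> j kj jh; rewrite oth; try by rewrite eq_sym inj //; lia.
by rewrite nj //; lia.
Qed.

End PartnerFunctions.

(** * Dictionary between sets of edges and involutions *)

Section MatchingSets.
Variable G : sgraph.
Implicit Types (M : {set {set G}}) (m n : G -> G) (x y z : G).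

Lemma set2_inj x y z t : [set x; y] = [set z; t] -> (x = z /\ y = t) \/ (x = t /\ y = z).
Proof.
move=> /setP e; have := e x; have := e y; have := e z; have := e t.
rewrite !inE !eqxx ?orbT /=.
by case: (z =P x); case: (t =P x); case: (z =P y); case: (t =P y) => *; subst; auto;
  repeat match goal with H : true = _ |- _ => move/esym/orP: H => [/eqP|/eqP] * end; subst;
    auto.
Qed.

(** The default [x] makes the unsaturated vertices fixed points. *)
Definition mate M x := odflt x [pick y | (x != y) && ([set x; y] \in M)].

Definition matching_of m : {set {set G}} := [set [set x; m x] | x in [pred x | m x != x]].

Lemma in_matching_of m x y : involutive m ->
  ([set x; y] \in matching_of m) = (m x == y) && (x != y).
Proof.
move=> mK; apply/imsetP/andP => [[z]|[/eqP <- ne]].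
  rewrite inE => ne /set2_inj [[-> ->]|[-> ->]]; rewrite ?mK; by rewrite eqxx // eq_sym.
by exists x => //; rewrite inE eq_sym.
Qed.

Lemma matching_edge M x y : matching M -> [set x; y] \in M -> adj x y.
Proof.
case/andP=> /subsetP Me _ /Me /imsetP[[a b] /=]; rewrite inE /= => ab.
by case/set2_inj => -[-> ->] //; rewrite adj_sym.
Qed.

Lemma mate_eq M x y : matching M -> x != y -> (mate M x == y) = ([set x; y] \in M).
Proof.
move=> MM ne; have /trivIsetP triv := (andP MM).2; rewrite /mate.
case: pickP => [z /andP[xz zM]|none] /=; last first.
  by rewrite (negPf ne); have := none y; rewrite /= ne.
apply/eqP/idP => [<- //|yM]; apply/eqP; case: (altP ([set x; z] =P [set x; y])) => [e|e].
  by case/set2_inj: e => [[_ ->]|[e _]]; [rewrite eqxx | rewrite e eqxx in ne].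
by have := triv _ _ zM yM e; rewrite -setI_eq0 => /eqP/setP/(_ x); rewrite !inE eqxx.
Qed.

Lemma matchfun_mate M : matching M -> matchfun setT (mate M).
Proof.
move=> MM; split=> // x; last first.
  by rewrite eq_sym => ne; have := eqxx (mate M x); rewrite mate_eq //; apply: matching_edge.
case: (altP (mate M x =P x)) => [e|ne]; first by rewrite !e.
by apply/eqP; rewrite mate_eq // setUC -mate_eq // eq_sym.
Qed.

Lemma mateK M : matching M -> matching_of (mate M) = M.
Proof.
move=> MM; have [mK _ _] := matchfun_mate MM; apply/setP => f; apply/idP/idP.
  case/imsetP => x; rewrite inE => ne ->.
  by rewrite -mate_eq // eq_sym.
move=> fM; have /andP[/subsetP Me _] := MM; have /imsetP[[a b] /=] := Me _ fM.
rewrite inE /= => ab e; rewrite e in fM *.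
by rewrite in_matching_of // mate_eq ?adj_neq // fM.
Qed.

Lemma matching_matching_of m : matchfun setT m -> matching (matching_of m).
Proof.
move=> [mK madj _]; apply/andP; split.
  apply/subsetP => f /imsetP[x]; rewrite inE => /madj a ->.
  by apply/imsetP; exists (x, m x); rewrite ?inE.
apply/trivIsetP => f g /imsetP[x _ ->] /imsetP[y _ ->] ne.
rewrite -setI_eq0; apply/eqP/setP => z; rewrite !inE; apply/negbTE; apply: contra ne.
case/andP=> /orP[]/eqP-> /orP[]/eqP e.
- by rewrite e.
- by rewrite e mK setUC.
- by rewrite -e mK setUC.
- by rewrite (inv_inj mK e).
Qed.

Lemma saturatedE m x : matchfun setT m -> saturated (matching_of m) x = (m x != x).
Proof.
move=> [mK madj _]; apply/bigcupP/idP => [[f /imsetP[y]]|ne].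
  by rewrite inE => ne ->; rewrite !inE => /orP[]/eqP-> //; rewrite mK eq_sym.
by exists [set x; m x]; rewrite ?inE ?eqxx //; apply/imsetP; exists x.
Qed.

(** This count turns maximum cardinality into a minimum number of exposed vertices. *)
Lemma card_matching_of m : matchfun setT m ->
  #|matching_of m| * 2 + #|free setT m| = #|G|.
Proof.
move=> mm; have [mK madj _] := mm; have /andP[_ triv] := matching_matching_of mm.
have -> : #|matching_of m| * 2 = #|cover (matching_of m)|.
  rewrite -(eqP triv) (eq_bigr (fun=> 2)) ?sum_nat_const // => f /imsetP[x].
  by rewrite inE => ne ->; rewrite cards2 eq_sym ne.
have -> : free setT m = ~: cover (matching_of m).
  by apply/setP => x; have := saturatedE x mm; rewrite !inE /saturated => ->; rewrite negbK.
by rewrite cardsC.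
Qed.

Lemma maximum_matching_of m : matchfun setT m ->
  maximum_matching (matching_of m) <-> maxmatch setT m.
Proof.
move=> mm; have e := card_matching_of mm; split.
  case/andP=> _ /forallP mx; split=> // n nm; have e' := card_matching_of nm.
  have := implyP (mx (matching_of n)) (matching_matching_of nm); lia.
case=> _ mx; apply/andP; split; first exact: matching_matching_of.
apply/forallP => M; apply/implyP => MM.
have e' := card_matching_of (matchfun_mate MM); rewrite mateK // in e'.
have := mx _ (matchfun_mate MM); lia.
Qed.

Lemma maximum_mate M : maximum_matching M -> maxmatch setT (mate M).
Proof.
move=> MM; have /andP[mM _] := MM; apply/maximum_matching_of; first exact: matchfun_mate.
by rewrite mateK.
Qed.

Lemma maxmatch_ex : exists m : G -> G, maxmatch setT m.
Proof.
have ex : exists k, `[< exists2 m : G -> G, matchfun setT m & #|free setT m| = k >].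
  exists #|free setT (@id G)|; apply/asboolP; exists id => //.
  by split=> // x; rewrite eqxx.
case: (ex_minnP ex) => k /asboolP[m mm mk] kmin; exists m; split=> // n nm.
by rewrite mk; apply: kmin; apply/asboolP; exists n.
Qed.

Lemma gallai_DP x : x \in gallai_D G <-> missable setT x.
Proof.
rewrite inE; split=> [/existsP[M /andP[MM s]]|[_ [m mm e]]].
  have /andP[mM _] := MM; split=> //; exists (mate M); first exact: maximum_mate.
  by apply/eqP/negPn; rewrite -saturatedE ?mateK //; apply: matchfun_mate.
have [fm _] := mm; apply/existsP; exists (matching_of m).
by rewrite saturatedE // e eqxx andbT; apply/maximum_matching_of.
Qed.

End MatchingSets.

(** * Gallai--Edmonds structure *)

Section Stability.
Variable G : sgraph.
Implicit Types (S Z : {set G}) (m n : G -> G) (x y z a r : G).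

(** Both ends of an edge meeting [B] become fixed, so the map remains an involution. *)
Definition drop_match (B : pred G) m x := if B x || B (m x) then x else m x.

Lemma matchfun_drop S B m : matchfun S m ->
  matchfun (S :\: [set x | B x]) (drop_match B m).
Proof.
move=> [mK madj mS]; rewrite /drop_match; split=> x.
- by case e: (B x || B (m x)); rewrite ?e // mK orbC e.
- by case: ifP => _; [rewrite eqxx | apply: madj].
- case: ifP => [|/negbT]; rewrite ?eqxx // negb_or !inE => /andP[-> _] ne.
  by rewrite (mS _ ne).
Qed.

Lemma matchfun_sub S S' m : S \subset S' -> matchfun S m -> matchfun S' m.
Proof. by move=> /subsetP s [mK madj mS]; split=> // x /mS /s. Qed.

Lemma matchfun_fix S m x : matchfun S m -> x \notin S -> m x = x.
Proof. by move=> [_ _ mS] xS; apply/eqP/negPn/negP => /mS; apply/negP. Qed.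

Section Step.
Variables (S : {set G}) (a r : G).
Hypotheses (aS : a \in S) (aD : ~ missable S a) (rD : missable S r) (ar : adj a r).

Let card_free_del n : matchfun (S :\ a) n ->
  #|free S n| = #|free (S :\ a) n|.+1.
Proof.
move=> nn; have na : n a = a by apply: (matchfun_fix nn); rewrite !inE eqxx.
have -> : free S n = a |: free (S :\ a) n.
  by apply/setP => x; rewrite !inE; case: (altP (x =P a)) => //= ->; rewrite aS na eqxx.
by rewrite cardsU1 !inE eqxx.
Qed.

(** The alternating path from [a] is not even, as switching [m] on it would give a maximum matching
    missing [a]. So it augments [n], which therefore exposes at least two vertices more than [m]. *)
Let gap m n : maxmatch S m -> matchfun S n -> n a = a -> #|free S m| + 2 <= #|free S n|.
Proof.
move=> [mm mmin] nn na.
have [h [Z [_ inZ _ clo]]] := alternating_switch mm nn na aS.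
have clo' z : z \in Z -> (n z \in Z) && (m z \in Z) by rewrite andbC => /clo.
case: ifP => _ [E1 E2 _]; first by have := mmin _ (matchfun_switch nn mm clo'); lia.
case: aD; split=> //; exists (switch Z m n); last first.
  by rewrite /switch ifT // -[a]/(alt_orbit m n a 0) inZ.
by split; [apply: matchfun_switch | rewrite E1].
Qed.

Lemma free_drop1 m : matchfun S m -> m a != a ->
  #|free (S :\ a) (drop_match (pred1 a) m)| = #|free S m|.+1.
Proof.
move=> [mK _ mS] ma.
have -> : free (S :\ a) (drop_match (pred1 a) m) = m a |: free S m.
  apply/setP => x; rewrite !inE /drop_match /=.
  case: (altP (x =P a)) => [->|xa] /=; first by rewrite [a == m a]eq_sym !(negPf ma) andbF.
  rewrite -[m x == a](inj_eq (inv_inj mK)) mK.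
  case: (altP (x =P m a)) => [->|//]; rewrite eqxx andbT mS //.
  by rewrite mK eq_sym.
by rewrite cardsU1 inE mK [a == _]eq_sym (negPf ma) andbF.
Qed.

(** A matching of G[S - a] exposes one more vertex, namely [a], when read in G[S]. The two vertices
    of [gap] thus leave exactly the one that dropping [a] exposes. *)
Lemma maxmatch_drop1 m : maxmatch S m -> maxmatch (S :\ a) (drop_match (pred1 a) m).
Proof.
move=> mm; have [fm mmin] := mm; have [mK _ _] := fm.
have ma : m a != a by apply/eqP => e; apply: aD; split=> //; exists m.
split.
  have := matchfun_drop (pred1 a) fm; congr (matchfun (_ :\: _) _).
  by apply/setP => x; rewrite !inE.
move=> n nn; rewrite free_drop1 // -ltnS -card_free_del // -[_.+2]addn2.
apply: gap mm _ _; first exact: matchfun_sub (subsetDl _ _) nn.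
by apply: (matchfun_fix nn); rewrite !inE eqxx.
Qed.

(* If the alternating path from y ends at a, matching a with the exposed r
   instead yields a maximum matching missing y. *)
Lemma missable_drop1 y : missable (S :\ a) y <-> missable S y.
Proof.
split=> [[ySa [n mn ny]]|[yS [m mm my]]]; last first.
  split; last first.
    by exists (drop_match (pred1 a) m); [apply: maxmatch_drop1 | rewrite /drop_match my;
      case: ifP].
  by rewrite !inE yS andbT; apply/eqP => e; apply: aD; rewrite -e; split=> //; exists m.
have [ya yS] : y != a /\ y \in S by move: ySa; rewrite !inE => /andP[].
apply: contrapT => yD.
have [fn nmin] := mn; have nn : matchfun S n := matchfun_sub (subsetDl _ _) fn.
have na : n a = a by apply: (matchfun_fix fn); rewrite !inE eqxx.
have [rS [m mm mr]] := rD; have [fm mmin] := mm; have [mK madj mS] := fm.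
have [h [Z [inj inZ Zin clo]]] := alternating_switch fm nn ny yS.
have clo' z : z \in Z -> (n z \in Z) && (m z \in Z) by rewrite andbC => /clo.
have yZ : y \in Z by rewrite -[y]/(alt_orbit m n y 0) inZ.
case: ifP => oh [E1 E2 fixed]; last first.
  apply: yD; split=> //; exists (switch Z m n); last by rewrite /switch yZ.
  by split; [apply: matchfun_switch | rewrite E1].
(* The path augments [n]; if it avoided [a], the augmentation would take place inside [S :\ a],
   where [n] is maximum. *)
have aZ : a \in Z.
  apply/negPn/negP => aZ.
  have f' : matchfun (S :\ a) (switch Z n m).
    have [K adj' inS'] := matchfun_switch nn fm clo'; split=> // x ne.
    rewrite !inE inS' // andbT; apply: contra ne => /eqP ->.
    by rewrite /switch (negPf aZ) na.
  have := nmin _ f'; have := card_free_del f'; have := card_free_del fn; lia.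
have rZ : r \notin Z by apply/negP => /fixed[]; rewrite mr eqxx.
(* [m1] exposes both ends [y] and [a] of the path, two vertices more than [m]; the edge between [a]
   and the exposed [r] wins the two back while [y] stays exposed. *)
set m1 := switch Z m n in E2.
have f1 : matchfun S m1 by apply: matchfun_switch.
have f2 := matchfun_rematch f1 (_ : m1 r = r) rS aS (_ : adj r a).
have := f2; rewrite /m1 /switch (negPf rZ) mr adj_sym => /(_ erefl ar) {}f2.
apply: yD; split=> //; exists (rematch m1 r a); last first.
  rewrite /rematch (negPf ya) /m1 /switch aZ na yZ (negPf ya).
  by case: eqP => // e; rewrite -e yZ in rZ.
split=> // p /mmin; apply: leq_trans.
have [K _ _] := f1.
have m1r : m1 r = r by rewrite /m1 /switch (negPf rZ).
have m1a : m1 a = a by rewrite /m1 /switch aZ.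
have ra : r != a by rewrite eq_sym adj_neq.
have : free S m1 = r |: (a |: free S (rematch m1 r a)).
  apply/setP => z; rewrite !inE /rematch.
  case: (altP (z =P r)) => [->|zr]; first by rewrite rS m1r eqxx.
  case: (altP (z =P a)) => [->|za]; first by rewrite aS m1a eqxx.
  by rewrite m1a (negPf za).
move/(congr1 (fun B : {set G} => #|B|)); rewrite !cardsU1 !inE /rematch eqxx.
rewrite ?[a == r]eq_sym ?(negPf ra) ?eqxx ?andbF /=; lia.
Qed.

End Step.

Definition setN (s : seq G) : {set G} := [set x | x \notin s].

(** Deleting one vertex of A leaves the missable vertices unchanged, so the next vertex of A is
    again not missable and still adjacent to a missable one. *)
Lemma stability (s : seq G) : uniq s -> {subset s <= gallai_A G} ->
  (forall x, missable (setN s) x <-> x \in gallai_D G) /\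
  forall m, maxmatch setT m -> maxmatch (setN s) (drop_match (mem s) m).
Proof.
elim: s => [|a s IH] /= => [_ _|/andP[as_ us] sub].
  have -> : setN [::] = setT by apply/setP => x; rewrite !inE.
  split=> [x|m]; first by rewrite gallai_DP.
  by congr (maxmatch _ _); apply: funext => x; rewrite /drop_match.
have [|IHD IHm] := IH us; first by move=> x xs; apply: sub; rewrite inE xs orbT.
have aA : a \in gallai_A G by apply: sub; rewrite inE eqxx.
have /setDP[] := aA; rewrite inE => /existsP[r /andP[rD ar]] aD.
have aS : a \in setN s by rewrite inE.
have aD' : ~ missable (setN s) a by rewrite IHD => e; rewrite e in aD.
have rD' : missable (setN s) r by rewrite IHD.
have eS : setN (a :: s) = setN s :\ a.
  by apply/setP => x; rewrite !inE negb_or.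
rewrite eS; split=> [x|m /IHm mm]; first by rewrite (missable_drop1 aS aD' rD' ar).
have := maxmatch_drop1 aS aD' ar mm; congr (maxmatch _ _).
apply: funext => x; rewrite /drop_match /= !inE.
case: (altP (x =P a)) => [->//|xa] /=; case xs: (x \in s) => /=; first by rewrite (negPf xa).
case mxs: (m x \in s) => /=; first by rewrite (negPf xa) orbT.
by rewrite orbF.
Qed.

End Stability.

(** * The graph without A, and Gallai's lemma for the components of G[D] *)

Section GallaiEdmonds.
Variable G : sgraph.
Implicit Types (m n : G -> G) (x y z a r : G).
Notation D := (gallai_D G).
Notation A := (gallai_A G).

Definition dropA m := drop_match (mem (gallai_A G)) m.

Lemma dropA_max m : maxmatch setT m -> maxmatch (~: A) (dropA m).
Proof.
have [||_ H] := @stability G (enum A); rewrite ?enum_uniq //.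
  by move=> x; rewrite mem_enum.
move/H; have -> : setN (enum A) = ~: A by apply/setP => x; rewrite !inE mem_enum !inE.
congr (maxmatch _ _); apply: funext => x.
by rewrite /dropA /drop_match /= !mem_enum.
Qed.

Lemma missable_compl_A x : missable (~: A) x <-> x \in D.
Proof.
have [||H _] := @stability G (enum A); rewrite ?enum_uniq //.
  by move=> y; rewrite mem_enum.
rewrite -H; have -> // : setN (enum A) = ~: A.
by apply/setP => y; rewrite !inE mem_enum !inE.
Qed.

Lemma D_notA x : x \in D -> x \notin A.
Proof. by move=> xD; rewrite inE xD. Qed.

Lemma D_nbhd x y : x \in D -> adj x y -> y \notin A -> y \in D.
Proof.
move=> xD xy; rewrite inE negb_and negbK => /orP[//|]; rewrite inE => /existsP[].
by exists x; rewrite xD adj_sym.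
Qed.

(** Take [r] in D next to [a] and the alternating path of a matching missing [r]. If [a] is off the
    path, switching exposes [r], and an exchange along the edge [r a] exposes [m a]. If [a] is on
    it, its index is odd, since even indices belong to D, and [m a] is the preceding vertex, of even
    index. *)
Lemma A_mate_D m a : maxmatch setT m -> a \in A -> m a \in D.
Proof.
move=> mm /setDP[/[1!inE] /existsP[r /andP[/gallai_DP[_ [n mn nr]] ar]] aD].
have [h [Z [oh inj inZ Zin [clo fixed ms]]]] := maxmatch_switch mm mn nr (in_setT _).
have ev := missable_even mm mn nr (in_setT _) inj.
case aZ : (a \in Z); last first.
  have [||p [mp pf _ _ _]] := exchangeE ms (_ : _ r = r) (in_setT r) (in_setT a).
  - by rewrite /switch -{1}[r]/(alt_orbit m n r 0) inZ.
  - by rewrite adj_sym.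
  rewrite /switch aZ in pf.
  by apply/gallai_DP; split=> //; exists p.
have [i ih ai] := Zin _ aZ.
have oi : odd i.
  apply/negPn/negP => oi; move/negP: aD; apply; apply/gallai_DP.
  by rewrite ai -(even_halfK oi); apply: ev; rewrite even_halfK.
case: i oi ih ai => // i oi ih ai.
rewrite /= in oi; have [[mK _ _] _] := mm.
rewrite ai alt_orbitS (negPf oi) mK -(even_halfK oi); apply/gallai_DP; apply: ev.
by rewrite even_halfK // ltnW.
Qed.

Lemma connect_D_sym : connect_sym (adj_in D).
Proof.
by apply: sym_connect_sym => x y; apply/and3P/and3P => -[xD yD xy]; split; rewrite // adj_sym.
Qed.

(* "Never both missed" is transitive along a path of G[D]: if m misses both
   ends x, z and n misses the middle vertex w, then the alternating path of w
   ends at one of x, z only, and switching m on it misses w and the other. *)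
Lemma gallai_lemma x y : x \in D -> connect (adj_in D) x y ->
  forall m, maxmatch (~: A) m -> m x = x -> m y = y -> x = y.
Proof.
move=> xD /connectP[p]; elim/last_ind: p y => [|p z IH] y /=; first by move=> _ ->.
rewrite rcons_path last_rcons => /andP[pp /and3P[lD yD ly]] -> {y} m mm mx mz.
set w := last x p in lD ly.
have {}IH := IH w pp erefl.
have inS u : u \in D -> u \in ~: A by rewrite in_setC; apply: D_notA.
have [_ [n mn nw]] := (missable_compl_A w).2 lD.
apply: contrapT => xz.
case: (altP (m w =P w)) => mw.
  by have [] := exchange mm mw (inS _ lD) (inS _ yD) ly; rewrite mz eqxx.
have [h [Z [oh inj inZ Zin [clo fixed ms]]]] := maxmatch_switch mm mn nw (inS _ lD).
have wZ : w \in Z by rewrite -[w]/(alt_orbit m n w 0) inZ.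
have sw : switch Z m n w = w by rewrite /switch wZ.
case xZ : (x \in Z); last first.
  have xw : x = w by apply: (IH _ ms) => //; rewrite /switch xZ.
  by rewrite xw wZ in xZ.
case zZ : (z \in Z); last first.
  have [] := exchange ms sw (inS _ lD) (inS _ yD) ly.
  by rewrite /switch zZ mz eqxx.
have [ex _] := fixed _ xZ; have [ez _] := fixed _ zZ.
by apply: xz; move: ex ez; rewrite mx mz !eqxx => /esym/eqP -> /esym/eqP ->.
Qed.

(* For x in D: m does not match x inside its component of G[D]. *)
Definition dfree m x := (m x == x) || (m x \in A).

(** Dropping the edges at A exposes every [dfree] vertex and leaves a maximum matching of G - A, to
    which [gallai_lemma] applies. *)
Lemma dfree_uniq m x y : maxmatch setT m -> x \in D -> connect (adj_in D) x y ->
  dfree m x -> dfree m y -> x = y.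
Proof.
move=> mm xD xy fx fy.
have dd z : dfree m z -> dropA m z = z.
  by rewrite /dropA /drop_match /= => /orP[/eqP ->|->]; rewrite ?orbT //; case: ifP.
by apply: (gallai_lemma xD xy (dropA_max mm)); apply: dd.
Qed.

End GallaiEdmonds.

(** * Alternating paths as sequences of matching edges *)

Section Heads.
Variables (G : sgraph) (m : G -> G).
Hypothesis fm : matchfun setT m.
Implicit Types (x y u v b f : G) (us vs ss p c : seq G).
Notation M := (matching_of m).

Let mK : involutive m. Proof. by case: fm. Qed.
Let madj x : m x != x -> adj x (m x). Proof. by case: fm => _ H _; apply: H. Qed.

(* An mm-path u1, m u1, u2, m u2, ... is represented by its heads u1, u2, ... *)
Fixpoint flat us := if us is u :: us' then u :: m u :: flat us' else [::].
Definition step : rel G := fun u v => adj (m u) v.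


Lemma flat_cons u us : flat (u :: us) = u :: m u :: flat us. Proof. by []. Qed.

Lemma flat_cat us vs : flat (us ++ vs) = flat us ++ flat vs.
Proof. by elim: us => //= u us ->. Qed.

Lemma flat_rcons us u : flat (rcons us u) = flat us ++ [:: u; m u].
Proof. by rewrite -cats1 flat_cat. Qed.

Lemma mem_flat x us : (x \in flat us) = (x \in us) || (m x \in us).
Proof.
elim: us => [|u us IH] //; rewrite flat_cons !inE IH -[m x == u](inj_eq (inv_inj mK)) mK.
by case: (x == u); case: (x == m u); case: (x \in us).
Qed.

Lemma size_flat us : size (flat us) = (size us).*2.
Proof. by elim: us => // u us IH; rewrite flat_cons doubleS -IH. Qed.

(** Heads of the reversed path: each matching edge is now entered at its other end. *)
Definition rev_heads us := rev (map m us).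

Lemma flat_rev_heads us : flat (rev_heads us) = rev (flat us).
Proof.
elim: us => // u us IH; rewrite /rev_heads /= rev_cons flat_rcons -/(rev_heads us) IH mK.
by rewrite ?flat_cons !rev_cons -!cats1 -catA.
Qed.

Lemma mem_flat_rev_heads us : flat (rev_heads us) =i flat us.
Proof. by move=> x; rewrite flat_rev_heads mem_rev. Qed.

Lemma step_rev_heads us : sorted step us -> sorted step (rev_heads us).
Proof.
move=> sus; rewrite rev_sorted sorted_map; apply: sub_sorted sus => x y /=.
by rewrite /step /= mK adj_sym.
Qed.

Lemma uniq_flat_head u us : uniq (flat (u :: us)) ->
  [/\ u != m u, u \notin flat us, m u \notin flat us & uniq (flat us)].
Proof. by rewrite flat_cons /= inE negb_or => /and3P[/andP[-> ->] -> ->]. Qed.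

Lemma uniq_flat_ne us u : uniq (flat us) -> u \in us -> m u != u.
Proof.
elim: us => // w us IH /uniq_flat_head[ne _ _ un]; rewrite inE => /orP[/eqP ->|/IH ->//].
by rewrite eq_sym.
Qed.

Lemma path_flat u us : path step u us -> uniq (flat (u :: us)) ->
  path (@adj G) u (m u :: flat us).
Proof.
elim: us u => [|w us IH] u.
  by move=> _ /uniq_flat_head[ne _ _ _]; rewrite /= madj // eq_sym.
case/andP=> uw pw /uniq_flat_head[ne _ _ un].
rewrite /= madj 1?eq_sym //= [adj _ w]uw; exact: IH.
Qed.

Lemma in_M x y : ([set x; y] \in M) = (m x == y) && (x != y).
Proof. exact: in_matching_of. Qed.

Notation xorM := (fun f g : {set G} => (f \in M) (+) (g \in M)).

Lemma altern_flat u us : uniq (flat (u :: us)) ->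
  path xorM [set u; m u] (path_edges (m u) (flat us)).
Proof.
elim: us u => // w us IH u /uniq_flat_head[ne].
rewrite flat_cons !inE !negb_or => /andP[uw _] _ un.
have [ne' _ _ _] := uniq_flat_head un.
by rewrite /= !in_M !mK !eqxx ne (negPf uw) ne' /=; apply: IH.
Qed.

Lemma altern_flat_rcons u us f : uniq (rcons (flat (u :: us)) f) ->
  path xorM [set u; m u] (path_edges (m u) (rcons (flat us) f)).
Proof.
elim: us u => [|w us IH] u; rewrite rcons_uniq => /andP[fn] /uniq_flat_head[ne uw _ un'].
  rewrite /= !in_M mK eqxx ne andbT /=; apply/andP => -[/eqP e _].
  by rewrite -e flat_cons mem_head in fn.
move: uw fn; rewrite !flat_cons !inE !negb_or => /andP[uw _] /and3P[_ _ fn].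
have [ne' _ _ _] := uniq_flat_head un'.
rewrite /= !in_M !mK !eqxx ne (negPf uw) ne' /=; apply: IH.
by rewrite rcons_uniq un' flat_cons !inE !negb_or fn.
Qed.

Lemma last_flat u us x : last x (flat (u :: us)) = m (last u us).
Proof. by elim: us u x => // w us IH u x; rewrite /= -(IH w x). Qed.

Lemma last_edge_flat u us (f : {set G}) : last f (path_edges u (m u :: flat us)) =
  [set last u us; m (last u us)].
Proof. by elim: us u f => // w us IH u f; rewrite /= -(IH w f). Qed.

Lemma path_edges_rcons x p y : path_edges x (rcons p y) =
  rcons (path_edges x p) [set last x p; y].
Proof. by elim: p x => //= z p IH x; rewrite IH. Qed.

Lemma mm_path_flat u us : path step u us -> uniq (flat (u :: us)) ->
  mm_path M u (m u :: flat us).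
Proof.
move=> pus un; have [ne _ _ _] := uniq_flat_head un.
apply/and5P; split=> //.
- by rewrite /simple_path path_flat.
- exact: altern_flat.
- by rewrite in_M eqxx.
- by rewrite last_edge_flat in_M eqxx eq_sym (@uniq_flat_ne (u :: us)) // mem_last.
Qed.

Lemma alternating_heads p x : path (@adj G) x p -> alternating M x p ->
  (p != [::] -> head set0 (path_edges x p) \in M) ->
  exists2 us, sorted step us & if odd (size p) then x :: p = flat us
    else exists2 f, x :: p = rcons (flat us) f & sorted step (rcons us f).
Proof.
move: {2}(size p) (leqnn (size p)) => n; elim: n p x => [|n IH] [|y p] x //=.
- by exists [::] => //; exists x.
- by exists [::] => //; exists x.
rewrite ltnS => sp /andP[xy py] alt /(_ isT); rewrite in_M => /andP[/eqP e _].
case: p sp py alt => [|z p] /= sp py alt.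
  by exists [:: x] => //; rewrite flat_cons e.
case/andP: py => yz pz; rewrite /alternating /= in alt.
have [|||us sus] := IH p z _ pz; first by lia.
- by move: alt => /andP[_]; case: (p) => //= w q /andP[_].
- case: (p) alt => [//|w q] /= /and3P[+ + _] _.
  by rewrite in_M e eqxx adj_neq //= => /negPf ->.
rewrite negbK; case: (odd (size p)) => [e2|[f e2 s2]].
  exists (x :: us); last by rewrite e2 flat_cons e.
  by case: us sus e2 => //= u us -> [<- _]; rewrite /step e yz.
exists (x :: us); first by case: us sus e2 {s2} => //= u us -> [<- _]; rewrite /step e yz.
exists f; first by rewrite e2 flat_cons e.
by case: us s2 e2 {sus} => /= [_ [<- _]|u us -> [<- _]]; rewrite /step e yz.
Qed.

Lemma mm_path_heads x p : mm_path M x p -> exists2 us, path step x us &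
   x :: p = flat (x :: us).
Proof.
case/and5P=> /andP[px un] alt ne hd la.
have [us sus] := alternating_heads px alt (fun _ => hd).
case: ifP => [_|ev [f e _]].
  by case: us sus => // u us pus [-> ->]; exists us.
(* In the even case the last edge joins [m (last u us)] to [f]; being in the matching, it would make
   [f] repeat [last u us]. *)
exfalso; case: us e sus => [[_ e]|u us e _]; first by rewrite e in ne.
have e1 : path_edges x p = path_edges u (rcons (m u :: flat us) f).
  by case: e => -> ->.
have : last set0 (path_edges x p) = [set m (last u us); f].
  by rewrite e1 path_edges_rcons last_rcons -(last_flat u us u).
move=> e2; move: la un; rewrite e2 in_M mK => /andP[/eqP e3 _].
by rewrite e rcons_uniq (mem_flat _ (u :: us)) -e3 mem_last.
Qed.

(* The blossom with base b and remaining vertices [flat ss], in cyclic order. *)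
Definition rooted_blossom b ss := if ss is u :: us then
  [&& adj b u, path step u us, adj (m (last u us)) b & uniq (b :: flat ss)] else false.

Lemma count_flat u us : uniq (flat (u :: us)) ->
  count (mem M) (path_edges u (m u :: flat us)) = (size us).+1.
Proof.
elim: us u => [|w us IH] u un; have [ne uw _ un'] := uniq_flat_head un.
  by rewrite /= in_M eqxx ne.
have -> : path_edges u (m u :: flat (w :: us)) =
   [set u; m u] :: [set m u; w] :: path_edges w (m w :: flat us) by [].
have uw' : u != w by move: uw; rewrite flat_cons inE negb_or => /andP[].
have step1 g h r : g \in M -> h \notin M -> count (mem M) (g :: h :: r) = (count (mem M) r).+1.
  by move=> /= -> /negPf ->.
by rewrite step1 ?IH // in_M ?mK ?eqxx ?(negPf uw').
Qed.

Lemma edge_flat (f : {set G}) u us : f \in path_edges u (m u :: flat us) -> f \in M ->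
  uniq (flat (u :: us)) -> exists2 v, v \in u :: us & f = [set v; m v].
Proof.
elim: us u => [|w us IH] u.
  by rewrite inE => /eqP -> _ _; exists u; rewrite ?inE ?eqxx.
rewrite [path_edges _ _]/= !inE => /or3P[/eqP ->|/eqP ->|fe] fM /uniq_flat_head[ne uw _ un'].
- by exists u; rewrite ?inE ?eqxx.
- by move: fM uw; rewrite in_M mK inE => /andP[->].
- by have [v vus ->] := IH w fe fM un'; exists v; rewrite // inE vus orbT.
Qed.

Lemma rooted_blossom_blossom b ss : rooted_blossom b ss ->
  blossom M (b :: flat ss) && base M (b :: flat ss) b.
Proof.
case: ss => // u us /and4P[bu pus lb /= /andP[bn un]].
have un' : uniq (flat (u :: us)) by [].
have [ne _ _ _] := uniq_flat_head un'.
have bM x : [set b; x] \in M -> x \in flat (u :: us) -> False.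
  rewrite in_M => /andP[/eqP <- _]; rewrite mem_flat mK.
  by move: bn; rewrite -[_ :: _]/(flat (u :: us)) mem_flat; case: (b \in _); case: (m b \in _).
have ce : cycle_edges (b :: flat (u :: us)) =
  [set b; u] :: rcons (path_edges u (m u :: flat us)) [set m (last u us); b].
  rewrite /cycle_edges -[flat (u :: us)]/(u :: m u :: flat us) /=.
  rewrite path_edges_rcons; congr (_ :: _ :: rcons _ [set _; _]).
  by case: (us) => //= w us'; rewrite -[LHS]/(last (m u) (flat (w :: us'))) last_flat.
have b1 : [set b; u] \notin M by apply/negP => /bM; apply; rewrite mem_flat inE eqxx.
have b2 : [set m (last u us); b] \notin M.
  by rewrite setUC; apply/negP => /bM; apply; rewrite mem_flat mK mem_last orbT.
apply/andP; split.
  apply/and4P; split.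
  - by rewrite /= ?ltnS.
  - apply/andP; split; last by apply/andP.
    rewrite /cycle rcons_path; have := path_flat pus un'; rewrite /= bu => -> /=.
    by rewrite -[last _ _]/(last u (flat (u :: us))) last_flat.
  - by rewrite /= size_flat negbK odd_double.
  - have sf := size_flat (u :: us).
    rewrite ce -cat1s count_cat -cats1 count_cat count_flat //.
    rewrite /= (negPf b1) (negPf b2) !addn0 add0n.
    by move: sf => /= -[->]; rewrite /= uphalf_double.
rewrite /base inE eqxx ce; apply/allP => f; rewrite inE mem_rcons inE.
case/or3P=> [/eqP->|/eqP->|fe]; rewrite ?(negPf b1) ?(negPf b2) //.
apply/implyP => fM; have [v vus ->] := edge_flat fe fM un'.
rewrite !inE negb_or; move: bn; rewrite -[_ :: _]/(flat (u :: us)) mem_flat negb_or.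
case/andP=> b3 b4; apply/andP; split; apply/eqP => e; move: b3 b4; rewrite e ?mK vus //.
Qed.

(** Recovers alternation from the edge count that defines a blossom: consecutive edges of a simple
    path are not both in the matching, and reaching the bound [k.+1] forces every second edge,
    beginning with the first. *)
Lemma heads_of_count k x p : size p = k.*2.+1 -> uniq (x :: p) -> path (@adj G) x p ->
  count (mem M) (path_edges x p) <= k.+1 /\
  (count (mem M) (path_edges x p) = k.+1 ->
   exists2 us, path step x us & x :: p = flat (x :: us)).
Proof.
elim: k x p => [|k IH] x [|y p] //=.
  case: p => //= _ _ _; rewrite addn0; split; first by case: (_ \in _).
  by case xM : (_ \in _) => // _; exists [::] => //; move: xM; rewrite in_M => /andP[/eqP <-].
case: p => //= z p [sp] /and4P[xn yn zn un] /and3P[xy yz pz].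
have [|c1 c2] := IH z p sp _ pz; first by rewrite /= zn.
have e12 : ([set x; y] \in M) + ([set y; z] \in M) <= 1.
  rewrite !in_M; case: (m x =P y) => e; case: (m y =P z) => e2 /=;
    rewrite ?addn0 ?leq_b1 ?add0n ?leq_b1 //.
  by move: xn; rewrite -e2 -e mK !inE eqxx !orbT.
move: e12 c1 c2; set b1 := nat_of_bool _; set b2 := nat_of_bool _; set c := count _ _.
move=> e12 c1 c2; split; first by lia.
move=> e; have e3 : c = k.+1 by lia.
have [us pus eus] := c2 e3; have e4 : b1 + b2 = 1 by lia.
rewrite /b1 /b2 in e4.
have : [set y; z] \notin M.
  apply/negP; rewrite in_M => /andP[/eqP e5 _].
  have : y \in z :: p by rewrite eus mem_flat e5 mem_head orbT.
  by rewrite (negPf yn).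
move=> yM; have : [set x; y] \in M by move: e4 yM; do 2 case: (_ \in M).
rewrite in_M => /andP[/eqP e6 _]; exists (z :: us); first by rewrite /= /step e6 yz.
by rewrite eus flat_cons e6.
Qed.

Lemma cycle_edges_rot1 c : cycle_edges (rot 1 c) = rot 1 (cycle_edges c).
Proof.
case: c => // x [|y p] //; rewrite rot1_cons /= rot1_cons.
by rewrite path_edges_rcons last_rcons.
Qed.

Lemma size_cycle_edges c : size (cycle_edges c) = size c.
Proof. by case: c => //= x p; rewrite size_pairmap size_rcons. Qed.

Lemma cycle_edges_rot i c : cycle_edges (rot i c) = rot i (cycle_edges c).
Proof.
elim: i => [|i IH]; first by rewrite !rot0.
case: (ltnP i (size c)) => ic; last first.
  by rewrite !rot_oversize ?size_cycle_edges // ltnW.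
by rewrite !(@rotS _ i) ?size_cycle_edges // cycle_edges_rot1 IH.
Qed.

(** With the base rotated to the front, the two edges at it are outside the matching. The k matching
    edges of a cycle of length 2k+1 then lie on the remaining path of 2k-1 edges, where
    [heads_of_count] is extremal. *)
Lemma blossom_rooted c b : blossom M c -> base M c b ->
  exists2 ss, rooted_blossom b ss & exists i, rot i c = b :: flat ss.
Proof.
case/and4P=> sz /andP[cyc un] od /eqP cnt /andP[bc /allP bb].
have [i s e] := rot_to bc.
have szE : size c = (size s).+1 by rewrite -(size_rot i) e.
have {}un : uniq (b :: s) by rewrite -e rot_uniq.
have {}cyc : cycle (@adj G) (b :: s) by rewrite -e rot_cycle.
have {}cnt : count (mem M) (cycle_edges (b :: s)) = (size s).+1./2.
  by rewrite -e cycle_edges_rot -szE -cnt; apply/seq.permP; rewrite perm_rot.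
have {}bb (f : {set G}) : f \in cycle_edges (b :: s) -> f \in M -> b \notin f.
  by rewrite -e cycle_edges_rot mem_rot => /bb/implyP.
case: s e szE un cyc cnt bb => [|u s] e szE un cyc cnt bb; first by rewrite szE in sz.
rewrite szE /= negbK in od sz.
have es : cycle_edges (b :: u :: s) =
   [set b; u] :: rcons (path_edges u s) [set last u s; b].
  by rewrite /= path_edges_rcons.
have b1 : [set b; u] \notin M.
  apply/negP => H; have := bb _ _ H; rewrite es inE eqxx => /(_ isT).
  by rewrite !inE eqxx.
have b2 : [set last u s; b] \notin M.
  apply/negP => H; have := bb _ _ H; rewrite es inE mem_rcons inE eqxx orbT => /(_ isT).
  by rewrite !inE eqxx orbT.
move: cyc; rewrite /= rcons_path => /and3P[bu pus lb].
have [k ek] : exists k, size s = k.*2.+1.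
  by exists (size s)./2; rewrite -[LHS]odd_double_half; move: od; case: (odd _).
have hk : (size (u :: s)).+1./2 = k.+1 by rewrite /= ek /= uphalf_double.
have [_ H] := heads_of_count ek (andP un).2 pus.
move: cnt; rewrite hk es /= (negPf b1) -cats1 count_cat /= (negPf b2) !addn0 add0n.
move=> /H[us p2 eus]; exists (u :: us); last by exists i; rewrite e eus.
rewrite /rooted_blossom bu p2 -eus un andbT /=.
by have := last_flat u us u; rewrite -eus /= => <-.
Qed.

Lemma stem_heads b p : stem M b p -> exists us f,
  [/\ b :: p = rcons (flat us) f, sorted step (rcons us f) & m f = f].
Proof.
case/and4P=> /andP[px un] alt ev; rewrite saturatedE // negbK => /eqP uf.
case: p px un alt ev uf => [|y p] px un alt ev uf; first by exists [::], b.
(* An even alternating path that starts outside the matching ends with a matching edge, but its last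
   vertex is exposed. *)
have hd : [set b; y] \in M.
  apply/negPn/negP => hd; case: p px un alt ev uf => [|z p] //= px un alt ev uf.
  move: alt; rewrite /alternating /= (negPf hd) /= => /andP[yz alt].
  have [|us sus] := @alternating_heads (z :: p) y _ alt (fun _ => yz).
    by case/andP: px.
  rewrite /= -[odd _]negbK ev; case: us sus => // u us _ e.
  have un' : uniq (flat (u :: us)) by rewrite -e; case/andP: un.
  have := uniq_flat_ne un' (mem_last u us).
  have := last_flat u us y; rewrite -e /= => e2.
  by rewrite -e2 -{1}uf e2 mK eqxx.
have [us sus] := alternating_heads px alt (fun _ => hd).
rewrite (negPf ev) => -[f e sf]; exists us, f; split=> //.
by rewrite -[f](last_rcons b (flat us)) -e.
Qed.

Lemma stem_flat us f b p : b :: p = rcons (flat us) f -> sorted step (rcons us f) ->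
  uniq (b :: p) -> m f = f -> stem M b p.
Proof.
move=> e sus un mf; have lf : last b p = f by rewrite -[RHS](last_rcons b (flat us)) -e.
apply/and4P; split; last by rewrite saturatedE // lf mf eqxx.
- rewrite /simple_path un andbT; case: us e sus un => [[_ ->]//|u us] [-> ep].
  rewrite rcons_cons [sorted _ _]/= rcons_path => /andP[pus lf'].
  have -> : u :: p = rcons (flat (u :: us)) f by rewrite ep.
  rewrite rcons_uniq => /andP[_ un]; rewrite ep -[_ :: rcons _ _]/(rcons (m u :: flat us) f).
  rewrite rcons_path (path_flat pus un) -[last _ _]/(last u (flat (u :: us))) last_flat.
  exact: lf'.
- case: us e sus un => [[_ ->]//|u us] [-> ->] _ un.
  exact: (@altern_flat_rcons u us f).
- have /(congr1 size) : b :: p = rcons (flat us) f by [].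
  by rewrite size_rcons size_flat /= => -[->]; rewrite odd_double.
Qed.

End Heads.

(** * Good sets *)

Section Good.
Variable (G : sgraph).
Implicit Types (m n : G -> G) (I : {set G}) (x y u v b f : G) (us vs ss p c : seq G).
Notation D := (gallai_D G).
Notation A := (gallai_A G).

Lemma nbhdP (K : {set G}) x : reflect (exists2 y, y \in K & adj x y) (x \in nbhd K).
Proof.
rewrite /nbhd in_set; apply: (iffP existsP) => [[y /andP[]]|[y yK xy]]; exists y => //.
by rewrite yK.
Qed.

(** The second clause also excludes exposed neighbours: such a [y] is its own partner, hence would
    lie in [I] against independence. *)
Definition good m I := {in I &, forall x y, ~~ adj x y} /\
  forall x y, x \in I -> adj x y -> m y \in I.

Lemma good_indep m I x y : good m I -> x \in I -> adj x y -> y \notin I.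
Proof. by move=> [ind _] xI xy; apply/negP => yI; have := ind _ _ xI yI; rewrite xy. Qed.

(** Let [n] miss [y] and follow the alternating path from [y]. Inductively every vertex of even
    index has a neighbour in [I], so its partner under [m], the next vertex, is in [I]. The end of
    the path is its own partner, so it is in [I] and adjacent to [I]. *)
Lemma good_notD m I x y : maxmatch setT m -> good m I -> x \in I -> adj x y -> y \notin D.
Proof.
move=> mm gI xI xy; apply/negP => /gallai_DP[_ [n mn ny]].
have [[mK madj _] _] := mm; have [[nK nadj _] _] := mn.
have [h [Z [oh inj inZ Zin [clo fixed _]]]] := maxmatch_switch mm mn ny (in_setT _).
set w := alt_orbit m n y in inj inZ Zin.
have P k : k.*2 <= h -> exists2 z, z \in I & adj z (w k.*2).
  elim: k => [|k IH] kh; first by exists x.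
  have [|z zI zw] := IH; first by lia.
  exists (w k.*2.+1); first by rewrite /w alt_orbitS odd_double; apply: gI.2 zI zw.
  have -> : w k.+1.*2 = n (w k.*2.+1) by rewrite doubleS /w alt_orbitS /= odd_double.
  apply: nadj; rewrite eq_sym; have := inj k.*2.+1 k.*2.+2 (ltnSn _) kh.
  by rewrite [w k.*2.+2]/w alt_orbitS /= odd_double.
have [|z zI] := P h./2; first by rewrite even_halfK.
rewrite even_halfK // => zh.
have := (fixed _ (inZ h (leqnn h))).1; rewrite -/w eqxx => /eqP e.
have := gI.2 _ _ zI zh; rewrite e; apply/negP; exact: good_indep gI zI zh.
Qed.

(** * Alternating paths against a good set *)

Section Touch.
Variables (m : G -> G) (I : {set G}).
Hypotheses (fm : matchfun setT m) (gI : good m I).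
Let mK : involutive m. Proof. by case: fm. Qed.

(** The next head is a neighbour of [m u], so membership in [I] passes forward from partner to
    partner; in the same way it passes backward from head to head in [good_bwd]. *)
Lemma good_fwd u us : path (step m) u us -> m u \in I ->
  forall v, v \in u :: us -> m v \in I /\ m (last u us) \in I.
Proof.
elim: us u => [|w us IH] u /=; first by move=> _ uI v; rewrite inE => /eqP ->.
case/andP=> uw pw uI v; have wI : m w \in I by apply: gI.2 uI uw.
rewrite inE => /orP[/eqP ->|vus]; last exact: IH pw wI v vus.
by split=> //; apply: (IH w pw wI w (mem_head _ _)).2.
Qed.

Lemma good_bwd u us : path (step m) u us -> forall v, v \in u :: us -> v \in I -> u \in I.
Proof.
elim: us u => [|w us IH] u /=; first by move=> _ v; rewrite inE => /eqP ->.
case/andP=> uw pw v; rewrite inE => /orP[/eqP ->//|vus vI].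
have wI : w \in I by apply: IH pw v vus vI.
by rewrite -(mK u); apply: gI.2 wI _; rewrite adj_sym.
Qed.

(** Membership would run once round the cycle and put both ends of its last edge in [I]. *)
Lemma good_blossom_base b ss : rooted_blossom m b ss -> b \notin I.
Proof.
case: ss => // u us /and4P[bu pus lb _]; apply/negP => bI.
have uI : m u \in I by apply: gI.2 bI bu.
have [_ lI] := good_fwd pus uI (mem_head _ _).
by have := good_indep gI lI lb; rewrite bI.
Qed.

(** In whichever direction membership runs, it reaches a neighbour of [b] on the cycle, and the
    partner of [b] follows. *)
Lemma good_blossom_touch b ss x : rooted_blossom m b ss -> x \in flat m ss ->
  (x \in I) || (m x \in I) -> m b \in I.
Proof.
case: ss => // u us /and4P[bu pus lb _]; rewrite mem_flat // => xf xI.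
have [v vus vI] : exists2 v, v \in u :: us & (v \in I) || (m v \in I).
  case/orP: xf => xf; [by exists x | exists (m x) => //].
  by rewrite mK orbC.
case/orP: vI => vI.
  have uI := good_bwd pus vus vI.
  by apply: gI.2 uI _; rewrite adj_sym.
have uI' : m (last u us) \in I.
  have : exists p q, us = p ++ q /\ last u p = v.
    by case/splitPl: vus => p q lp; exists p, q.
  case=> p [q [e lp]]; rewrite e in pus *; rewrite cat_path lp in pus; case/andP: pus => _ pq.
  by rewrite last_cat lp; have [] := good_fwd pq vI (mem_head _ _).
exact: gI.2 uI' lb.
Qed.

Lemma path_touch u us v : path (step m) u us -> v \in flat m (u :: us) ->
  (v \in I) || (m v \in I) -> (u \in I) || (m (last u us) \in I).
Proof.
move=> pus vf vI.
have [w wus wI] : exists2 v, v \in u :: us & (v \in I) || (m v \in I).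
  move: vf; rewrite mem_flat // => /orP vf.
  case: vf => vf; [by exists v | exists (m v) => //].
  by rewrite mK orbC.
case/orP: wI => wI; first by rewrite (good_bwd pus wus wI).
apply/orP; right.
have : exists p q, us = p ++ q /\ last u p = w.
  by case/splitPl: wus => p q lp; exists p, q.
case=> p [q [e lp]]; rewrite e in pus *; rewrite cat_path lp in pus; case/andP: pus => _ pq.
by rewrite last_cat lp; have [] := good_fwd pq wI (mem_head _ _).
Qed.

(** Membership runs along the Tposy until it reaches one of the two bases, where [good_blossom_base]
    forbids it. *)
Lemma tposy_not_good v : in_tposy (matching_of m) v -> (v \notin I) && (m v \notin I).
Proof.
case=> c1 [c2 [x [p [[/andP[b1 s1] /andP[b2 s2] mp _ _] vin]]]].
rewrite -negb_or; apply/negP => vI.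
have [us pus e] := mm_path_heads fm mp.
have lp : last x p = m (last x us) by rewrite -(last_flat m x us x) -e.
have [ss1 bl1 [i1 r1]] := blossom_rooted fm b1 s1.
have [ss2 bl2 [i2 r2]] := blossom_rooted fm b2 s2.
have n1 := good_blossom_base bl1; have n2 := good_blossom_base bl2.
have fwd : m x \in I -> False.
  by move=> xI; have [_] := good_fwd pus xI (mem_head _ _); rewrite -lp (negPf n2).
have bwd : m (last x p) \in I -> False.
  by rewrite lp mK => /(good_bwd pus (mem_last _ _)); rewrite (negPf n1).
move: vin; rewrite mem_cat -(mem_rot i1 c1) r1 mem_cat -(mem_rot i2 c2) r2 e inE.
case/or3P=> [|h|h].
- case/orP=> [/eqP h|h]; last exact: fwd (good_blossom_touch bl1 h vI).
  by move: vI; rewrite h (negPf n1) /= => /fwd.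
- case/predU1P: h => [h|h]; last exact: bwd (good_blossom_touch bl2 h vI).
  by move: vI; rewrite h (negPf n2) /= => /bwd.
- by case/orP: (path_touch pus h vI); rewrite -?lp ?(negPf n1) ?(negPf n2).
Qed.

(** Membership running towards the exposed end [f] turns round there, [f] being its own partner, and
    comes back to the base. *)
Lemma tflower_not_good v : in_tflower (matching_of m) v -> (v \notin I) && (m v \notin I).
Proof.
case=> c [b [p [/and4P[bl bs stemP _] vin]]].
rewrite -negb_or; apply/negP => vI.
have [us [f [e sf mf]]] := stem_heads fm stemP.
have [ss bls [i r]] := blossom_rooted fm bl bs.
have n1 := good_blossom_base bls.
have fI : f \in I -> False.
  case: us e sf => [[<- _]|u us [eb _]]; first by rewrite (negPf n1).
  rewrite /= rcons_path => /andP[pus lf] fI.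
  have : last u us \in I by rewrite -(mK (last _ _)); apply: gI.2 fI _; rewrite adj_sym.
  by move/(good_bwd pus (mem_last _ _)); rewrite -eb (negPf n1).
have bI : m b \in I -> False.
  case: us e sf => [[-> _]|u us [-> _]]; first by rewrite mf => _ /fI.
  rewrite /= rcons_path => /andP[pus lf] uI.
  have [_ lI] := good_fwd pus uI (mem_head _ _).
  by have := gI.2 _ _ lI lf; rewrite mf => /fI.
move: vin; rewrite mem_cat -(mem_rot i c) r e inE mem_rcons inE.
case/orP=> [|/orP[/eqP h|h]].
- case/orP=> [/eqP h|h]; last exact: bI (good_blossom_touch bls h vI).
  by move: vI; rewrite h (negPf n1) /= => /bI.
- by move: vI; rewrite h mf orbb => /fI.
- case: us e sf h => [//|u us [eb _]]; rewrite /= rcons_path => /andP[pus lf] h.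
  case/orP: (path_touch pus h vI) => [|lI]; first by rewrite -eb (negPf n1).
  by have := gI.2 _ _ lI lf; rewrite mf => /fI.
Qed.

End Touch.

Lemma SD_not_good v : v \in SD G -> exists2 m, maxmatch setT m &
  (in_tflower (matching_of m) v \/ in_tposy (matching_of m) v) /\
  forall I, good m I -> v \notin I /\ v \notin nbhd I.
Proof.
rewrite inE => /asboolP[M [MM vM]].
have mM := maximum_mate MM; have [fm _] := mM; have /andP[mMM _] := MM.
exists (mate M) => //; rewrite mateK //; split=> // I gI.
have /andP[v1 v2] : (v \notin I) && (mate M v \notin I).
  by case: vM => vM; [apply: tflower_not_good gI _ _ | apply: tposy_not_good gI _ _];
    rewrite ?mateK.
split=> //; apply: contra v2 => /nbhdP[y yI vy].
by apply: gI.2 yI _; rewrite adj_sym.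
Qed.

Lemma in_SD m v : maxmatch setT m ->
  in_tflower (matching_of m) v \/ in_tposy (matching_of m) v -> v \in SD G.
Proof.
move=> mm vin; rewrite inE; apply/asboolP; exists (matching_of m); split=> //.
by apply/maximum_matching_of => //; case: mm.
Qed.

(** Membership in a nontrivial component of G[D], expressed locally. *)
Definition nontriv x := (x \in D) && (x \in nbhd D).

Lemma nontrivP x : reflect (x \in D /\ exists2 u, u \in D & adj x u) (nontriv x).
Proof.
apply: (iffP andP) => -[xD]; first by case/nbhdP=> u uD xu; split=> //; exists u.
by case=> u uD xu; split=> //; apply/nbhdP; exists u.
Qed.

Lemma nontriv_connect x y : nontriv x -> connect (adj_in D) x y -> nontriv y.
Proof.
move=> xn; rewrite connect_D_sym => /connectP[[|z p] /= pp e]; first by rewrite e in xn.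
by case/andP: pp => /and3P[yD zD yz] _; apply/nontrivP; split=> //; exists z.
Qed.

Lemma flat_mkseq m (x : nat -> G) k : (forall i, i < k -> m (x i.*2.+1) = x i.*2.+2) ->
  flat m (mkseq (fun i => x i.*2.+1) k) = mkseq (fun i => x i.+1) k.*2.
Proof.
elim: k => // k IH H; rewrite mkseqS flat_rcons IH; last by move=> i ik; apply: H; lia.
by rewrite doubleS !mkseqS -!cats1 -catA H.
Qed.

Lemma path_mkseq m (x : nat -> G) k : (forall i, i < k -> adj (m (x i.*2.+1)) (x i.*2.+3)) ->
  path (step m) (x 1) (mkseq (fun i => x i.*2.+3) k) /\
  last (x 1) (mkseq (fun i => x i.*2.+3) k) = x k.*2.+1.
Proof.
elim: k => // k IH H; have [|p1 l1] := IH; first by move=> i ik; apply: H; lia.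
by rewrite mkseqS rcons_path p1 last_rcons l1 /step H.
Qed.

(** Let [n] miss a neighbour [u] of [x] in D. Once the edges at A are dropped, the alternating path
    from [x] stays in the component of [x]. An odd path would end at a second [dfree] vertex for
    [m]; an even one ends at a [dfree] vertex for [n], which must be [u]. The edge from [u] to [x]
    closes the blossom. *)
Lemma nontriv_blossom m x : maxmatch setT m -> nontriv x -> dfree m x ->
  exists2 ss, rooted_blossom m x ss & forall y, y \in flat m ss -> connect (adj_in D) x y.
Proof.
move=> mm /nontrivP[xD [u uD xu]] xf.
have [_ [n mn nu]] := (gallai_DP u).1 uD.
have [[mK madj mS] _] := mm.
have [m'm _] := dropA_max mm; have [n'm _] := dropA_max mn.
have [m'K m'adj m'S] := m'm; have [n'K n'adj n'S] := n'm.
set m' := dropA m in m'm m'K m'adj m'S; set n' := dropA n in n'm n'K n'adj n'S.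
have dfr k z : z \in D -> dropA k z = z -> dfree k z.
  move=> zD; rewrite /dropA /drop_match /dfree /=.
  by rewrite (negPf (D_notA zD)) /=; case: (k z \in A); rewrite ?orbT // => /eqP ->.
have m'x : m' x = x.
  move: xf; rewrite /m' /dropA /drop_match /= => /orP[/eqP ->|->]; last by rewrite orbT.
  by case: ifP.
have [h] := alt_orbitP n'K m'K m'x; set Z := [set _ | _ : _].
set w := alt_orbit n' m' x => -[inj inZ Zin clo fixed].
have wD i : i <= h -> (w i \in D) && connect (adj_in D) x (w i).
  elim: i => [|i IH] ih; first by rewrite -[w 0]/x xD connect0.
  have /andP[iD ci] := IH (ltnW ih).
  have [a nA] : adj (w i) (w i.+1) /\ w i.+1 \notin A.
    have := inj i i.+1 (ltnSn _) ih; rewrite [w i.+1]alt_orbitS -/w eq_sym; case: (odd i) => ne.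
      by split; [exact: m'adj | have := m'S (m' (w i)); rewrite m'K eq_sym in_setC; apply].
    by split; [exact: n'adj | have := n'S (n' (w i)); rewrite n'K eq_sym in_setC; apply].
  have iD' := D_nbhd iD a nA; rewrite iD'; apply: connect_trans ci (connect1 _).
  exact/and3P.
have [hD hc] := andP (wD h (leqnn h)).
have oh : ~~ odd h.
  apply/negP => oh; rewrite oh in fixed; have [h0 /(_ _ (inZ h (leqnn h)))[_]] := fixed.
  rewrite -/w eqxx orbT => /eqP /(dfr m _ hD) hf.
  have := inj 0 h; rewrite lt0n h0 leqnn -(dfree_uniq mm xD hc xf hf) eqxx => /(_ isT isT).
  by [].
rewrite (negPf oh) in fixed.
have hu : w h = u.
  have [/eqP + _] := fixed _ (inZ h (leqnn h)); rewrite -/w eqxx.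
  move=> /eqP /eqP/(dfr n _ hD) hf; apply: (dfree_uniq mn hD) => //;
    last by rewrite /dfree nu eqxx.
  rewrite connect_D_sym in hc; apply: connect_trans hc _.
  by apply: connect1; apply/and3P.
have [k hk] : exists k, h = k.+1.*2.
  case: h oh hu {inj inZ Zin clo fixed wD hD hc Z} => [_|h oh _].
    by move=> e; rewrite -[w 0]/x in e; rewrite -e adj_irrefl in xu.
  by exists h./2; move: oh; lia.
have mw i : i < k.+1 -> m (w i.*2.+1) = w i.*2.+2.
  move=> ik; have e : w i.*2.+2 = m' (w i.*2.+1) by rewrite [LHS]alt_orbitS /= odd_double.
  have := inj i.*2.+1 i.*2.+2; rewrite ltnSn => /(_ isT).
  rewrite e /m' /dropA /drop_match; case: ifP => // _.
  by rewrite eqxx => H; have := H _; lia.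
have [|p1 l1] := @path_mkseq m w k.
  move=> i ik; rewrite mw; last by lia.
  rewrite [w i.*2.+3]alt_orbitS /= odd_double; apply: n'adj; rewrite eq_sym.
  have := inj i.*2.+2 i.*2.+3 (ltnSn _); rewrite [w i.*2.+3]alt_orbitS /= odd_double; apply;
    lia.
have e : mkseq (fun i => w i.*2.+1) k.+1 = w 1 :: mkseq (fun i => w i.*2.+3) k.
  by rewrite /mkseq /= -[1]/(1 + 0) iotaDl -map_comp; congr (_ :: _); apply: eq_map.
have fl := flat_mkseq mw; rewrite -hk e in fl.
exists (w 1 :: mkseq (fun i => w i.*2.+3) k); last first.
  move=> y; rewrite fl => /mapP[i]; rewrite mem_iota add0n => /andP[_ ih] ->.
  by have /andP[] := wD i.+1 ih.
apply/and4P; split=> //.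
- have := inj 0 1 isT; rewrite [w 1]alt_orbitS -/w -[w 0]/x /= eq_sym => H.
  by apply: n'adj; apply: H; rewrite hk.
- by rewrite l1 mw // -doubleS -hk hu adj_sym.
- rewrite fl -[x]/(w 0).
  have -> : w 0 :: mkseq (fun i => w i.+1) h = mkseq w h.+1.
    by rewrite /mkseq /= -[1]/(1 + 0) iotaDl -map_comp; congr (_ :: _); apply: eq_map.
  apply/(mkseq_uniqP w) => i j; rewrite !inE !ltnS => ih jh /eqP wij.
  case: (ltngtP i j) wij => // ij; first by rewrite (negPf (inj _ _ ij jh)).
  by rewrite eq_sym (negPf (inj _ _ ij ih)).
Qed.

End Good.

(** * Tflowers through D and A *)

Section Forest.
Variable (G : sgraph).
Implicit Types (m n : G -> G) (I : {set G}) (x y u v b f r d a : G) (us vs ss p c rs : seq G).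
Notation D := (gallai_D G).
Notation A := (gallai_A G).

(* Two consecutive vertices of D on an alternating path from D towards an exposed
   vertex; the vertex of A between them is [m r]. *)
Definition forest_step m : rel G := fun r d => [&& m r \in A, adj (m r) d & d \in D].

Lemma forest_step_step m r rs : path (forest_step m) r rs -> path (step m) r rs.
Proof. by apply: sub_path => x y /and3P[]. Qed.

Lemma forest_path_D m r rs x : path (forest_step m) r rs -> x \in rs -> x \in D.
Proof.
elim: rs r => //= d rs IH r /andP[/and3P[_ _ dD] pd]; rewrite inE => /orP[/eqP->//|].
exact: IH pd.
Qed.

Lemma forest_path_A m r rs x : path (forest_step m) r rs -> x \in belast r rs -> m x \in A.
Proof.
elim: rs r => //= d rs IH r /andP[/and3P[rA _ _] pd]; rewrite inE => /orP[/eqP->//|].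
exact: IH pd.
Qed.

Lemma nontriv_D x : nontriv x -> x \in D. Proof. by case/nontrivP. Qed.

Lemma eq_forest_path m m' r rs : {in belast r rs, m =1 m'} -> path (forest_step m) r rs ->
  path (forest_step m') r rs.
Proof.
elim: rs r => //= d rs IH r e /andP[/and3P[rA rd dD] pd].
rewrite /forest_step -e ?mem_head // rA rd dD IH // => x xin.
by apply: e; rewrite inE xin orbT.
Qed.

Lemma uniq_flat_DA m us : matchfun setT m -> uniq us -> (forall x, x \in us -> x \in D) ->
  (forall x, x \in us -> m x \in A) -> uniq (flat m us).
Proof.
move=> fm; have [mK _ _] := fm; elim: us => //= u us IH /andP[un uus] sD sA.
rewrite IH // ?andbT => [|x xus|x xus]; try by [apply: sD; rewrite inE xus orbT | apply: sA;
  rewrite inE xus orbT].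
have uD := sD u (mem_head _ _); have muA := sA u (mem_head _ _).
have muU : m u \notin us.
  by apply/negP => H; have /D_notA := sD (m u) (mem_behead (H : m u \in behead (u :: us)));
    rewrite muA.
rewrite inE !(mem_flat fm) mK !negb_or un muU !andbT.
by apply/eqP => e; move: muA; rewrite -e (negPf (D_notA uD)).
Qed.

Lemma in_flower m b ss us f v : maxmatch setT m -> rooted_blossom m b ss ->
  sorted (step m) (rcons us f) -> head f (rcons us f) = b -> uniq (rcons (flat m us) f) ->
    m f = f ->
  (forall y, y \in b :: flat m ss -> y \in rcons (flat m us) f -> y = b) ->
  v \in flat m ss ++ rcons (flat m us) f -> v \in SD G.
Proof.
move=> mm bl sus hb un mf dis vin; have [fm _] := mm; apply: (in_SD mm); left.
have [p e] : exists p, b :: p = rcons (flat m us) f.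
  by case: us hb {sus un dis vin} => [|u us] /= <-; eexists.
exists (b :: flat m ss), b, p; split; last first.
  by move: vin; rewrite !mem_cat -e => /orP[h|->]; rewrite ?orbT // inE h orbT.
have /andP[bl1 bl2] := rooted_blossom_blossom fm bl.
apply/and4P; split=> //; first by apply: (stem_flat fm e) => //; rewrite e.
apply/hasPn => y yp; apply/negP => yc; have := un; rewrite -e /= => /andP[/negP bp _].
by apply: bp; rewrite -(dis y yc) // -e inE yp orbT.
Qed.

(** The stem is the path itself and the blossom lies in the component of [r0]. They share only [r0],
    because the stem's vertices in D are [dfree] and a component has at most one such vertex. *)
Lemma flower_of_path m r0 rs v : maxmatch setT m -> nontriv r0 -> path (forest_step m) r0 rs ->
  uniq (r0 :: rs) -> m (last r0 rs) = last r0 rs ->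
  (v \in r0 :: rs) || (m v \in r0 :: rs) -> v \in SD G.
Proof.
move=> mm r0n pst un mf vin; have [fm _] := mm; have [mK madj _] := fm.
have df : dfree m r0.
  case: rs pst mf {un vin} => [|r rs] /= pst mf; first by rewrite /dfree mf eqxx.
  by case/andP: pst => /and3P[mA _ _] _; rewrite /dfree mA orbT.
have [ss bl ssc] := nontriv_blossom mm r0n df.
set f := last r0 rs in mf; pose hs := belast r0 rs.
have ehs : r0 :: rs = rcons hs f by rewrite lastI.
have hsD x : x \in hs -> x \in D.
  move=> /mem_belast; rewrite inE => /orP[/eqP ->|]; first exact: nontriv_D.
  exact: forest_path_D pst.
have hsA x : x \in hs -> m x \in A by apply: forest_path_A pst.
have fD : f \in D by apply/gallai_DP; split=> //; exists m.
have unh : uniq hs /\ f \notin hs by move: un; rewrite ehs rcons_uniq => /andP[].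
apply: (@in_flower m r0 ss hs f v) => //.
- by rewrite -ehs; apply: forest_step_step pst.
- by rewrite -ehs.
- rewrite rcons_uniq uniq_flat_DA ?unh.1 // andbT (mem_flat fm) mf orbb.
  exact: unh.2.
- move=> y yc yin.
  have cy : connect (adj_in D) r0 y.
    by move: yc; rewrite inE => /orP[/eqP->|/ssc].
  have yD := nontriv_D (nontriv_connect r0n cy).
  apply/esym/(dfree_uniq mm (nontriv_D r0n) cy df).
  move: yin; rewrite mem_rcons inE (mem_flat fm) /dfree.
  case/or3P=> [/eqP->|/hsA->|/hsA]; rewrite ?mf ?eqxx ?orbT // mK.
  by rewrite (negPf (D_notA yD)).
- move: vin; rewrite ehs !mem_rcons mem_cat mem_rcons !inE (mem_flat fm v hs).
  case/orP=> /orP[/eqP h|->]; rewrite ?h ?eqxx ?orbT //.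
  by rewrite -(mK v) h mf eqxx orbT.
Qed.

Lemma forest_source_D m r d : maxmatch setT m -> connect (forest_step m) r d -> d \in D ->
  r \in D.
Proof.
move=> mm /connectP[[|x p] /= pp ->] // _; case/andP: pp => /and3P[mA _ _] _.
by have [[mK _ _] _] := mm; rewrite -(mK r); apply: A_mate_D.
Qed.

(* The alternating path shifting the exposed vertex to d' avoids everything
   reachable from d, so a can then be rematched to d' without losing that part. *)
Lemma forest_exchange m d x a d' : maxmatch setT m -> m d = d -> 
  (forall r, connect (forest_step m) r d -> ~~ nontriv r) ->
  connect (forest_step m) x d -> adj x a -> d' \in D -> adj a d' ->
  exists m', [/\ maxmatch setT m', m' d = d & connect (forest_step m') d' d].
Proof.
move=> mm md tr xd xa d'D ad'.
case d'R: (connect (forest_step m) d' d); first by exists m.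
have [[mK madj _] _] := mm.
have dD : d \in D by apply/gallai_DP; split=> //; exists m.
have RD r : connect (forest_step m) r d -> r \in D by move=> c; apply: forest_source_D mm c dD.
have nbA r z : connect (forest_step m) r d -> adj r z -> z \in A.
  move=> c rz; apply/negPn/negP => /(D_nbhd (RD _ c) rz) zD.
  by move/negP: (tr _ c); apply; apply/nontrivP; split; [exact: RD | exists z].
have RN r z : connect (forest_step m) r d -> adj r z -> connect (forest_step m) (m z) d.
  move=> c rz; apply: connect_trans (connect1 _) (c).
  by apply/and3P; rewrite mK adj_sym; split; [exact: nbA c rz | | exact: RD].
have aA : a \in A := nbA _ _ xd xa.
have bR : connect (forest_step m) (m a) d := RN _ _ xd xa.
have [_ [n mn nd']] := (gallai_DP d').1 d'D; have [[nK nadj _] _] := mn.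
have [h [Z [oh inj inZ Zin [clo fixed ms]]]] := maxmatch_switch mm mn nd' (in_setT _).
have evD := missable_even mm mn nd' (in_setT _) inj.
set w := alt_orbit m n d' in inj inZ Zin evD.
(* By [RN], if a vertex of even index reached [d], so would the one two places before it, and in the
   end [d'], which is excluded. *)
have ev k : k.*2 <= h -> ~~ connect (forest_step m) (w k.*2) d.
  elim: k => [|k IH] kh; first by rewrite -[w 0]/d' d'R.
  have kh' : k.*2 <= h by lia.
  apply/negP => c; move/negP: (IH kh'); apply.
  have e1 : w k.*2.+1 = m (w k.*2) by rewrite /w alt_orbitS odd_double.
  have e2 : w k.+1.*2 = n (w k.*2.+1) by rewrite doubleS /w alt_orbitS /= odd_double.
  rewrite -[w k.*2]mK -e1; apply: RN c _; rewrite adj_sym e2; apply: nadj.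
  by rewrite -e2 doubleS eq_sym inj.
(* At an odd index, [m r] is the preceding vertex of even index and lies in D, while the neighbours
   of a vertex reaching [d] lie in A. *)
have RZ r : connect (forest_step m) r d -> r \notin Z.
  move=> c; apply/negP => /Zin[i ih ri].
  case oi : (odd i); last first.
    by have := ev i./2; rewrite even_halfK ?oi // -ri c => /(_ ih).
  case: i ih ri oi => // i ih ri /= oi.
  have mr : m r = w i by rewrite ri /w alt_orbitS (negPf oi) mK.
  have iD : w i \in D.
    by rewrite -(even_halfK oi); apply/gallai_DP/evD; rewrite even_halfK // ltnW.
  have rmr : m r != r by rewrite mr ri inj.
  by have := D_notA iD; rewrite -mr (nbA r) // madj.
set m1 := switch Z m n in ms.
have m1R r : connect (forest_step m) r d -> m1 r = m r by move=> /RZ/negPf rZ;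
  rewrite /m1 /switch rZ.
have m1d' : m1 d' = d' by rewrite /m1 /switch -{1}[d']/(w 0) inZ.
have m1d : m1 d = d by rewrite m1R.
have m1a : m1 a = m a.
  rewrite /m1 /switch ifN //; apply/negP => /clo/andP[bZ _].
  by have := RZ _ bR; rewrite bZ.
have [|m2 [mm2 m2b m2d' m2a oth]] := exchangeE ms m1d' (in_setT _) (in_setT a).
  by rewrite adj_sym.
rewrite m1a in m2b oth.
have [[m2K _ _] _] := mm2.
have aR r : connect (forest_step m) r d -> r != a.
  by move=> /RD rD; apply/eqP => e; move: aA; rewrite -e (negPf (D_notA rD)).
have d'neq r : connect (forest_step m) r d -> r != d'.
  by move=> c; apply/eqP => e; rewrite e d'R in c.
have m2R r : connect (forest_step m) r d -> r != m a -> m2 r = m r.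
  by move=> c rb; rewrite oth ?d'neq ?aR // m1R.
have ma : m a != d.
  apply/eqP => e; have ad : a = d by rewrite -(mK a) e md.
  by have := D_notA dD; rewrite -ad aA.
exists m2; split=> //; first by rewrite m2R ?md // eq_sym.
(* [a] is now matched to [d'], so [d'] can replace [m a] as the start of the path to [d]; the path
   is made simple so that no later vertex is [m a], the only one whose partner changed. *)
case/connectP: bR => p pp ed.
case/shortenP: pp ed => -[|r q] pq uq _ ed; first by rewrite /= ed eqxx in ma.
move: pq uq => /= /andP[/and3P[_ ar rD] pq] /andP[bq _].
rewrite mK in ar.
have qR z : z \in r :: q -> connect (forest_step m) z d.
  move=> zq; rewrite ed /=; case/splitPl: zq pq => q1 q2 <-.
  by rewrite cat_path last_cat => /andP[_ p2]; apply/connectP; exists q2.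
apply: (@connect_trans _ _ r); first by apply: connect1; rewrite /forest_step m2d' aA ar rD.
apply/connectP; exists q => //; apply: eq_forest_path pq => z zq.
have zq' : z \in r :: q by apply: mem_belast zq.
by rewrite m2R // ?qR //; apply: contra bq => /eqP <-.
Qed.

(** [I] collects the vertices that reach [d] for any maximum matching missing [d]. Varying the
    matching makes [I] good for an arbitrary maximum [n]: [forest_exchange] is applied with [n a] as
    the vertex to be reached. *)
Lemma root_or_good d : d \in D ->
  (exists m r, [/\ maxmatch setT m, m d = d, nontriv r & connect (forest_step m) r d]) \/
  (exists2 I : {set G}, d \in I & forall m, maxmatch setT m -> good m I).
Proof.
move=> dD.
case: (pselect (exists m r, [/\ maxmatch setT m, m d = d,
  nontriv r & connect (forest_step m) r d])) => H.
  by left.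
right; pose I := [set x | `[< exists m, [/\ maxmatch setT m,
  m d = d & connect (forest_step m) x d] >]].
have IP x : x \in I <-> exists m, [/\ maxmatch setT m, m d = d & connect (forest_step m) x d].
  by rewrite inE; split=> /asboolP.
exists I.
  by have [_ [m mm md]] := (gallai_DP d).1 dD; apply/IP; exists m; split=> //; apply: connect0.
have tr m r : maxmatch setT m -> m d = d -> connect (forest_step m) r d -> ~~ nontriv r.
  by move=> mm md c; apply/negP => rn; apply: H; exists m, r.
have ID x : x \in I -> x \in D by case/IP=> m [mm md c]; apply: forest_source_D mm c dD.
have Inb x y : x \in I -> adj x y -> y \in A.
  move=> xI xy; apply/negPn/negP => /(D_nbhd (ID _ xI) xy) yD.
  have /IP[m [mm md c]] := xI; move/negP: (tr m x mm md c); apply.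
  by apply/nontrivP; split; [exact: ID | exists y].
move=> n mn; split=> [x y xI yI|x a xI xa].
  by apply/negP => /(Inb _ _ xI); apply/negP/D_notA/ID.
have /IP[m [mm md c]] := xI; have aA := Inb _ _ xI xa.
have naD := A_mate_D mn aA; have [[nK nadj _] _] := mn.
apply/IP; apply: (forest_exchange mm md _ c xa naD).
  by move=> r; apply: tr.
by apply: nadj; apply/eqP => e; have := D_notA naD; rewrite e aA.
Qed.

(** A vertex [a] of A that is off the stem is brought onto it by lengthening the stem: matching its
    end [d] to [a] exposes [m a], which becomes the new end. *)
Lemma SD_or_good x : (x \in D) || (x \in A) -> x \in SD G \/
  exists2 I : {set G}, (x \in I) || (x \in nbhd I) & forall m, maxmatch setT m -> good m I.
Proof.
case/orP=> [xD|aA].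
  case: (root_or_good xD) => [[m [r [mm mx rn /connectP[p pp lx]]]]|[I xI gI]]; last first.
    by right; exists I; rewrite ?xI.
  case/shortenP: pp lx => rs pst un _ lx.
  by left; apply: (flower_of_path mm rn pst un); rewrite -?lx // {1}lx mem_last.
rename x into a; move: (aA); rewrite /gallai_A in_setD => /andP[_ /nbhdP[d dD ad]].
case: (root_or_good dD) => [[m [r [mm md rn /connectP[p pp ld]]]]|[I dI gI]]; last first.
  by right; exists I => //; apply/orP; right; apply/nbhdP; exists d.
left; case/shortenP: pp ld => rs pst un _ ld.
have [[mK madj _] _] := mm.
case aon : (m a \in r :: rs).
  by apply: (flower_of_path mm rn pst un); rewrite -?ld // aon orbT.
have [|m2 [mm2 m2b m2d m2a oth]] := exchangeE mm md (in_setT _) (in_setT a).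
  by rewrite adj_sym.
have bD : m a \in D := A_mate_D mm aA.
have da : d != a by apply/eqP => e; move: (D_notA dD); rewrite e aA.
have m2E x : x \in belast r rs -> m x = m2 x.
  move=> xb; have xr : x \in r :: rs := mem_belast xb.
  rewrite oth //.
  - apply/eqP => e; move: un; rewrite lastI -ld rcons_uniq -e xb.
  - by [].
  - apply/eqP => e; have := forest_path_A pst xb; rewrite e => maA.
    by move: (D_notA bD); rewrite maA.
  - by apply/eqP => e; rewrite -e xr in aon.
apply: (@flower_of_path m2 r (rcons rs (m a)) a mm2 rn).
- rewrite rcons_path (eq_forest_path m2E pst) /forest_step -ld m2d aA bD andbT /=.
  by apply: madj; apply/eqP => e; move: (D_notA bD); rewrite e aA.
- by rewrite -rcons_cons rcons_uniq aon.
- by rewrite last_rcons.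
- by apply/orP; right; rewrite m2a -rcons_cons mem_rcons inE ld mem_last orbT.
Qed.

End Forest.

(** * Tposies through C *)

Section Cpart.
Variable (G : sgraph).
Implicit Types (m n : G -> G) (I : {set G}) (x y z u v w b f r d a : G).
Implicit Types (us vs ss p q c rs l hs : seq G).
Notation D := (gallai_D G).
Notation A := (gallai_A G).

Definition gallai_C : {set G} := ~: (D :|: A).
Notation C := gallai_C.

Lemma in_C x : (x \in C) = (x \notin D) && (x \notin A).
Proof. by rewrite in_setC in_setU negb_or. Qed.

Lemma C_adj_notD x y : x \in C -> adj x y -> y \notin D.
Proof.
rewrite in_C => /andP[xD xA] xy; apply: contra xA => yD.
by rewrite /gallai_A in_setD xD; apply/nbhdP; exists y.
Qed.

Lemma C_adj_C x y : x \in C -> adj x y -> y \notin A -> y \in C.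
Proof. by move=> xC xy yA; rewrite in_C (C_adj_notD xC xy). Qed.

Lemma C_mate m x : maxmatch setT m -> x \in C -> m x \in C.
Proof.
move=> mm xC; have [[mK madj _] _] := mm; have := xC; rewrite in_C => /andP[xD xA].
have mx : m x != x.
  by apply/eqP => e; move/negP: xD; apply; apply/gallai_DP; split=> //; exists m.
apply: C_adj_C xC (madj _ mx) _; apply/negP => /(A_mate_D mm); rewrite mK; exact/negP.
Qed.

Lemma C_mateE m x : maxmatch setT m -> (m x \in C) = (x \in C).
Proof.
move=> mm; have [[mK _ _] _] := mm; apply/idP/idP => [/(C_mate mm)|/(C_mate mm) //].
by rewrite mK.
Qed.

Lemma flat_C m us y : maxmatch setT m -> (forall w, w \in us -> w \in C) ->
  y \in flat m us -> y \in C.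
Proof.
move=> mm sC; have [fm _] := mm; rewrite (mem_flat fm) => /orP[/sC//|/sC].
by rewrite C_mateE.
Qed.

Definition live m a := forall I, good m I -> a \notin nbhd I.

Lemma tposy_live m a : maxmatch setT m -> in_tposy (matching_of m) a -> live m a.
Proof.
move=> [fm _] pa I gI; have /andP[aI maI] := tposy_not_good fm gI pa.
by apply: contra maI => /nbhdP[y yI ay]; apply: gI.2 yI _; rewrite adj_sym.
Qed.

(* Shifting the exposed vertex f step by step along the path exposes each head. *)
Lemma free_heads_D hs m f : maxmatch setT m -> sorted (step m) (rcons hs f) ->
  uniq (rcons (flat m hs) f) -> m f = f -> forall w, w \in hs -> w \in D.
Proof.
elim/last_ind: hs m f => [|hs w IH] m f mm //.
rewrite flat_rcons => sh.
have [sh1 lf] : sorted (step m) (rcons hs w) /\ adj (m w) f.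
  case: hs sh {IH} => [|h hs] /=; first by rewrite andbT.
  by rewrite rcons_path last_rcons => /andP[].
rewrite rcons_uniq cat_uniq mem_cat !inE !negb_or => /and5P[/and3P[fh fw fmw] uh hw _ _] mf.
have [fm _] := mm; have [mK madj _] := fm.
have [|m' [mm' m'w _ _ oth]] := exchangeE mm mf (in_setT _) (in_setT (m w)).
  by rewrite adj_sym.
rewrite mK in m'w oth.
have wD : w \in D by apply/gallai_DP; split=> //; exists m'.
have nin y : y \in hs -> [/\ y != f, y != m w & y != w].
  move=> yh; move: fh hw; rewrite !(mem_flat fm) !negb_or mK => /andP[f1 _].
  case/and3P=> /andP[w1 w2] _ _.
  by split; apply/eqP => e; move: yh; rewrite e ?(negPf f1) ?(negPf w1) ?(negPf w2).
have m'E y : y \in hs -> m y = m' y by move=> /nin[? ? ?]; rewrite oth.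
have efl : flat m hs = flat m' hs.
  by elim: (hs) m'E => //= h hs' IH' e; rewrite e ?mem_head // IH' // => y yh; apply: e;
    rewrite inE yh orbT.
move=> y; rewrite mem_rcons inE => /orP[/eqP ->//|yh].
apply: (IH m' w mm' _ _ m'w y yh); last first.
  by rewrite -efl rcons_uniq uh andbT; case/and3P: hw.
case: (hs) sh1 m'E => //= h t; elim: t h => [|g t IHt] h /=.
  by rewrite !andbT /step => + e; rewrite e ?mem_head.
case/andP=> hg pg e; rewrite /step -e ?mem_head // [adj _ _]hg; apply: IHt pg _.
by move=> z zt; apply: e; rewrite inE zt orbT.
Qed.

Lemma rooted_blossomP m b ss : matchfun setT m -> rooted_blossom m b ss <->
  [/\ ss != [::], path (step m) (m b) (rcons ss b) & uniq (b :: flat m ss)].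
Proof.
move=> [mK _ _]; case: ss => [|u us]; first by split=> // -[].
rewrite /rooted_blossom [path _ (m b) _]/= {2}/step mK rcons_path; split.
  by case/and4P=> -> -> lb un; split.
by case=> _ /and3P[-> -> lb] ->; rewrite andbT.
Qed.

Lemma rooted_blossom_uniq m b ss : rooted_blossom m b ss -> ss != [::] /\ uniq (b :: flat m ss).
Proof. by case: ss => // u us /and4P[]. Qed.

(** Going once round the blossom and then along the stem is a single alternating path to the exposed
    vertex. By [free_heads_D] its heads lie in D, while C is closed under partners. *)
Lemma tflower_notC m v : maxmatch setT m -> in_tflower (matching_of m) v -> v \notin C.
Proof.
move=> mm [c [b [p [/and4P[bl bs sp dis] vin]]]]; have [fm _] := mm; have [mK _ _] := fm.
have [hs [f [e sf mf]]] := stem_heads fm sp.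
have [ss bls [i r]] := blossom_rooted fm bl bs.
have fD : f \in D by apply/gallai_DP; split=> //; exists m.
have hd : head f (rcons hs f) = b by case: hs e {sf} => [[->]|h hs []].
have unp : uniq (b :: p) by case/and4P: sp => /andP[].
have shs : sorted (step m) (rcons (ss ++ hs) f).
  rewrite rcons_cat; have [_ pb _] := (rooted_blossomP _ _ fm).1 bls.
  case: ss {r} bls pb => // u us _; rewrite [path _ _ _]/= => /andP[_]; rewrite rcons_path.
  case/andP=> pus lb; rewrite /= cat_path pus /=.
  by case: (hs) hd sf => [|h t] /= -> //; [rewrite lb | rewrite lb].
have unh : uniq (rcons (flat m (ss ++ hs)) f).
  rewrite flat_cat rcons_cat -e cat_uniq unp andbT.
  have [_] := rooted_blossom_uniq bls; rewrite cons_uniq => /andP[bn ->]; rewrite andTb.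
  apply/hasPn => y; rewrite inE => /predU1P[->//|yp]; apply/negP => ys;
    move/hasPn: dis => /(_ y yp) /=.
  by rewrite -(mem_rot i) r inE ys orbT.
have hD := free_heads_D mm shs unh mf.
have vf : (v == f) || (v \in flat m (ss ++ hs)).
  have hin y : y \in rcons (flat m hs) f -> (y == f) || (y \in flat m (ss ++ hs)).
    by rewrite mem_rcons inE flat_cat mem_cat => /orP[->|->]; rewrite ?orbT.
  move: vin; rewrite mem_cat -(mem_rot i c) r e => /orP[|/hin//].
  rewrite inE => /predU1P[->|vs]; first by apply: hin; rewrite -e mem_head.
  by rewrite flat_cat mem_cat vs orbT.
apply/negP => vC; have := vC; rewrite in_C => /andP[vD _].
case/predU1P: vf => [vf|]; first by rewrite vf fD in vD.
rewrite (mem_flat fm) => /orP[/hD|/hD]; rewrite ?(negPf vD) // => mvD.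
by have := C_mate mm vC; rewrite in_C mvD.
Qed.

(** Shifts the exposed vertex of a maximum matching of G - A along the walk. [n] is the current
    matching; it still agrees with [m] on the part of the walk that lies ahead. *)
Lemma walk_notA_D m q x n : maxmatch setT m -> maxmatch (~: A) n -> n x = x -> x \in D ->
  path (step m) (m x) q -> {in q, forall w, w \notin A} -> uniq (x :: flat m q) ->
  {in flat m q, dropA m =1 n} -> m (last (m x) q) \in D.
Proof.
move=> mm; have [fm _] := mm; have [mK _ _] := fm.
have inS y : y \in D -> y \in ~: A by move=> /D_notA; rewrite in_setC.
elim: q x n => [|w q IH] x n mn nx xD; first by rewrite [last _ _]/= mK.
case/andP; rewrite {1}/step mK => xw pw nA; rewrite [flat _ _]/= !cons_uniq !in_cons !negb_or.
case/and4P=> /and3P[xw' xmw xq] /andP[wmw wq] mwq uq e.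
have wA : w \notin A by apply: nA; rewrite mem_head.
have wD := D_nbhd xD xw wA.
have [nw _] := exchange mn nx (inS _ xD) (inS _ wD) xw.
have nw' : n w = m w.
  move: nw; rewrite -e ?mem_head // /dropA /drop_match; case: ifP => //.
  by rewrite eqxx.
have [n' [mn' n'f _ _ oth]] := exchangeE mn nx (inS _ xD) (inS _ wD) xw.
rewrite nw' in n'f oth.
have mwA : m w \notin A.
  by move: nw; rewrite -e ?mem_head // /dropA /drop_match /= (negPf wA) /=; case: ifP;
    rewrite ?eqxx.
have mwD : m w \in D.
  apply/missable_compl_A; split; first by rewrite in_setC.
  by exists n'.
have := IH (m w) n' mn' n'f mwD; rewrite mK => H; rewrite [last _ _]/=; apply: H => //.
- by move=> y yq; apply: nA; rewrite inE yq orbT.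
- by rewrite /= mwq.
- move=> y yq; rewrite oth; first by apply: e; rewrite !inE yq !orbT.
  + by apply/eqP => ey; rewrite -ey yq in xq.
  + by apply/eqP => ey; rewrite -ey yq in wq.
  + by apply/eqP => ey; rewrite -ey yq in mwq.
Qed.

Lemma path_C m u us : maxmatch setT m -> path (step m) u us -> u \in C ->
  {in us, forall w, w \notin A} -> {in us, forall w, w \in C}.
Proof.
move=> mm; elim: us u => //= w us IH u /andP[uw pw] uC nA y.
have wC : w \in C by apply: C_adj_C (C_mate mm uC) uw _; apply: nA; rewrite mem_head.
rewrite inE => /predU1P[->//|]; apply: IH pw wC _ _ => z zu.
by apply: nA; rewrite inE zu orbT.
Qed.

Lemma last_occ (P : pred G) s : has P s -> exists p a q, [/\ s = p ++ a :: q, P a & ~~ has P q].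
Proof.
elim: s => //= x s IH; case Ps: (has P s); last first.
  by rewrite orbF => Px; exists [::], x, s; rewrite Ps.
by move=> _; have [p [a [q [-> Pa nq]]]] := IH Ps; exists (x :: p), a, q.
Qed.

Lemma first_occ (P : pred G) s : has P s ->
  exists p a q, [/\ s = p ++ a :: q, P a & ~~ has P p].
Proof.
elim: s => //= x s IH; case Px: (P x); first by exists [::], x, s.
by move=> /IH[p [a [q [-> Pa nq]]]]; exists (x :: p), a, q; rewrite /= Px.
Qed.

(* After its last vertex in A the blossom would return to b from a vertex of D. *)
Lemma rooted_blossom_C m b ss : maxmatch setT m -> rooted_blossom m b ss -> b \in C ->
  {in ss, forall w, w \in C}.
Proof.
move=> mm bl bC; have [fm _] := mm; have [mK _ _] := fm.
have [ne pb un] := (rooted_blossomP _ _ fm).1 bl.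
suff nA : {in ss, forall w, w \notin A}.
  move: pb; rewrite rcons_path => /andP[pb _].
  by apply: (path_C mm pb (C_mate mm bC)).
move=> w ws; apply/negP => wA.
have : has (mem A) ss by apply/hasP; exists w.
case/last_occ=> p [a [q [e aA nq]]].
move: pb un; rewrite e rcons_cat cat_path flat_cat /= => /and3P[_ _ pq] /andP[_].
rewrite cat_uniq /= => /and3P[_ _ /and3P[_ maq uq]].
move: pq; rewrite rcons_path => /andP[pq lb].
have maD := A_mate_D mm aA.
have dma : dropA m (m a) = m a by rewrite /dropA /drop_match ifT //; apply/orP; right;
  rewrite mK; apply: aA.
have := @walk_notA_D m q (m a) (dropA m) mm (dropA_max mm) dma maD.
rewrite mK => /(_ pq) H.
have /H : {in q, forall w : G, w \notin A}.
  by move=> y yq; move/hasPn: nq => /(_ y yq).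
rewrite /= maq uq => /(_ isT (fun _ _ => erefl)) lD.
by move: lb; rewrite /step adj_sym => /(C_adj_notD bC); rewrite lD.
Qed.

Lemma path_exit m u us : maxmatch setT m -> path (step m) u us -> u \in C ->
  {in us, forall w, w \in C} \/ exists p a q, [/\ us = p ++ a :: q, a \in A,
    {in u :: p, forall w, w \in C} & adj (m (last u p)) a].
Proof.
move=> mm pus uC; case hA : (has (mem A) us); last first.
  left; apply: (path_C mm pus uC) => w wu; apply/negP => wA.
  by move/hasP: hA; apply; exists w.
right; have [p [a [q [e aA np]]]] := first_occ hA; exists p, a, q.
move: pus; rewrite e cat_path => /and3P[pp la _]; split=> // w.
rewrite inE => /predU1P[->//|]; apply: (path_C mm pp uC) => z zp.
by move/hasPn: np => /(_ z zp).
Qed.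

(* What remains in C of a Tposy through v, if it is not contained in C. *)
Definition segment_A_C_A m v := exists u us a1 a2,
  [/\ path (step m) u us, uniq (flat m (u :: us)), {in u :: us, forall w, w \in C} &
      v \in flat m (u :: us)] /\
  [/\ adj a1 u, adj (m (last u us)) a2, a1 \in A /\ live m a1 & a2 \in A /\ live m a2].

(** The case in which one blossom of the Tposy lies in C and the path leaves C at [a]. *)
Definition blossom_C_to_A m v := exists b ss us a,
  [/\ rooted_blossom m b ss, path (step m) b us, uniq (flat m (b :: us) ++ flat m ss),
      {in b :: us, forall w, w \in C} & {in ss, forall w, w \in C}] /\
  [/\ adj (m (last b us)) a, a \in A, live m a & v \in flat m (b :: us) ++ flat m ss].

(** A Tposy in terms of heads. Liveness of its vertices is recorded because the pieces cut out of it
    later no longer show it. *)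
Definition linked_blossoms m x us ss1 ss2 :=
  [/\ path (step m) x us, uniq (flat m (x :: us)), rooted_blossom m x ss1,
      rooted_blossom m (m (last x us)) ss2 &
      forall y, y \in flat m (x :: us) -> y != x -> y != m (last x us) ->
        (y \notin flat m ss1) && (y \notin flat m ss2)] /\
  forall y, y \in flat m (x :: us) ++ flat m ss1 ++ flat m ss2 -> live m y.

Lemma rev_heads_rcons m us u : rev_heads m (rcons us u) = m u :: rev_heads m us.
Proof. by rewrite /rev_heads map_rcons rev_rcons. Qed.

Lemma rev_heads_cons m us u : rev_heads m (u :: us) = rcons (rev_heads m us) (m u).
Proof. by rewrite /rev_heads /= rev_cons. Qed.

Lemma rev_heads_cat m us vs : rev_heads m (us ++ vs) = rev_heads m vs ++ rev_heads m us.
Proof. by rewrite /rev_heads map_cat rev_cat. Qed.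

Lemma rev_headsK m : involutive m -> involutive (rev_heads m).
Proof. by move=> mK us; rewrite /rev_heads map_rev revK -map_comp map_id_in // => x _ /=;
  rewrite mK. Qed.

Lemma mem_rev_heads m us x : involutive m -> (x \in rev_heads m us) = (m x \in us).
Proof. by move=> mK; rewrite mem_rev -{1}(mK x) mem_map //; apply: inv_inj. Qed.

Lemma rev_heads_C m us : maxmatch setT m -> {in us, forall w, w \in C} ->
  {in rev_heads m us, forall w, w \in C}.
Proof.
move=> mm sC w; have [[mK _ _] _] := mm; rewrite mem_rev_heads // => /sC.
by rewrite C_mateE.
Qed.

Lemma linked_blossoms_rev m x us ss1 ss2 : maxmatch setT m -> linked_blossoms m x us ss1 ss2 ->
  exists us', x :: us = rev_heads m (m (last x us) :: us') /\
  m (last (m (last x us)) us') = x /\ linked_blossoms m (m (last x us)) us' ss2 ss1.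
Proof.
move=> mm [[pus un bl1 bl2 dis] liveP]; have [fm _] := mm; have [mK _ _] := fm.
pose us' := behead (rev_heads m (x :: us)).
have e : rev_heads m (x :: us) = m (last x us) :: us'.
  by rewrite /us' lastI rev_heads_rcons.
have e2 : m (last (m (last x us)) us') = x.
  have : last x (rev_heads m (x :: us)) = m x by rewrite rev_heads_cons last_rcons.
  by rewrite e /= => ->; rewrite mK.
have fl y : (y \in flat m (m (last x us) :: us')) = (y \in flat m (x :: us)).
  by rewrite -e mem_flat_rev_heads.
exists us'; split; first by rewrite -e rev_headsK.
split=> //; split; last first.
  move=> y; rewrite !mem_cat fl => h; apply: liveP; rewrite !mem_cat.
  by case/or3P: h => ->; rewrite ?orbT.
split=> //.
- by have := step_rev_heads fm (pus : sorted (step m) (x :: us)); rewrite e.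
- by rewrite -e flat_rev_heads // rev_uniq.
- by rewrite e2.
- by move=> y; rewrite fl e2 => yin h1 h2; rewrite andbC dis.
Qed.

Lemma cat_compare (s1 s2 t1 t2 : seq G) : s1 ++ s2 = t1 ++ t2 ->
  (exists r : seq G, t1 = s1 ++ r /\ s2 = r ++ t2) \/
  (exists r : seq G, s1 = t1 ++ r /\ t2 = r ++ s2).
Proof.
elim: s1 t1 => [|x s1 IH] [|y t1] /=; try by [move=> <-; left; exists [::] | move=> ->; left;
  eexists | move=> <-; right; eexists].
by case=> -> /IH[[r [-> ->]]|[r [-> ->]]]; [left|right]; exists r.
Qed.

(** A blossom with base in C lies in C, so only the path can leave. [v] is asked to be on the
    blossom or on a stretch of the path that stays in C from [x] on, so that it survives when the
    path is cut at its first vertex in A. *)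
Lemma base_C_cases m x us ss1 ss2 v : maxmatch setT m -> linked_blossoms m x us ss1 ss2 ->
  x \in C ->
  v \in flat m ss1 \/ (exists l w (r : seq G), [/\ x :: us = l ++ w :: r, {in rcons l w,
    forall z, z \in C}
     & (w == v) || (w == m v)]) ->
  blossom_C_to_A m v \/ [/\ {in x :: us, forall w, w \in C}, {in ss1, forall w, w \in C} &
                 {in ss2, forall w, w \in C}].
Proof.
move=> mm [[pus un bl1 bl2 dis] liveP] xC vin; have [fm _] := mm; have [mK _ _] := fm.
have s1C := rooted_blossom_C mm bl1 xC.
case: (path_exit mm pus xC) => [usC|[p [a [q [e aA pC la]]]]].
  have xusC : {in x :: us, forall w, w \in C} by move=> w /predU1P[->//|/usC].
  right; split=> //; apply: (rooted_blossom_C mm bl2).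
  by apply: C_mate mm (xusC _ (mem_last _ _)).
left; exists x, ss1, p, a.
have pp : path (step m) x p by move: pus; rewrite e cat_path => /andP[].
have eun : flat m (x :: us) = flat m (x :: p) ++ flat m (a :: q) by rewrite e -flat_cat.
split; split=> //.
- rewrite cat_uniq; have := un; rewrite eun cat_uniq => /and3P[-> hn _] /=.
  have [_ /= /andP[xn ->]] := rooted_blossom_uniq bl1; rewrite andbT.
  apply/hasPn => y ys; apply/negP => yp.
  have yx : y != x by apply/eqP => ey; rewrite -ey ys in xn.
  have yl : y != m (last x us).
    apply/eqP => ey; have H : y \in flat m (a :: q).
      by rewrite ey e last_cat -(last_flat m a q a); apply: (mem_last a (m a :: flat m q)).
    by move/hasPn: hn => /(_ y H); rewrite /= yp.
  by have := dis y; rewrite eun mem_cat yp /= ys => /(_ isT yx yl).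
- by apply: liveP; rewrite mem_cat eun mem_cat (mem_flat fm a (_ :: _)) mem_head !orbT.
rewrite mem_cat; case: vin => [->|[l [w [r [el lC wv]]]]]; first by rewrite orbT.
have wp : w \in x :: p.
  have : (x :: p) ++ (a :: q) = rcons l w ++ r by rewrite cat_rcons -el e.
  case/cat_compare=> [[[|a' t] [e1 e2]]|[t [-> _]]].
  - by rewrite cats0 in e1; rewrite -e1 mem_rcons mem_head.
  - case: e2 => e2 _; have := lC a; rewrite e1 mem_cat -e2 mem_head orbT => /(_ isT).
    by rewrite in_C aA andbF.
  - by rewrite mem_cat mem_rcons mem_head.
by rewrite (mem_flat fm); case/orP: wv => /eqP <-; rewrite wp ?orbT.
Qed.

(** The walk back from [w] has reversed heads, whence [rev_heads m l]; reversing its part [p1] again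
    and appending [w :: p2] gives the segment. *)
Lemma two_exits m l w (r : seq G) v a1 a2 (p1 p2 : seq G) : maxmatch setT m ->
  sorted (step m) (l ++ w :: r) ->
  uniq (flat m (l ++ w :: r)) -> (w == v) || (w == m v) ->
  (exists q1 : seq G, rev_heads m l = p1 ++ q1) -> (exists q2 : seq G, r = p2 ++ q2) ->
  {in m w :: p1, forall z, z \in C} -> {in w :: p2, forall z, z \in C} ->
  adj (m (last (m w) p1)) a1 -> adj (m (last w p2)) a2 ->
  a1 \in A /\ live m a1 -> a2 \in A /\ live m a2 -> segment_A_C_A m v.
Proof.
move=> mm sl un wv [q1 e1] [q2 e2] C1 C2 ad1 ad2 l1 l2; have [fm _] := mm; have [mK _ _] := fm.
have el : l = rev_heads m q1 ++ rev_heads m p1 by rewrite -rev_heads_cat -e1 rev_headsK.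
have eu : rev_heads m p1 ++ w :: p2 = m (last (m w) p1) :: behead (rev_heads m p1 ++ w :: p2).
  case/lastP: (p1) => [|p z]; first by rewrite /= mK.
  by rewrite rev_heads_rcons last_rcons.
have ell : l ++ w :: r = rev_heads m q1 ++ (rev_heads m p1 ++ w :: p2) ++ q2 by rewrite el e2
  -!catA.
rewrite ell in sl un.
have sl' : sorted (step m) (rev_heads m p1 ++ w :: p2).
  by have [_ /cat_sorted2[]] := cat_sorted2 sl.
have un' : uniq (flat m (rev_heads m p1 ++ w :: p2)).
  move: un; rewrite !(flat_cat m (rev_heads m q1)) flat_cat cat_uniq => /and3P[_ _].
  by rewrite cat_uniq => /and3P[].
have lst z : last z (rev_heads m p1 ++ w :: p2) = last w p2 by rewrite last_cat.
exists (m (last (m w) p1)), (behead (rev_heads m p1 ++ w :: p2)), a1, a2.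
rewrite -eu; split; split=> //.
- by move: sl'; rewrite eu.
- move=> z; rewrite mem_cat => /orP[|/C2//].
  by apply: rev_heads_C => // y yp; apply: C1; rewrite inE yp orbT.
- rewrite (mem_flat fm) !mem_cat !inE; case/orP: wv => /eqP ->; rewrite eqxx ?orbT //.
- by rewrite adj_sym.
- have := lst (m (last (m w) p1)); rewrite {1}eu /= => e.
  by rewrite -[last _ (behead _)]/(last (m (last (m w) p1)) (behead (rev_heads m p1 ++ w ::
    p2))) e.
Qed.

End Cpart.

(** * What a Tposy through C leaves inside C *)

Section Cases.
Variable (G : sgraph).
Implicit Types (m n : G -> G) (I : {set G}) (x y z u v w b f d a : G).
Implicit Types (us vs ss p q c rs l r hs : seq G).
Notation D := (gallai_D G).
Notation A := (gallai_A G).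
Notation C := (gallai_C G).

Lemma tposy_linked_blossoms m c1 c2 x p : maxmatch setT m -> tposy (matching_of m) c1 c2 x p ->
  exists us ss1 ss2 i1 i2, [/\ linked_blossoms m x us ss1 ss2, x :: p = flat m (x :: us),
    rot i1 c1 = x :: flat m ss1 & rot i2 c2 = m (last x us) :: flat m ss2].
Proof.
move=> mm tp; have [fm _] := mm; have [/andP[b1 s1] /andP[b2 s2] mp int _] := tp.
have [us pus e] := mm_path_heads fm mp.
have lp : last x p = m (last x us) by rewrite -(last_flat m x us x) -e.
have [ss1 bl1 [i1 r1]] := blossom_rooted fm b1 s1.
have [ss2 bl2 [i2 r2]] := blossom_rooted fm b2 s2.
have un : uniq (x :: p) by case/and5P: mp => /andP[].
exists us, ss1, ss2, i1, i2; split=> //; last by rewrite -lp.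
split; first split=> //.
- by rewrite -e.
- by rewrite -lp.
- move=> y; rewrite -e -lp => yin yx yl.
  have : y \in behead (belast x p).
    move: yin; rewrite lastI mem_rcons inE (negPf yl) /=.
    by case: (belast x p) (lastI x p) => //= z t [<- _]; rewrite inE (negPf yx).
  move/int => /andP[]; rewrite -(mem_rot i1 c1) r1 -(mem_rot i2 c2) r2.
  by rewrite !in_cons !negb_or => /andP[_ ->] /andP[_ ->].
move=> y yin; apply: tposy_live => //; exists c1, c2, x, p; split=> //.
rewrite mem_cat -(mem_rot i1 c1) r1 mem_cat -(mem_rot i2 c2) r2 e.
move: yin; rewrite !mem_cat => /or3P[->|h|h]; rewrite ?orbT //.
  by rewrite [y \in x :: _]in_cons h orbT.
by rewrite [y \in last _ _ :: _]in_cons h !orbT.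
Qed.

Lemma split_flat m us v : matchfun setT m -> v \in flat m us ->
  exists l w r, us = l ++ w :: r /\ (w == v) || (w == m v).
Proof.
move=> fm; rewrite (mem_flat fm) => /orP[] /path.splitPr => -[l r].
  by exists l, v, r; rewrite eqxx.
by exists l, (m v), r; rewrite eqxx orbT.
Qed.

Lemma step_sorted_cat m l w r : sorted (step m) (l ++ w :: r) -> path (step m) w r.
Proof. by case/cat_sorted2. Qed.

(** One walks from [v] in both directions. On the path, a walk that does not exit reaches a base in
    C, the situation of [base_C_cases]. On a blossom with base outside C both walks exit, at the
    latest at the base. *)
Lemma linked_blossoms_cases m x us ss1 ss2 v : maxmatch setT m ->
  linked_blossoms m x us ss1 ss2 -> v \in C ->
  v \in x :: flat m ss1 \/ v \in flat m (x :: us) ->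
  [\/ blossom_C_to_A m v, segment_A_C_A m v | [/\ {in x :: us, forall w, w \in C}, {in ss1,
    forall w, w \in C} &
                 {in ss2, forall w, w \in C}]].
Proof.
move=> mm wp vC vin; have [fm _] := mm; have [mK _ _] := fm.
have [[pus un bl1 bl2 dis] liveP] := wp.
have base : x \in C -> v \in flat m ss1 \/ (exists l w (r : seq G),
      [/\ x :: us = l ++ w :: r, {in rcons l w, forall z, z \in C} & (w == v) || (w == m v)]) ->
    [\/ blossom_C_to_A m v, segment_A_C_A m v | [/\ {in x :: us, forall w, w \in C},
    {in ss1, forall w, w \in C} & {in ss2, forall w, w \in C}]].
  by move=> xC vin'; case: (base_C_cases mm wp xC vin') => ?; [apply: Or31 | apply: Or33].
have wC w : (w == v) || (w == m v) -> w \in C.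
  by case/orP=> /eqP->; rewrite ?C_mateE.
have live_path a p q : x :: us = p ++ a :: q -> live m a.
  move=> e; apply: liveP; rewrite mem_cat (mem_flat fm) e mem_cat mem_head !orbT.
  by [].
have live_path' a p q : rev_heads m (x :: us) = p ++ a :: q -> live m a.
  move=> e; apply: liveP; rewrite mem_cat -(mem_flat_rev_heads fm) (mem_flat fm) e mem_cat
    mem_head.
  by rewrite !orbT.
have onpath l w r : x :: us = l ++ w :: r -> (w == v) || (w == m v) ->
    [\/ blossom_C_to_A m v, segment_A_C_A m v | [/\ {in x :: us, forall w, w \in C},
    {in ss1, forall w, w \in C} & {in ss2, forall w, w \in C}]].
  move=> e wv; have cw := wC w wv.
  have spus : sorted (step m) (l ++ w :: r) by rewrite -e.
  have erev : rev_heads m (x :: us) = rev_heads m r ++ m w :: rev_heads m l.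
    by rewrite e rev_heads_cat rev_heads_cons cat_rcons.
  have pl : path (step m) (m w) (rev_heads m l).
    by have := step_rev_heads fm (pus : sorted (step m) (x :: us));
      rewrite erev => /step_sorted_cat.
  have mwC := C_mate mm cw.
  case: (path_exit mm pl mwC) => [lC|[p1 [a1 [q1 [e1 a1A p1C la1]]]]].
    have lC' z : z \in l -> z \in C.
      by move=> zl; rewrite -(C_mateE _ mm); apply: lC; rewrite (mem_rev_heads _ _ mK) mK.
    apply: base; last first.
      right; exists l, w, r; split=> // z; rewrite mem_rcons inE => /predU1P[->//|].
      exact: lC'.
    by case: (l) e lC' => [[-> _] //|z l' [-> _]]; apply; rewrite mem_head.
  case: (path_exit mm (step_sorted_cat spus) cw) => [rC|[p2 [a2 [q2 [e2 a2A p2C la2]]]]].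
    have [us' [e' [e'' wp']]] := linked_blossoms_rev mm wp.
    have er : m (last x us) :: us' = rev_heads m r ++ m w :: rev_heads m l.
      by rewrite -erev e' rev_headsK.
    have yC : m (last x us) \in C.
      rewrite (C_mateE _ mm); have -> : last x us = last x (l ++ w :: r) by rewrite -e.
      rewrite last_cat /=; have := mem_last w r; rewrite inE => /predU1P[->//|]; exact: rC.
    have [|b3|[h1 h2 h3]] := base_C_cases mm wp' yC (v := v).
    - right; exists (rev_heads m r), (m w), (rev_heads m l); split=> //.
        move=> z; rewrite mem_rcons inE => /predU1P[->//|]; exact: rev_heads_C.
      by case/orP: wv => /eqP ->; rewrite ?mK eqxx ?orbT.
    - exact: Or31.
    - by apply: Or33; split=> //; rewrite e'; apply: rev_heads_C.
  apply: Or32; apply: (two_exits mm spus _ wv _ _ p1C p2C la1 la2) => //.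
  - by rewrite -e.
  - by eexists; exact: e1.
  - by eexists; exact: e2.
  - by split=> //; apply: (live_path' a1 (rev_heads m r ++ m w :: p1) q1);
      rewrite erev e1 -catA.
  - by split=> //; apply: (live_path a2 (l ++ w :: p2) q2); rewrite e e2 -catA.
case: vin => [vb|vp]; last first.
  by have [l [w [r [e wv]]]] := split_flat fm vp; apply: onpath e wv.
case xC : (x \in C).
  move: vb; rewrite in_cons => /predU1P[vx|vs]; last by apply: base => //; left.
  by apply: base => //; right; exists [::], x, us; rewrite vx eqxx; split=> // z;
    rewrite inE => /eqP ->.
move: vb; rewrite in_cons => /predU1P[vx|vs]; first by rewrite -vx vC in xC.
have [l [w [r [e wv]]]] := split_flat fm vs.
have cw := wC w wv; have mwC := C_mate mm cw.
have [_ pb ub] := (rooted_blossomP _ _ fm).1 bl1.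
have lx : live m x by apply: liveP; rewrite mem_cat mem_head.
have lss a : a \in ss1 -> live m a.
  by move=> a1; apply: liveP; rewrite !mem_cat (mem_flat fm _ ss1) a1 !orbT.
have lss' a : m a \in ss1 -> live m a.
  by move=> a1; apply: liveP; rewrite !mem_cat (mem_flat fm _ ss1) a1 !orbT.
move: pb; rewrite e rcons_cat rcons_cons => pb.
have sw : sorted (step m) (rcons (w :: r) x) by have := path_sorted pb => /cat_sorted2[].
have sl : sorted (step m) (rcons (m w :: rev_heads m l) x).
  have := step_rev_heads fm (pb : sorted (step m) (m x :: l ++ w :: rcons r x)).
  rewrite rev_heads_cons mK rev_heads_cat rev_heads_cons cat_rcons rcons_cat => /cat_sorted2[_].
  by rewrite rcons_cons.
(* When the whole arc stays in C, the base [x] serves as exit: it is outside C and adjacent to C,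
   hence in A. Both arcs may exit there. *)
have ex1 z t : sorted (step m) (rcons (z :: t) x) -> z \in C -> (forall a, a \in t ->
  live m a) ->
    exists p a, [/\ exists q, t = p ++ q, {in z :: p, forall y, y \in C}, adj (m (last z p)) a &
      a \in A /\ live m a].
  rewrite /= rcons_path => /andP[pt lt] zC lt'.
  case: (path_exit mm pt zC) => [tC|[p [a [q [e1 aA pC la]]]]].
    exists t, x; split=> //; first by exists [::]; rewrite cats0.
      by move=> y; rewrite inE => /predU1P[->//|/tC].
    split=> //; apply/negPn/negP => xA.
    have lC : last z t \in C by have := mem_last z t; rewrite inE => /predU1P[->//|/tC].
    by have := C_adj_C (C_mate mm lC) lt xA; rewrite xC.
  exists p, a; split=> //; first by exists (a :: q).
  by split=> //; apply: lt'; rewrite e1 mem_cat mem_head orbT.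
have [|p2 [a2 [e2 p2C la2 L2]]] := ex1 _ _ sw cw.
  by move=> a ar; apply: lss; rewrite e mem_cat inE ar !orbT.
have [|p1 [a1 [e1 p1C la1 L1]]] := ex1 _ _ sl mwC.
  by move=> a; rewrite (mem_rev_heads _ _ mK) => al; apply: lss'; rewrite e mem_cat al.
apply: Or32; apply: (two_exits mm _ _ wv e1 e2 p1C p2C la1 la2 L1 L2).
  have := path_sorted pb; rewrite -rcons_cons -rcons_cat.
  by case: (l) => [|h t] /=; rewrite rcons_path => /andP[].
by move: ub; rewrite e => /andP[].
Qed.

(** Stated with [tposy] and not in heads: the blossoms may overlap, and their intersection must be
    carried to the other graph. *)
Definition posy_in_C m v := exists c1 c2 x p, [/\ tposy (matching_of m) c1 c2 x p,
  v \in c1 ++ c2 ++ x :: p & {in c1 ++ c2 ++ x :: p, forall y, y \in C}].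

Lemma tposy_cases m v : maxmatch setT m -> v \in C -> in_tposy (matching_of m) v ->
  [\/ posy_in_C m v, blossom_C_to_A m v | segment_A_C_A m v].
Proof.
move=> mm vC [c1 [c2 [x [p [tp vin]]]]]; have [fm _] := mm.
have [us [ss1 [ss2 [i1 [i2 [wp e r1 r2]]]]]] := tposy_linked_blossoms mm tp.
have done_ : [/\ {in x :: us, forall w, w \in C}, {in ss1, forall w, w \in C} &
                 {in ss2, forall w, w \in C}] -> posy_in_C m v.
  move=> [h0 h1 h2]; exists c1, c2, x, p; split=> // y.
  rewrite mem_cat -(mem_rot i1 c1) r1 mem_cat -(mem_rot i2 c2) r2 e.
  case/or3P; last by apply: flat_C.
  - by rewrite in_cons => /predU1P[->|]; [apply: h0; rewrite mem_head | apply: flat_C].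
  - rewrite in_cons => /predU1P[->|]; last exact: flat_C.
    by apply: C_mate => //; apply: h0; apply: mem_last.
move: vin; rewrite mem_cat -(mem_rot i1 c1) r1 mem_cat -(mem_rot i2 c2) r2 e.
have fwd h := linked_blossoms_cases mm wp vC h.
case/or3P=> h.
- by case: (fwd (or_introl h)) => ?; [apply: Or32 | apply: Or33 | apply/Or31/done_].
- have [us' [e' [e'' wp']]] := linked_blossoms_rev mm wp.
  case: (linked_blossoms_cases mm wp' vC (or_introl h)) => [?|?|[h0 h1 h2]];
    [exact: Or32 | exact: Or33 |].
  by apply/Or31/done_; split=> //; rewrite e'; apply: rev_heads_C.
- by case: (fwd (or_intror h)) => ?; [apply: Or32 | apply: Or33 | apply/Or31/done_].
Qed.

Lemma SD_C_cases v : v \in SD G -> v \in C -> exists2 m, maxmatch setT m &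
  [\/ posy_in_C m v, blossom_C_to_A m v | segment_A_C_A m v].
Proof.
move=> vS vC; have [m mm [[fl|tp] _]] := SD_not_good vS; exists m => //.
  by have := tflower_notC mm fl; rewrite vC.
exact: tposy_cases.
Qed.

End Cases.

(** * Rebuilding a Tposy from its part in C *)

Section Build.
Variable (G : sgraph).
Implicit Types (m n : G -> G) (I : {set G}) (x y z u v w b f d a : G).
Implicit Types (us vs ss p q c rs l r hs t : seq G).
Notation D := (gallai_D G).
Notation A := (gallai_A G).
Notation C := (gallai_C G).

Lemma nontriv_SD x : nontriv x -> x \in SD G.
Proof.
move=> xn; have [_ [m mm mx]] := (gallai_DP x).1 (nontriv_D xn).
by apply: (@flower_of_path G m x [::] x mm xn) => //=; rewrite inE eqxx.
Qed.

(** The Tposies assembled below have disjoint blossoms, so a single uniqueness condition expresses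
    all the disjointness. *)
Lemma in_posy m x us ss1 ss2 v : maxmatch setT m -> path (step m) x us ->
  rooted_blossom m x ss1 -> rooted_blossom m (m (last x us)) ss2 ->
  uniq (flat m ss1 ++ flat m (x :: us) ++ flat m ss2) ->
  v \in flat m ss1 ++ flat m (x :: us) ++ flat m ss2 -> v \in SD G.
Proof.
move=> mm pus bl1 bl2 un vin; have [fm _] := mm; have [mK _ _] := fm.
apply: (in_SD mm); right; set b := m (last x us) in bl2.
have lb : last x (m x :: flat m us) = b by rewrite /b -(last_flat m x us x).
have bf : b \in flat m (x :: us) by rewrite /b (mem_flat fm) mK mem_last orbT.
have xf : x \in flat m (x :: us) by rewrite (mem_flat fm) mem_head.
exists (x :: flat m ss1), (b :: flat m ss2), x, (m x :: flat m us); split; last first.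
  move: vin; rewrite !mem_cat => /or3P[h|h|h].
  - by rewrite [v \in x :: _]in_cons h orbT.
  - by rewrite -[x :: m x :: _]/(flat m (x :: us)) h !orbT.
  - by rewrite [v \in b :: _]in_cons h !orbT.
move: (un); rewrite cat_uniq => /and3P[_ /hasPn d1 un2].
move: (un2); rewrite cat_uniq => /and3P[unp /hasPn d2 _].
have dis y : y \in flat m (x :: us) -> (y \notin flat m ss1) && (y \notin flat m ss2).
  move=> yf; apply/andP; split; first by apply: d1; rewrite mem_cat yf.
  by apply/negP => /d2; rewrite /= yf.
have dis' y : y \in flat m ss2 -> y \notin flat m ss1.
  by move=> ys; apply: d1; rewrite mem_cat ys orbT.
split.
- exact: rooted_blossom_blossom.
- rewrite lb; exact: rooted_blossom_blossom.
- exact: mm_path_flat.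
- move=> y yb.
  have yin : y \in flat m (x :: us).
    have := mem_behead yb; exact: mem_belast.
  have [y1 y2] : y != x /\ y != b.
    move: unp yb; rewrite -[flat m (x :: us)]/(x :: m x :: flat m us) => unp.
    have unl : uniq (rcons (belast x (m x :: flat m us)) b) by rewrite -lb -lastI.
    move: unl; rewrite rcons_uniq [belast _ _]/= [behead _]/= in_cons negb_or.
    case/andP=> /andP[_ bn] _ yb; split; last by apply/eqP => e; rewrite -e yb in bn.
    apply/eqP => e; move: unp => /= /andP[xn _]; move/negP: xn; apply.
    by move: (mem_belast yb); rewrite e.
  by have /andP[h1 h2] := dis y yin; rewrite !in_cons !negb_or y1 y2 h1 h2.
- have xb : x != b.
    rewrite /b; case/lastP: (us) unp => [|us' z] unp /=.
      by have [] := uniq_flat_head unp.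
    rewrite last_rcons; have [_ + _ _] := uniq_flat_head unp.
    by apply: contra => /eqP ->; rewrite (mem_flat fm) mK orbC mem_rcons mem_head.
  left=> y; rewrite !in_cons => /predU1P[->|y1].
    by rewrite negb_or xb; have /andP[] := dis x xf.
  rewrite negb_or; apply/andP; split; last by apply/negP => /dis'; rewrite y1.
  by apply/eqP => e; have /andP[] := dis b bf; rewrite -e y1.
Qed.

(** If no nontrivial vertex led to [m a], the vertices leading there would form a good set adjacent
    to [a]. The tail is the path from such a vertex to [m a] reversed, so its heads lie in A. *)
Lemma live_tail m a : maxmatch setT m -> a \in A -> live m a -> exists t,
  [/\ path (step m) a t, uniq (a :: t), {in a :: t, forall w, w \in A /\ m w \in D} &
      nontriv (m (last a t))].
Proof.
move=> mm aA la; have [fm _] := mm; have [mK _ _] := fm.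
have maD := A_mate_D mm aA.
have [r0 r0n c0] : exists2 r0, nontriv r0 & connect (forest_step m) r0 (m a).
  apply: contrapT => H; pose I := [set x | connect (forest_step m) x (m a)].
  have tr x : x \in I -> ~~ nontriv x.
    by rewrite inE => c; apply/negP => xn; apply: H; exists x.
  have ID x : x \in I -> x \in D by rewrite inE => c; apply: forest_source_D mm c maD.
  have nb x y : x \in I -> adj x y -> y \in A.
    move=> xI xy; apply/negPn/negP => /(D_nbhd (ID _ xI) xy) yD.
    by move/negP: (tr _ xI); apply; apply/nontrivP; split; [apply: ID | exists y].
  have gI : good m I.
    split=> [x y xI yI|x y xI xy].
      by apply/negP => /(nb _ _ xI); apply/negP/D_notA/ID.
    move: (xI); rewrite !inE => c; apply: connect_trans (connect1 _) c.
    by rewrite /forest_step mK (nb _ _ xI xy) adj_sym xy ID.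
  have := la I gI; move/negP; apply; apply/nbhdP; exists (m a).
    by rewrite inE connect0.
  have [_ madj _] := fm; apply: madj; apply/eqP => e.
  by move: (D_notA maD); rewrite e aA.
case/connectP: c0 => p0 pp0 e0; case/shortenP: pp0 e0 => rs pst un _ e0.
have rA w : w \in r0 :: rs -> w \in D /\ m w \in A.
  move=> wr; split.
    by move: wr; rewrite inE => /predU1P[->|]; [apply: nontriv_D | apply: forest_path_D pst].
  move: wr; rewrite lastI mem_rcons inE => /predU1P[->|]; last exact: forest_path_A pst.
  by rewrite -e0 mK.
have e : rev_heads m (r0 :: rs) = a :: behead (rev_heads m (r0 :: rs)).
  by rewrite lastI rev_heads_rcons -e0 mK.
exists (behead (rev_heads m (r0 :: rs))); rewrite -e; split.
- have := step_rev_heads fm (forest_step_step pst : sorted (step m) (r0 :: rs)).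
  by rewrite e.
- by rewrite rev_uniq map_inj_uniq //; apply: inv_inj.
- by move=> w; rewrite (mem_rev_heads _ _ mK) => /rA[]; rewrite mK.
- have -> : last a (behead (rev_heads m (r0 :: rs))) = last a (rev_heads m (r0 :: rs)) by
    rewrite e.
  by rewrite rev_heads_cons last_rcons mK.
Qed.

Lemma uniq_flat_AD m us : matchfun setT m -> uniq us ->
  {in us, forall w, w \in A /\ m w \in D} -> uniq (flat m us).
Proof.
move=> fm un h; have [mK _ _] := fm; rewrite -rev_uniq -flat_rev_heads //.
apply: uniq_flat_DA => //; first by rewrite rev_uniq map_inj_uniq //; apply: inv_inj.
  by move=> x; rewrite (mem_rev_heads _ _ mK) => /h[]; rewrite mK.
by move=> x; rewrite (mem_rev_heads _ _ mK) => /h[].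
Qed.

(** The partner of a vertex of A is [dfree], so if it lay in the component of the blossom it would
    be the base, which is not in [flat m ss]. *)
Lemma tail_blossom m a t : maxmatch setT m -> uniq (a :: t) ->
  {in a :: t, forall w, w \in A /\ m w \in D} -> nontriv (m (last a t)) ->
  exists ss, [/\ rooted_blossom m (m (last a t)) ss, 
    forall y, y \in flat m ss -> y \in D /\ connect (adj_in D) (m (last a t)) y &
    forall w, w \in A -> w \notin flat m ss /\ m w \notin flat m ss].
Proof.
move=> mm un h ne; have [fm _] := mm; have [mK _ _] := fm.
have lA : last a t \in A := (h _ (mem_last _ _)).1.
have df : dfree m (m (last a t)) by rewrite /dfree mK lA orbT.
have [ss bl ssc] := nontriv_blossom mm ne df; exists ss; split=> //.
  by move=> y ys; split; [apply/nontriv_D/(nontriv_connect ne (ssc y ys)) | apply: ssc].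
have [_ /= /andP[bn _]] := rooted_blossom_uniq bl.
move=> w wA; have n2 : m w \notin flat m ss.
  apply/negP => ws; move/negP: bn; apply.
  have -> // : m (last a t) = m w.
  by apply: (dfree_uniq mm (nontriv_D ne) (ssc _ ws) df); rewrite /dfree mK wA orbT.
split=> //; apply/negP => ws; have := nontriv_D (nontriv_connect ne (ssc _ ws)).
by move=> wD; have := D_notA wD; rewrite wA.
Qed.

Lemma blossom_C_to_A_SD m v : maxmatch setT m -> blossom_C_to_A m v -> v \in SD G.
Proof.
move=> mm [b [ss [us [a [[bl pus un usC ssC] [la aA liveP vin]]]]]].
have [fm _] := mm; have [mK _ _] := fm.
have [t [pt ut tA tn]] := live_tail mm aA liveP.
have [ss2 [bl2 s2D s2A]] := tail_blossom mm ut tA tn.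
have CnotA y : y \in C -> y \notin A by rewrite in_C => /andP[].
have CnotD y : y \in C -> y \notin D by rewrite in_C => /andP[].
have tAD y : y \in flat m (a :: t) -> (y \in A) || (y \in D).
  by rewrite (mem_flat fm) => /orP[/tA[->]|/tA[_]]; rewrite ?mK // => ->; rewrite orbT.
have notC y : y \in flat m (a :: t) ++ flat m ss2 -> y \notin C.
  rewrite mem_cat in_C negb_and !negbK => /orP[/tAD|/s2D[->//]].
  by rewrite orbC.
have el : last b (us ++ a :: t) = last a t by rewrite last_cat.
apply: (@in_posy m b (us ++ a :: t) ss ss2 v) => //.
- by rewrite cat_path pus /= [step _ _ _]la pt.
- by rewrite el.
- have -> : flat m ss ++ flat m (b :: us ++ a :: t) ++ flat m ss2 =
     (flat m ss ++ flat m (b :: us)) ++ flat m (a :: t) ++ flat m ss2.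
    by rewrite -cat_cons flat_cat !catA.
  have [_ /= /andP[_ u2]] := rooted_blossom_uniq bl2.
  have uAB : uniq (flat m ss ++ flat m (b :: us)) by rewrite uniq_catC.
  have uCD : uniq (flat m (a :: t) ++ flat m ss2).
    rewrite cat_uniq (uniq_flat_AD fm ut tA) andTb u2 andbT; apply/hasPn => y.
    move=> ys; apply/negP => yt; have : y \in flat m (a :: t) := yt.
    have := s2A (m y); have := s2A y; rewrite mK ys (mem_flat fm _ (a :: t)) => h1 h2.
    by case/orP=> /tA[yA _]; [case: (h1 yA) | case: (h2 yA)].
  rewrite cat_uniq uAB uCD andbT; apply/hasPn => y /notC yC; apply/negP => h.
  have : y \in flat m ss ++ flat m (b :: us) := h.
  by rewrite mem_cat => /orP[/(flat_C mm ssC)|/(flat_C mm usC)]; apply/negP.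
- move: vin; rewrite -cat_cons flat_cat !mem_cat.
  by case/orP=> ->; rewrite ?orbT.
Qed.

Lemma sorted_cat_cons (e : rel G) x s y t : path e x s -> e (last x s) y -> path e y t ->
  path e x (s ++ y :: t).
Proof. by move=> h1 h2 h3; rewrite cat_path h1 /= h2. Qed.

Lemma perm_rev_cat3 (T : eqType) (s1 s2 s3 s4 : seq T) :
  perm_eq ((s1 ++ s2 ++ s3) ++ s4) ((rev s3 ++ s2 ++ s1) ++ s4).
Proof.
rewrite perm_cat2r; apply/seq.permP => P.
by rewrite !count_cat count_rev addnA addnC [count P s1 + _]addnC.
Qed.

(* The two tails either are disjoint, or merge at some z in A; in the second case
   the segment and the two initial parts form a blossom with base z. *)
Lemma segment_A_C_A_SD m v : maxmatch setT m -> segment_A_C_A m v -> v \in SD G.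
Proof.
move=> mm [u [us [a1 [a2 [[pus un usC vin] [l1 l2 [a1A lv1] [a2A lv2]]]]]]].
have [fm _] := mm; have [mK _ _] := fm.
have [t1 [pt1 ut1 tA1 tn1]] := live_tail mm a1A lv1.
have [t2 [pt2 ut2 tA2 tn2]] := live_tail mm a2A lv2.
have [ss1 [bl1 s1D s1A]] := tail_blossom mm ut1 tA1 tn1.
have notC t y : {in t, forall w, w \in A /\ m w \in D} -> y \in flat m t -> y \notin C.
  move=> h; rewrite (mem_flat fm) in_C negb_and !negbK.
  by case/orP=> /h[h1]; rewrite ?mK => h2; rewrite ?h1 ?h2 ?orbT.
have Cflat t y : {in t, forall w, w \in A /\ m w \in D} -> y \in flat m t ->
  y \notin flat m (u :: us).
  by move=> h yt; apply/negP => /(flat_C mm usC); apply/negP; apply: notC h yt.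
have ss_off ss t y : (forall w, w \in A -> w \notin flat m ss /\ m w \notin flat m ss) ->
    {in t, forall w, w \in A /\ m w \in D} -> y \in flat m t -> y \notin flat m ss.
  move=> hs h; rewrite (mem_flat fm) => /orP[/h[yA _]|/h[yA _]].
    by case: (hs y yA).
  by case: (hs (m y) yA); rewrite mK.
have ss_C ss y : (forall z, z \in flat m ss -> z \in D) -> y \in flat m ss ->
  y \notin flat m (u :: us).
  by move=> h ys; apply/negP => /(flat_C mm usC); rewrite in_C h.
have [_ /= /andP[_ us1]] := rooted_blossom_uniq bl1.
case hh : (has (mem (a1 :: t1)) (a2 :: t2)).
  (* [z] is the first vertex of the second tail on the first one, so [p2] is disjoint from the whole
     first tail. [p1] and [p2] may be empty; both are when [a1 = a2]. *)
  have [p2 [z [q2 [e2 z1 n2]]]] := first_occ hh.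
  have [p1 [q1 e1]] : exists p1 q1, a1 :: t1 = p1 ++ z :: q1.
    by case/path.splitPr: (z1 : z \in a1 :: t1) => p1 q1; exists p1, q1.
  have pz : path (step m) z q1 by have := pt1 : sorted _ (a1 :: t1);
    rewrite e1 => /step_sorted_cat.
  have lz : last z q1 = last a1 t1.
    by have : last a1 (a1 :: t1) = last a1 (p1 ++ z :: q1); [rewrite e1 | rewrite last_cat].
  (* The cycle starts at [z], runs back along the first tail to [a1], through the segment, and along
     the second tail from [a2] to [z]. What is left of the first tail joins it to the blossom
     [ss1]. *)
  pose ss := rev_heads m p1 ++ (u :: us) ++ p2.
  have pss : path (step m) (m z) (rcons ss z).
    have eh : rev_heads m (rcons p1 z) = m z :: rev_heads m p1 by rewrite rev_heads_rcons.
    have s1 : sorted (step m) (rcons p1 z).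
      have := pt1 : sorted _ (a1 :: t1); rewrite e1 -cat_rcons.
      by case/cat_sorted2.
    have s1' := step_rev_heads fm s1; rewrite eh in s1'.
    have la1 : last (m z) (rev_heads m p1) = m a1.
      have -> : last (m z) (rev_heads m p1) = last (m z) (rev_heads m (rcons p1 z)) by rewrite
        eh.
      case: (p1) e1 => [[-> _]|h p1' [-> _]]; first by [].
      by rewrite rcons_cons rev_heads_cons last_rcons.
    rewrite /ss rcons_cat rcons_cat; apply: sorted_cat_cons => //.
      by rewrite /step la1 mK.
    have : sorted (step m) (rcons p2 z).
      have := pt2 : sorted _ (a2 :: t2); rewrite e2 -cat_rcons.
      by case/cat_sorted2.
    have : head a2 (rcons p2 z) = a2.
      by case: (p2) e2 => [[-> _]|h p' [-> _]].
    case: (rcons p2 z) (headI p2 z) => // h t' _ /= -> pt'.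
    by apply: sorted_cat_cons.
  have sub1 w : w \in p1 ++ z :: q1 -> w \in A /\ m w \in D by rewrite -e1 => /tA1.
  have sub2 w : w \in p2 -> w \in A /\ m w \in D.
    by move=> wp; apply: tA2; rewrite e2 mem_cat wp.
  have up1 : uniq (p1 ++ z :: q1) by rewrite -e1.
  have up2 : uniq p2 by move: ut2; rewrite e2 cat_uniq => /and3P[].
  have uf1 := uniq_flat_AD fm up1 sub1.
  have uf2 := uniq_flat_AD fm up2 sub2.
  have d12 y : y \in flat m p2 -> y \notin flat m (p1 ++ z :: q1).
    rewrite !(mem_flat fm) -e1 => /orP[y2|y2]; rewrite negb_or.
      have /hasPn := n2 => /(_ y y2) h; rewrite h /=.
      by apply/negP => /tA1[h1 _]; have /D_notA := (sub2 y y2).2; rewrite h1.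
    have /hasPn := n2 => /(_ (m y) y2) h; rewrite h andbT.
    apply/negP => /tA1[h1 _]; have /D_notA := (sub2 (m y) y2).2; rewrite mK.
    by rewrite h1.
  have un_all : uniq (flat m p2 ++ flat m (u :: us) ++ flat m p1 ++ flat m (z :: q1)).
    rewrite -(flat_cat m p1).
    have u1 : uniq (flat m (u :: us) ++ flat m (p1 ++ z :: q1)).
      by rewrite cat_uniq un uf1 andbT andTb; apply/hasPn => y; exact: Cflat.
    rewrite cat_uniq uf2 u1 andbT andTb; apply/hasPn => y.
    rewrite mem_cat => /orP[y1|y1]; apply/negP => y2.
      by have := Cflat _ _ sub2 y2; rewrite y1.
    by have := d12 y y2; rewrite y1.
  have mss y : (y \in flat m ss) = [|| y \in flat m p2,
    y \in flat m (u :: us) | y \in flat m p1].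
    rewrite /ss !flat_cat !mem_cat (mem_flat_rev_heads fm).
    by case: (y \in flat m p2); case: (y \in flat m p1); case: (y \in flat m (u :: us)).
  have uss : uniq (flat m ss ++ flat m (z :: q1)).
    rewrite -(perm_uniq (s1 := (flat m p2 ++ flat m (u :: us) ++ flat m p1) ++ flat m (z ::
      q1))).
      by rewrite -!catA.
    have -> : flat m ss = rev (flat m p1) ++ flat m (u :: us) ++ flat m p2.
      by rewrite /ss !flat_cat flat_rev_heads.
    exact: perm_rev_cat3.
  have bz : rooted_blossom m z ss.
    apply/(rooted_blossomP _ _ fm); split=> //.
      by rewrite /ss; case: (rev_heads m p1).
    move: uss; rewrite cat_uniq [uniq (z :: _)]/= => /and3P[-> /hasPn h _]; rewrite andbT.
    by apply: h; rewrite (mem_flat fm) mem_head.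
  apply: (@in_posy m z q1 ss ss1 v) => //.
  - by rewrite lz.
  - rewrite catA cat_uniq uss us1 andbT andTb; apply/hasPn => y ys.
    apply/negP => h; have : y \in flat m ss ++ flat m (z :: q1) := h.
    have o1 := ss_off ss1 (p1 ++ z :: q1) y s1A sub1; rewrite flat_cat mem_cat in o1.
    have o2 := ss_off ss1 p2 y s1A sub2.
    have o3 := ss_C ss1 y (fun z h => (s1D z h).1) ys.
    rewrite mem_cat mss (negPf o3) => /orP[/or3P[/o2|//|yt]|yt]; first by rewrite ys.
      by have := o1 _; rewrite yt ys => /(_ isT).
    by have := o1 _; rewrite yt orbT ys => /(_ isT).
  - by rewrite mem_cat mss vin orbT.
have [ss2 [bl2 s2D s2A]] := tail_blossom mm ut2 tA2 tn2.
have [_ /= /andP[_ us2]] := rooted_blossom_uniq bl2.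
have disj w : w \in a2 :: t2 -> w \notin a1 :: t1.
  by move=> w2; apply/negP => w1; move/negbT/hasPn: hh => /(_ w w2); rewrite /= w1.
have fdis y : y \in flat m (a2 :: t2) -> y \notin flat m (a1 :: t1).
  rewrite !(mem_flat fm) => /orP[y2|y2]; rewrite negb_or.
    rewrite (disj _ y2) /=; apply/negP => /tA1[h1 _]; have /D_notA := (tA2 y y2).2.
    by rewrite h1.
  rewrite (disj _ y2) andbT; apply/negP => /tA1[h1 _]; have /D_notA := (tA2 (m y) y2).2.
  by rewrite mK h1.
pose b1 := m (last a1 t1); pose b2 := m (last a2 t2).
have l1A : last a1 t1 \in A := (tA1 _ (mem_last _ _)).1.
have l2A : last a2 t2 \in A := (tA2 _ (mem_last _ _)).1.
(* A common vertex would put both blossoms in one component, whose only [dfree] vertex would be both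
   bases; the disjoint tails would then have the same last head. *)
have sdis y : y \in flat m ss2 -> y \notin flat m ss1.
  move=> y2; apply/negP => y1.
  have c : connect (adj_in D) b1 b2.
    by apply: connect_trans (s1D y y1).2 _; rewrite connect_D_sym (s2D y y2).2.
  have e : b1 = b2.
    by apply: (dfree_uniq mm (nontriv_D tn1) c); rewrite /dfree /b1 /b2 mK ?l1A ?l2A orbT.
  have := disj _ (mem_last a2 t2); rewrite -(inv_inj mK e) mem_last.
  by [].
pose T := rev_heads m (a1 :: t1).
have eT : T = b1 :: behead T by rewrite /T lastI rev_heads_rcons.
have lT z : last z T = m a1 by rewrite /T rev_heads_cons last_rcons.
have pT : path (step m) b1 (behead T).
  by have := step_rev_heads fm (pt1 : sorted _ (a1 :: t1)); rewrite -/T eT.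
have lT' : last b1 (behead T) = m a1 by rewrite -(lT b1) [in RHS]eT.
have fT : flat m (b1 :: behead T ++ (u :: us) ++ a2 :: t2) =
    flat m T ++ flat m (u :: us) ++ flat m (a2 :: t2).
  by rewrite -cat_cons -eT !flat_cat.
have fTm y : (y \in flat m T) = (y \in flat m (a1 :: t1)) by rewrite (mem_flat_rev_heads fm).
apply: (@in_posy m b1 (behead T ++ (u :: us) ++ a2 :: t2) ss1 ss2 v) => //.
- apply: sorted_cat_cons => //; first by rewrite lT' /step mK.
  exact: sorted_cat_cons.
- by rewrite !last_cat /=.
- rewrite fT.
  have u1 : uniq (flat m (a2 :: t2) ++ flat m ss2).
    rewrite cat_uniq us2 (uniq_flat_AD fm ut2 tA2) andbT andTb; apply/hasPn => y ys.
    by apply/negP => h; have := ss_off ss2 (a2 :: t2) y s2A tA2 h; rewrite ys.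
  have u2 : uniq (flat m (u :: us) ++ flat m (a2 :: t2) ++ flat m ss2).
    rewrite cat_uniq un u1 andbT andTb; apply/hasPn => y.
    rewrite mem_cat => /orP[/(Cflat _ _ tA2)//|].
    by apply: ss_C => z /s2D[].
  have u3 : uniq (flat m T ++ flat m (u :: us) ++ flat m (a2 :: t2) ++ flat m ss2).
    rewrite cat_uniq u2 flat_rev_heads // rev_uniq (uniq_flat_AD fm ut1 tA1) andbT andTb.
    apply/hasPn => y yin; apply/negP; rewrite /= mem_rev => y1; move: yin.
    have o1 := Cflat _ _ tA1 y1; have o2 := contraL (fdis y) y1.
    rewrite !mem_cat (negPf o1) (negPf o2) /= => y2.
    by have := ss_off ss2 (a1 :: t1) y s2A tA1 y1; rewrite y2.
  rewrite -!catA cat_uniq us1 u3 andbT andTb; apply/hasPn => y.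
  rewrite !mem_cat fTm => /or4P[] h; apply/negP => y1.
  - by have := ss_off _ _ _ s1A tA1 h; rewrite y1.
  - by have := ss_C ss1 y (fun z h => (s1D z h).1) y1; rewrite h.
  - by have := ss_off _ _ _ s1A tA2 h; rewrite y1.
  - by have := sdis _ h; rewrite y1.
- by rewrite fT !mem_cat vin !orbT.
Qed.

End Build.

(** Intrinsic, so that it also makes sense in the reduced form, where exactly the triangle vertices
    are not kept. *)
Definition kept (G : sgraph) (x : G) := ~~ nontriv x.

(** * Transfer between graphs with the same reduced part *)

(* phi only matters on the kept vertices. *)
Record transfer (G1 G2 : sgraph) (phi : G1 -> G2) : Prop := Transfer {
  transfer_inj : {in @kept G1 &, injective phi};
  transfer_kept : forall x, kept x -> kept (phi x);
  transfer_surj : forall y, kept y -> exists2 x, kept x & phi x = y;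
  transfer_adj : forall x y, kept x -> kept y -> adj (phi x) (phi y) = adj x y;
  transfer_D : forall x, kept x -> (phi x \in gallai_D G2) = (x \in gallai_D G1);
  transfer_A : forall x, kept x -> (phi x \in gallai_A G2) = (x \in gallai_A G1);
  transfer_match : forall m1, maxmatch setT m1 -> exists2 m2, maxmatch setT m2 &
    forall x, kept x -> (kept (m1 x) -> m2 (phi x) = phi (m1 x)) /\
      (~~ kept (m1 x) -> ~~ kept (m2 (phi x))) }.

Section TransferTheory.
Variables (G1 G2 : sgraph) (phi : G1 -> G2).
Hypothesis T : transfer phi.
Notation C := (gallai_C G1).

Definition matched m1 m2 := forall x : G1, kept x ->
  (kept (m1 x) -> m2 (phi x) = phi (m1 x)) /\ (~~ kept (m1 x) -> ~~ kept (m2 (phi x))).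

Lemma kept_notD (G : sgraph) (x : G) : x \notin gallai_D G -> kept x.
Proof. by apply: contra => /nontriv_D. Qed.

Lemma kept_C x : x \in C -> kept x.
Proof. by rewrite in_C => /andP[/kept_notD]. Qed.

Lemma kept_A (G : sgraph) (x : G) : x \in gallai_A G -> kept x.
Proof. by rewrite /gallai_A in_setD => /andP[/kept_notD]. Qed.

Lemma transfer_C x : x \in C -> phi x \in gallai_C G2.
Proof.
move=> xC; have xk := kept_C xC; move: xC.
by rewrite !in_C (transfer_D T) // (transfer_A T).
Qed.

Lemma good_kept (G : sgraph) m (I : {set G}) x : maxmatch setT m -> good m I -> x \in I ->
  kept x.
Proof.
move=> mm gI xI; apply/negP => /nontrivP[_ [u uD xu]].
by have := good_notD mm gI xI xu; rewrite uD.
Qed.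

Definition pull (I2 : {set G2}) : {set G1} := [set x | kept x && (phi x \in I2)].

Lemma in_pull I2 x : (x \in pull I2) = kept x && (phi x \in I2).
Proof. by rewrite /pull in_set. Qed.

(** A neighbour [y] of [x] that is not kept would either make [x] nontrivial or put [phi x] in A; in
    the latter case [phi x] has a neighbour in D, against [good_notD]. *)
Lemma pull_good m1 m2 I2 : maxmatch setT m1 -> maxmatch setT m2 -> matched m1 m2 ->
  good m2 I2 -> good m1 (pull I2).
Proof.
move=> mm1 mm2 mt gI; split=> [x y|x y]; rewrite !in_pull.
  move=> /andP[xk xI] /andP[yk yI]; rewrite -(transfer_adj T) //.
  by apply/negP => xy; have := good_indep gI xI xy; rewrite yI.
case/andP=> xk xI xy.
have yk : kept y.
  apply/negP => yn; have yD := nontriv_D yn.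
  case xD : (x \in gallai_D G1).
    by move/negP: xk; apply; apply/nontrivP; split=> //; exists y.
  have : phi x \in gallai_A G2.
    by rewrite (transfer_A T) // /gallai_A in_setD xD; apply/nbhdP; exists y.
  rewrite /gallai_A in_setD => /andP[_ /nbhdP[u uD xu]].
  by have := good_notD mm2 gI xI xu; rewrite uD.
have myI : m2 (phi y) \in I2 by apply: gI.2 xI _; rewrite (transfer_adj T).
have mk : kept (m1 y).
  case mk: (kept (m1 y)) => //; have /negP := (mt y yk).2 (negbT mk).
  by case; apply: good_kept gI myI.
by apply/andP; split=> //; rewrite -((mt y yk).1 mk).
Qed.

Lemma pull_nbhd m2 I2 x : maxmatch setT m2 -> good m2 I2 -> kept x ->
  phi x \in nbhd I2 -> x \in nbhd (pull I2).
Proof.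
move=> mm2 gI xk /nbhdP[y2 yI xy].
have [y yk e] := transfer_surj T (good_kept mm2 gI yI); rewrite -e in yI xy.
by apply/nbhdP; exists y; [rewrite in_pull; apply/andP | rewrite -(transfer_adj T)].
Qed.

Lemma live_transfer m1 m2 a : maxmatch setT m1 -> maxmatch setT m2 -> matched m1 m2 ->
  kept a -> live m1 a -> live m2 (phi a).
Proof.
move=> mm1 mm2 mt ak la I2 gI; apply: contra (la _ (pull_good mm1 mm2 mt gI)).
exact: pull_nbhd mm2 gI ak.
Qed.

(** * Images of paths, blossoms and Tposies contained in C *)

Section Lists.
Variables (m1 : G1 -> G1) (m2 : G2 -> G2).
Hypotheses (mm1 : maxmatch setT m1) (mm2 : maxmatch setT m2) (mt : matched m1 m2).

Lemma matched_C x : x \in C -> m2 (phi x) = phi (m1 x).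
Proof. by move=> xC; apply: (mt (kept_C xC)).1; apply/kept_C/C_mate. Qed.

Lemma phi_injC : {in C &, injective phi}.
Proof. by move=> x y /kept_C xk /kept_C yk; apply: transfer_inj. Qed.

Lemma adj_C x y : x \in C -> y \in C -> adj (phi x) (phi y) = adj x y.
Proof. by move=> /kept_C xk /kept_C yk; apply: transfer_adj. Qed.

Lemma flat_map us : {in us, forall w, w \in C} -> flat m2 (map phi us) = map phi (flat m1 us).
Proof.
elim: us => //= u us IH h; rewrite IH ?matched_C ?h ?mem_head // => w wu.
by apply: h; rewrite inE wu orbT.
Qed.

Lemma uniq_mapC s : {in s, forall w, w \in C} -> uniq (map phi s) = uniq s.
Proof. by move=> h; rewrite map_inj_in_uniq // => x y /h xC /h yC; apply: phi_injC. Qed.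

Lemma mem_mapC s v : {in s, forall w, w \in C} -> v \in C -> (phi v \in map phi s) = (v \in s).
Proof.
move=> h vC; apply/mapP/idP => [[w ws /phi_injC e]|vs]; last by exists v.
by rewrite e // h.
Qed.

Lemma path_map_step u us : {in u :: us, forall w, w \in C} ->
  path (step m1) u us -> path (step m2) (phi u) (map phi us).
Proof.
elim: us u => //= w us IH u h /andP[uw pw].
have uC : u \in C by apply: h; rewrite mem_head.
have wC : w \in C by apply: h; rewrite !inE eqxx orbT.
rewrite IH ?andbT //; last by move=> z zw; apply: h; rewrite inE zw orbT.
by rewrite /step matched_C // adj_C // C_mate.
Qed.

Lemma rooted_blossom_map b ss : b \in C -> {in ss, forall w, w \in C} ->
  rooted_blossom m1 b ss -> rooted_blossom m2 (phi b) (map phi ss).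
Proof.
move=> bC h; case: ss h => // u us h /and4P[bu pus lb un].
have uC : u \in C by apply: h; rewrite mem_head.
have lC : last u us \in C by apply: h; apply: mem_last.
apply/and4P; split.
- by rewrite adj_C.
- exact: path_map_step.
- by rewrite last_map matched_C // adj_C // C_mate.
- rewrite -[flat m2 _]/(flat m2 (map phi (u :: us))) flat_map // -map_cons uniq_mapC //.
  by move=> w; rewrite in_cons => /predU1P[->//|]; apply: flat_C.
Qed.

Lemma segment_A_C_A_map v : v \in C -> segment_A_C_A m1 v -> segment_A_C_A m2 (phi v).
Proof.
move=> vC [u [us [a1 [a2 [[pus un usC vin] [l1 l2 [a1A lv1] [a2A lv2]]]]]]].
have fC y : y \in flat m1 (u :: us) -> y \in C by apply: flat_C.
have uC : u \in C by apply: usC; rewrite mem_head.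
have lC : last u us \in C by apply: usC; apply: mem_last.
have efl : flat m2 (phi u :: map phi us) = map phi (flat m1 (u :: us)) by rewrite -flat_map.
exists (phi u), (map phi us), (phi a1), (phi a2); split; split.
- exact: path_map_step.
- by rewrite efl uniq_mapC.
- move=> w; rewrite -map_cons => /mapP[z zu ->]; apply: transfer_C; exact: usC.
- by rewrite efl mem_mapC.
- by rewrite (transfer_adj T) //; [apply: kept_A | apply: kept_C].
- by rewrite last_map matched_C // (transfer_adj T) ?l2 ?la //;
    [apply/kept_C/C_mate | apply: kept_A].
- rewrite (transfer_A T) ?kept_A //; split=> //.
  exact: live_transfer mm1 mm2 mt (kept_A a1A) lv1.
- rewrite (transfer_A T) ?kept_A //; split=> //.
  exact: live_transfer mm1 mm2 mt (kept_A a2A) lv2.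
Qed.

Lemma blossom_C_to_A_map v : v \in C -> blossom_C_to_A m1 v -> blossom_C_to_A m2 (phi v).
Proof.
move=> vC [b [ss [us [a [[bl pus un usC ssC] [la aA liveP vin]]]]]].
have fC y : y \in flat m1 (b :: us) ++ flat m1 ss -> y \in C.
  by rewrite mem_cat => /orP[]; apply: flat_C.
have bC : b \in C by apply: usC; rewrite mem_head.
have lC : last b us \in C by apply: usC; apply: mem_last.
have efl : flat m2 (phi b :: map phi us) ++ flat m2 (map phi ss) =
   map phi (flat m1 (b :: us) ++ flat m1 ss) by rewrite map_cat -!flat_map.
exists (phi b), (map phi ss), (map phi us), (phi a); split; split.
- exact: rooted_blossom_map.
- exact: path_map_step.
- by rewrite efl uniq_mapC.
- by move=> w; rewrite -map_cons => /mapP[z zu ->]; apply: transfer_C; exact: usC.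
- by move=> w /mapP[z zu ->]; apply: transfer_C; exact: ssC.
- by rewrite last_map matched_C // (transfer_adj T) ?l2 ?la //;
    [apply/kept_C/C_mate | apply: kept_A].
- by rewrite (transfer_A T) ?kept_A.
- exact: live_transfer mm1 mm2 mt (kept_A aA) liveP.
- by rewrite efl mem_mapC.
Qed.

Notation M1 := (matching_of m1).
Notation M2 := (matching_of m2).
Notation img f := (phi @: (f : {set G1})).

(** [phi] need not be injective on all of [G1], so edges are compared through their images only for
    pairs inside C. *)
Definition edgeC (f : {set G1}) := exists x y, [/\ x \in C, y \in C & f = [set x; y]].

Lemma path_edges_C x p : {in x :: p, forall w, w \in C} ->
  forall f, f \in path_edges x p -> edgeC f.
Proof.
elim: p x => //= y p IH x h f; rewrite inE => /predU1P[->|].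
  by exists x, y; rewrite !h // !inE eqxx ?orbT.
by apply: IH => z zy; apply: h; rewrite inE zy orbT.
Qed.

Lemma cycle_edges_C c : {in c, forall w, w \in C} -> forall f, f \in cycle_edges c -> edgeC f.
Proof.
case: c => // x p h; apply: path_edges_C => w; rewrite inE mem_rcons inE.
by case/or3P=> [/eqP->|/eqP->|wp]; apply: h; rewrite inE ?eqxx ?wp ?orbT.
Qed.

Lemma path_edges_map x p : path_edges (phi x) (map phi p) = map (fun f => img f) (path_edges x
  p).
Proof. by elim: p x => //= y p IH x; rewrite IH imsetU1 imset_set1. Qed.

Lemma cycle_edges_map c : cycle_edges (map phi c) = map (fun f => img f) (cycle_edges c).
Proof. by case: c => //= x p; rewrite -map_rcons path_edges_map. Qed.

Lemma img_M f : edgeC f -> (img f \in M2) = (f \in M1).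
Proof.
case=> x [y [xC yC ->]]; rewrite imsetU1 imset_set1.
have [[K1 _ _] _] := mm1; have [[K2 _ _] _] := mm2.
rewrite !in_matching_of // matched_C // !(inj_in_eq phi_injC) //.
exact: C_mate.
Qed.

Lemma img_mem f v : edgeC f -> v \in C -> (phi v \in img f) = (v \in f).
Proof.
case=> x [y [xC yC ->]] vC; rewrite imsetU1 imset_set1 !inE.
by rewrite !(inj_in_eq phi_injC).
Qed.

Lemma img_inj f g : edgeC f -> edgeC g -> img f = img g -> f = g.
Proof.
move=> ef eg e; apply/setP => v; have [x [y [xC yC _]]] := ef.
case vC : (v \in C); first by rewrite -(img_mem ef vC) e img_mem.
have notin h : edgeC h -> (v \in h) = false.
  case=> z [t [zC tC ->]]; rewrite !inE; apply/negbTE/norP.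
  by split; apply/eqP => ev; rewrite ev ?zC ?tC in vC.
by rewrite !notin.
Qed.

Lemma mem_map_img f es : edgeC f -> (forall g, g \in es -> edgeC g) ->
  (img f \in map (fun f => img f) es) = (f \in es).
Proof.
move=> ef h; apply/mapP/idP => [[g gs /(img_inj ef (h _ gs)) ->//]|fs].
by exists f.
Qed.

Lemma mm_path_map x p : {in x :: p, forall w, w \in C} ->
  mm_path M1 x p -> mm_path M2 (phi x) (map phi p).
Proof.
move=> h /and5P[/andP[px un] alt ne hd la].
have eC := path_edges_C h.
have pe f : f \in path_edges x p -> (img f \in M2) = (f \in M1) by move/eC/img_M.
have pn : path_edges x p != [::] by case: (p) ne.
apply/and5P; split; last 2 first.
- rewrite path_edges_map; case: (path_edges x p) pn hd pe => //= f es _ fM pe.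
  by rewrite pe ?mem_head.
- rewrite path_edges_map; case: (path_edges x p) pn la pe => //= f es _ fM pe.
  by rewrite last_map pe ?mem_last.
- rewrite /simple_path -map_cons uniq_mapC // un andbT path_map.
  apply: (sub_in_path (P := [in C])) px; last by apply/allP.
  by move=> y z yC zC yz; rewrite /= adj_C.
- rewrite /alternating path_edges_map sorted_map.
  apply: (sub_in_sorted (P := mem (path_edges x p))) alt; last exact: allss.
  by move=> f g fp gp; rewrite /= !pe.
- by case: (p) ne.
Qed.

Lemma blossom_map c b : {in c, forall w, w \in C} ->
  blossom M1 c && base M1 c b -> blossom M2 (map phi c) && base M2 (map phi c) (phi b).
Proof.
move=> h /andP[/and4P[sz /andP[cyc un] od /eqP cnt] /andP[bc /allP ba]].
have eC := cycle_edges_C h.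
have pe f : f \in cycle_edges c -> (img f \in M2) = (f \in M1) by move/eC/img_M.
have bC : b \in C by apply: h.
apply/andP; split; last first.
  apply/andP; split; first by apply: map_f.
  rewrite cycle_edges_map; apply/allP => g /mapP[f fc ->].
  by rewrite pe // (img_mem (eC f fc) bC); apply: ba.
apply/and4P; split; rewrite ?size_map //.
- rewrite /ucycleb uniq_mapC // un andbT cycle_map.
  apply: (sub_in_cycle (P := [in C])) cyc; last by apply/allP.
  by move=> y z yC zC yz; rewrite /= adj_C.
- rewrite cycle_edges_map count_map -cnt; apply/eqP/eq_in_count => f fc /=.
  exact: pe.
Qed.

Lemma tposy_map c1 c2 x p : {in c1 ++ c2 ++ x :: p, forall w, w \in C} ->
  tposy M1 c1 c2 x p -> tposy M2 (map phi c1) (map phi c2) (phi x) (map phi p).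
Proof.
move=> h [b1 b2 mp int meet].
have h1 : {in c1, forall w, w \in C} by move=> w wc; apply: h; rewrite mem_cat wc.
have h2 : {in c2, forall w, w \in C} by move=> w wc; apply: h; rewrite !mem_cat wc orbT.
have h3 : {in x :: p, forall w, w \in C} by move=> w wc; apply: h; rewrite !mem_cat wc !orbT.
split.
- exact: blossom_map.
- by rewrite last_map; exact: blossom_map.
- exact: mm_path_map.
- rewrite belast_map behead_map => w /mapP[y yb ->].
  have yC : y \in C by apply/h3/mem_belast/mem_behead.
  by rewrite !mem_mapC //; apply: int.
case: meet => [dis|[y [q [mq vq eq]]]].
  left=> w /mapP[y yc ->]; rewrite mem_mapC //; [exact: dis | exact: h1].
have hq : {in y :: q, forall w, w \in C}.
  by move=> w; rewrite vq => /andP[/h1].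
right; exists (phi y), (map phi q); split.
- exact: mm_path_map.
- move=> w; rewrite -map_cons; apply/idP/andP => [/mapP[z zq ->]|[/mapP[z z1 ->]]].
    by have := zq; rewrite !mem_mapC ?hq // vq => /andP[].
  by have zC := h1 z z1; rewrite !mem_mapC // vq z1.
- move=> f; rewrite path_edges_map !cycle_edges_map.
  apply/idP/andP => [/mapP[g gq ->]|[/mapP[g g1 ->]]].
    have eg := path_edges_C hq gq.
    have := gq; rewrite !(mem_map_img eg) ?eq => [/andP[]//||]; exact: cycle_edges_C.
  have eg := cycle_edges_C h1 g1.
  rewrite !(mem_map_img eg); [|exact: path_edges_C | exact: cycle_edges_C].
  by rewrite eq g1.
Qed.

Lemma posy_in_C_map v : v \in C -> posy_in_C m1 v -> phi v \in SD G2.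
Proof.
move=> vC [c1 [c2 [x [p [tp vin h]]]]]; apply: (in_SD mm2); right.
exists (map phi c1), (map phi c2), (phi x), (map phi p); split; first exact: tposy_map.
by rewrite -map_cons -!map_cat mem_mapC.
Qed.

End Lists.
Lemma SD_transfer x : kept x -> x \in SD G1 -> phi x \in SD G2.
Proof.
move=> xk xS; case xC : (x \in C).
  have [m1 mm1 cs] := SD_C_cases xS xC.
  have [m2 mm2 mt] := transfer_match T mm1.
  case: cs => cs; first by apply: (posy_in_C_map mm1 mm2 mt xC cs).
    by apply: (blossom_C_to_A_SD mm2); apply: (blossom_C_to_A_map mm1 mm2 mt xC cs).
  by apply: (segment_A_C_A_SD mm2); apply: (segment_A_C_A_map mm1 mm2 mt xC cs).
have DA : (phi x \in gallai_D G2) || (phi x \in gallai_A G2).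
  rewrite (transfer_D T) // (transfer_A T) //.
  by move/negbT: xC; rewrite in_C negb_and !negbK.
(* By contraposition: a set good for all maximum matchings of [G2] is good for the one corresponding
   to the matching that witnesses [x] in SD, and it can be pulled back to that witness. *)
case: (SD_or_good DA) => // -[I2 xI gI].
have [m1 mm1 [_ ng]] := SD_not_good xS.
have [m2 mm2 mt] := transfer_match T mm1.
have [xI1 xN1] := ng _ (pull_good mm1 mm2 mt (gI m2 mm2)).
case/orP: xI => xI; first by rewrite in_pull xI andbT xk in xI1.
by rewrite (pull_nbhd mm2 (gI m2 mm2) xk xI) in xN1.
Qed.

Lemma sterboul_deming_transfer : sterboul_deming G1 -> sterboul_deming G2.
Proof.
move=> h; apply/setP => y; rewrite in_setC in_set0; apply/negbF.
case yk : (kept y); last by apply/nontriv_SD/negbNE/negbT.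
have [x xk <-] := transfer_surj T yk; apply: SD_transfer => //.
by have := in_set0 x; rewrite -h in_setC => /negbFE.
Qed.

End TransferTheory.

(** * The reduced form *)

Section Components.
Variable G : sgraph.
Implicit Types (x y : G) (K : D_component G) (k : kept_vertex G).
Notation D := (gallai_D G).

Lemma in_component x y :
  (y \in [set z in D | connect (adj_in D) x z]) = (y \in D) && connect (adj_in D) x y.
Proof. by rewrite in_set. Qed.

Lemma comp_nontriv K x : x \in val K -> nontriv x.
Proof.
have := valP K; rewrite inE => /andP[/imsetP[z zD eK] K1] xK.
have [y yK yx] : exists2 y, y \in val K & y != x.
  have : 0 < #|val K :\ x| by rewrite (cardsD1 x) xK in K1.
  by case/card_gt0P=> y; rewrite !inE => /andP[yx yK]; exists y.
move: xK yK; rewrite eK !in_component => /andP[xD zx] /andP[yD zy].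
have xy : connect (adj_in D) x y by rewrite connect_D_sym in zx; apply: connect_trans zx zy.
case/connectP: xy => -[|w p] /= pp e; first by rewrite e eqxx in yx.
by case/andP: pp => /and3P[_ wD xw] _; apply/nontrivP; split=> //; exists w.
Qed.

Lemma comp_connect K x y : x \in val K -> (y \in val K) = connect (adj_in D) x y.
Proof.
move=> xK; have xD := nontriv_D (comp_nontriv xK); have := valP K.
rewrite inE => /andP[/imsetP[z zD eK] _]; move: xK; rewrite eK !in_component => /andP[_ zx].
apply/andP/idP => [[_ zy]|xy]; first by rewrite connect_D_sym in zx; apply: connect_trans zx zy.
split; last exact: connect_trans zx xy.
by apply: nontriv_D; apply: nontriv_connect xy; apply: (@comp_nontriv K);
  rewrite eK in_component xD.
Qed.

Lemma comp_ex x : nontriv x -> exists K, x \in val K.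
Proof.
move=> xn; have xD := nontriv_D xn; pose S := [set y in D | connect (adj_in D) x y].
have SP : S \in nontrivial_D_components G.
  rewrite inE; apply/andP; split; first by apply/imsetP; exists x.
  have /nontrivP[_ [u uD xu]] := xn.
  have uS : u \in S by rewrite in_component uD connect1 //; apply/and3P.
  have xS : x \in S by rewrite in_component xD connect0.
  by rewrite (cardsD1 x) xS (cardsD1 u) in_setD1 uS [u == x]eq_sym adj_neq.
by pose K : D_component G := exist _ S SP; exists K; rewrite in_component xD connect0.
Qed.

Lemma comp_uniq K K' x : x \in val K -> x \in val K' -> K = K'.
Proof.
move=> xK xK'; apply: val_inj; apply/setP => y.
by rewrite (comp_connect y xK) (comp_connect y xK').
Qed.

Lemma in_cover x : (x \in cover (nontrivial_D_components G)) = nontriv x.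
Proof.
apply/bigcupP/idP => [[S SK xS]|/comp_ex[K xK]].
  by pose K : D_component G := exist _ S SK; apply: (@comp_nontriv K).
by exists (val K) => //; apply: valP.
Qed.

Lemma kept_val k : kept (val k).
Proof. by rewrite /kept -in_cover; case: k. Qed.

Lemma kept_lift x : kept x -> exists k, val k = x.
Proof. by rewrite /kept -in_cover => xk; pose k : kept_vertex G := exist _ x xk; exists k. Qed.

Lemma comp_notkept K x : x \in val K -> ~~ kept x.
Proof. by move/comp_nontriv; rewrite /kept negbK. Qed.

Lemma comp_neq0 K : exists x, x \in val K.
Proof. by have := valP K; rewrite inE => /andP[_ /ltnW/card_gt0P]. Qed.

Lemma comp_adj_A K x y : x \in val K -> adj x y -> kept y -> y \in gallai_A G.
Proof.
move=> xK xy yk; have xn := comp_nontriv xK; apply/negPn/negP => yA.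
have yD := D_nbhd (nontriv_D xn) xy yA.
by move/negP: yk; apply; apply/nontrivP; split=> //; exists x;
  [exact: nontriv_D | rewrite adj_sym].
Qed.

Lemma comp_dfree_uniq m K x y : maxmatch setT m -> x \in val K -> y \in val K ->
  dfree m x -> dfree m y -> x = y.
Proof.
move=> mm xK yK; apply: dfree_uniq => //; first exact: nontriv_D (comp_nontriv xK).
by rewrite -(comp_connect _ xK).
Qed.

Lemma comp_mate m K x : maxmatch setT m -> x \in val K -> ~~ dfree m x -> m x \in val K.
Proof.
move=> mm xK; rewrite negb_or => /andP[mx mxA]; have [[_ madj _] _] := mm.
have xD := nontriv_D (comp_nontriv xK); have mD := D_nbhd xD (madj _ mx) mxA.
by rewrite (comp_connect _ xK); apply: connect1; apply/and3P; split=> //; apply: madj.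
Qed.

(** Otherwise [m] matches the component perfectly within itself, while a matching missing [y] leaves
    only [y] unmatched in it. The alternating path from [y] inside the component could end neither
    at a second such vertex nor at one exposed by [m]. *)
Lemma comp_dfree_ex m K : maxmatch setT m -> exists2 x, x \in val K & dfree m x.
Proof.
move=> mm; apply: contrapT => H.
have nd x : x \in val K -> ~~ dfree m x by move=> xK; apply/negP => xd; apply: H; exists x.
have [y yK] := comp_neq0 K.
have [_ [n mn ny]] := (gallai_DP y).1 (nontriv_D (comp_nontriv yK)).
have dy : dfree n y by rewrite /dfree ny eqxx.
have [[mK _ _] _] := mm; have [[nK _ _] _] := mn.
pose m' x := if x \in val K then m x else x; pose n' x := if x \in val K then n x else x.
have nk x : x \in val K -> n x \in val K.
  move=> xK; case dx: (dfree n x); last by apply: comp_mate; rewrite ?dx.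
  by rewrite (comp_dfree_uniq mn xK yK dx dy) ny.
have mk x : x \in val K -> m x \in val K by move=> xK; apply: comp_mate => //; apply: nd.
have m'K : involutive m' by move=> x; rewrite /m'; case xK: (x \in val K); rewrite ?mk ?mK ?xK.
have n'K : involutive n' by move=> x; rewrite /n'; case xK: (x \in val K); rewrite ?nk ?nK ?xK.
have n'y : n' y = y by rewrite /n' yK.
have [h] := alt_orbitP m'K n'K n'y; set Z := [set _ | _ : _].
set w := alt_orbit m' n' y => -[inj inZ Zin clo fixed].
have wK i : w i \in val K.
  elim: i => [|i IH] //; rewrite /w alt_orbitS -/w.
  by case: (odd i); rewrite /m' /n' IH ?mk ?nk.
case: ifP fixed => oh fixed.
  have [h0 /(_ _ (inZ h (leqnn h)))[_]] := fixed; rewrite -/w eqxx orbT => /eqP.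
  rewrite /n' wK => nh.
  have dh : dfree n (w h) by rewrite /dfree nh eqxx.
  have := inj 0 h; rewrite lt0n h0 leqnn -/w (comp_dfree_uniq mn (wK h) yK dh dy) eqxx.
  by move/(_ isT isT).
have := (fixed _ (inZ h (leqnn h))).1; rewrite -/w eqxx /m' wK => /eqP mh.
by have := nd _ (wK h); rewrite /dfree mh eqxx.
Qed.

End Components.

(** * Matchings of G against matchings of its reduced form *)

Section Reduced.
Variable G : sgraph.
Notation R := (reduced_form G).
Notation D := (gallai_D G).
Notation A := (gallai_A G).
Implicit Types (x y : G) (K : D_component G) (k : kept_vertex G) (v : R).

Definition kept_vtx k : R := inl k.
Definition tri_vtx K (i : 'I_3) : R := inr (K, i).
Let o1 : 'I_3 := inord 1.
Let o2 : 'I_3 := inord 2.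

Let o12 : o1 != o2. Proof. by rewrite -val_eqE /= !inordK. Qed.
Let o01 : o1 != ord0. Proof. by rewrite -val_eqE /= !inordK. Qed.
Let o02 : o2 != ord0. Proof. by rewrite -val_eqE /= !inordK. Qed.
Let oP (i : 'I_3) : [\/ i = ord0, i = o1 | i = o2].
Proof.
case: i => -[|[|[|//]]] p; [apply: Or31|apply: Or32|apply: Or33]; apply: val_inj => //=;
  by rewrite inordK.
Qed.

Lemma adj_kept_kept k k' : adj (kept_vtx k) (kept_vtx k') = adj (val k) (val k'). Proof. by [].
  Qed.

Lemma adj_tri_tri K K' i j : adj (tri_vtx K i) (tri_vtx K' j) = (K == K') && (i != j). Proof.
  by []. Qed.

Lemma adj_kept_tri k K i : adj (kept_vtx k) (tri_vtx K i) = (i == ord0) && (val k \in nbhd (val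
  K) :&: A).
Proof. by []. Qed.

Let tperm0 i : i != ord0 -> tperm o1 o2 i != ord0.
Proof. by case: (oP i) => ->; rewrite ?tpermL ?tpermR ?eqxx ?o01 ?o02. Qed.

Lemma R_cases v : (exists k, v = kept_vtx k) \/ exists K i, v = tri_vtx K i.
Proof. by case: v => [k|[K i]]; [left; exists k | right; exists K, i]. Qed.

Lemma to_reduced_vertex : exists f : G -> R, (forall k, f (val k) = kept_vtx k) /\
  forall K x, x \in val K -> f x = tri_vtx K ord0.
Proof.
have H x : exists v : R, (forall k, val k = x -> v = kept_vtx k) /\
    (forall K, x \in val K -> v = tri_vtx K ord0).
  case xk : (kept x).
    have [k e] := kept_lift xk; exists (kept_vtx k); split=> [k' e'|K /comp_notkept];
      last by rewrite xk.
    by congr kept_vtx; apply: val_inj; rewrite e.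
  have [K xK] := comp_ex (negbFE xk).
  exists (tri_vtx K ord0); split=> [k e|K' xK']; first by have := kept_val k; rewrite e xk.
  by rewrite (comp_uniq xK xK').
have [f fP] := choice H; exists f; split=> [k|K x]; [exact: (fP _).1 | exact: (fP _).2].
Qed.

(* A component K of G[D] is entered by at most one matching edge, at its only
   dfree vertex [dk K]; this edge becomes the edge at the vertex 0 of the triangle. *)
Lemma to_reduced m (toR : G -> R) : maxmatch setT m -> (forall k, toR (val k) = kept_vtx k) ->
  (forall K x, x \in val K -> toR x = tri_vtx K ord0) -> exists n : R -> R,
  [/\ matchfun setT n, #|free setT n| <= #|free setT m|,
      forall k, n (kept_vtx k) = toR (m (val k)),
      forall K x, x \in val K -> m x = x -> n (tri_vtx K ord0) = tri_vtx K ord0 &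
      forall K, n (tri_vtx K o1) = tri_vtx K o2 ].
Proof.
move=> mm tk tK; have [[mK madj _] _] := mm.
have [dk dkP] := choice (fun K => let: ex_intro2 x a b := comp_dfree_ex K mm in
   ex_intro (fun x => x \in val K /\ dfree m x) x (conj a b)).
have [n [nl n0 ni]] : exists n : R -> R, [/\ forall k, n (kept_vtx k) = toR (m (val k)),
    forall K, n (tri_vtx K ord0) = if kept (m (dk K)) then toR (m (dk K)) else tri_vtx K ord0 &
    forall K i, i != ord0 -> n (tri_vtx K i) = tri_vtx K (tperm o1 o2 i)].
  exists (fun v : R => match v with inl k => toR (m (val k))
  | inr (K, i) => if i == ord0 then if kept (m (dk K)) then toR (m (dk K)) else v
                  else tri_vtx K (tperm o1 o2 i) end).
  by split=> // K i /negPf /= ->.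
have dkK K : dk K \in val K := (dkP K).1.
have mdk K : ~~ kept (m (dk K)) -> m (dk K) = dk K.
  have [_ /orP[/eqP //|/kept_A mA]] := dkP K; by rewrite mA.
have kK k K : m (val k) \in val K -> dk K = m (val k).
  move=> mkK; apply: (comp_dfree_uniq mm (dkK K) mkK (dkP K).2).
  rewrite /dfree mK orbC (comp_adj_A mkK) //; last exact: kept_val.
  rewrite -{2}(mK (val k)); apply: madj; rewrite mK; apply/eqP => e.
  by have := comp_notkept mkK; rewrite -e kept_val.
have cases x : (exists k, val k = x) \/ exists K, x \in val K.
  by case xk: (kept x); [left; apply: kept_lift | right; apply: comp_ex; exact: negbFE].
exists n; split=> //.
- split=> // v.
  + case: (R_cases v) => [[k ->]|[K [i ->]]].
      rewrite nl; case: (cases (m (val k))) => [[k' e]|[K mkK]].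
        by rewrite -e tk nl e mK tk.
      by rewrite (tK _ _ mkK) n0 (kK _ _ mkK) mK kept_val tk.
    case: (altP (i =P ord0)) => [->|i0]; last first.
      by rewrite ni // ni ?tpermK // tperm0.
    rewrite n0; case dkk: (kept (m (dk K))); last by rewrite n0 dkk.
    have [k e] := kept_lift dkk; rewrite -e tk nl e mK.
    by rewrite (tK _ _ (dkK K)).
  + case: (R_cases v) => [[k ->]|[K [i ->]]].
      rewrite nl; case: (cases (m (val k))) => [[k' e]|[K mkK]].
        rewrite -e tk => ne; rewrite adj_kept_kept e; apply: madj.
        by apply: contra ne => /eqP e'; apply/eqP; congr kept_vtx; apply: val_inj; rewrite e e'.
      rewrite (tK _ _ mkK) => _; rewrite adj_kept_tri eqxx in_setI.
      have a : adj (val k) (m (val k)).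
        by apply: madj; apply/eqP => e; have := comp_notkept mkK; rewrite e kept_val.
      rewrite (comp_adj_A mkK _ (kept_val k)) ?andbT; last by rewrite adj_sym.
      by apply/nbhdP; exists (m (val k)).
    case: (altP (i =P ord0)) => [->|i0]; last first.
      move=> _; rewrite ni // adj_tri_tri eqxx /=.
      case: (oP i) i0 => ->; rewrite ?eqxx ?tpermL ?tpermR ?o12 // => _.
      by rewrite eq_sym o12.
    rewrite n0; case dkk: (kept (m (dk K))); last by rewrite eqxx.
    have [k e] := kept_lift dkk; rewrite -e tk => _.
    rewrite adj_sym adj_kept_tri eqxx in_setI e.
    have a : adj (m (dk K)) (dk K).
      rewrite -{2}(mK (dk K)); apply: madj; rewrite mK; apply/eqP => e'.
      by have := comp_notkept (dkK K); rewrite e' dkk.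
    rewrite (comp_adj_A (dkK K) _ dkk) ?andbT; last by rewrite adj_sym.
    by apply/nbhdP; exists (dk K).
(* Each vertex exposed by [n] is the image of one exposed by [m]: in a triangle only the vertex 0
   can be exposed, and then [dk K] is. *)
- apply: leq_trans (leq_imset_card toR _); apply: subset_leq_card; apply/subsetP => v.
  rewrite in_set => /andP[_]; case: (R_cases v) => [[k ->]|[K [i ->]]].
    rewrite nl; case: (cases (m (val k))) => [[k' e]|[K mkK]].
      rewrite -e tk => /eqP[ek]; apply/imsetP; exists (val k); rewrite ?tk //.
      by rewrite /free in_set in_setT -e ek eqxx.
    by rewrite (tK _ _ mkK) => /eqP.
  case: (altP (i =P ord0)) => [->|i0].
    rewrite n0; case dkk: (kept (m (dk K))).
      by have [k e] := kept_lift dkk; rewrite -e tk => /eqP.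
    move=> _; apply/imsetP; exists (dk K); last by rewrite (tK K).
    by rewrite /free in_set in_setT mdk ?dkk ?eqxx.
  rewrite ni // => /eqP[]; case: (oP i) i0 => ->; rewrite ?eqxx // => _;
    rewrite ?tpermL ?tpermR => e.
    by move: o12; rewrite e eqxx.
  by move: o12; rewrite e eqxx.
- move=> K x xK mx; rewrite n0.
  have -> : dk K = x.
    by apply: (comp_dfree_uniq mm (dkK K) xK (dkP K).2); rewrite /dfree mx eqxx.
  by rewrite mx (negPf (comp_notkept xK)).
- by move=> K; rewrite ni // tpermL.
Qed.

(** In each component a vertex [rt K] takes over the matching edge that leaves the triangle, if
    there is one. The other vertices of the component are matched among themselves by a maximum
    matching that misses [rt K]. *)
Lemma of_reduced (n : R -> R) : matchfun setT n -> exists m : G -> G,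
  [/\ matchfun setT m, #|free setT m| <= #|free setT n|,
      forall k k', n (kept_vtx k) = kept_vtx k' -> m (val k) = val k' &
      forall k K i, n (kept_vtx k) = tri_vtx K i -> m (val k) \in val K].
Proof.
move=> [nK nadj _].
have H K : exists x, x \in val K /\ forall k, n (tri_vtx K ord0) = kept_vtx k -> adj (val k) x.
  case e : (n (tri_vtx K ord0)) => [k|s]; last by have [x xK] := comp_neq0 K; exists x.
  have := nadj (tri_vtx K ord0); rewrite e => /(_ isT); rewrite adj_sym.
  rewrite -/(kept_vtx k) adj_kept_tri eqxx andTb in_setI => /andP[/nbhdP[x xK kx] _].
  by exists x; split=> // k' [<-].
have [rt rtP] := choice H.
have H2 K : exists p : G -> G, [/\ involutive p, p (rt K) = rt K &
    forall x, x \in val K -> x != rt K -> p x \in val K /\ adj x (p x)].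
  have rK := (rtP K).1.
  have [_ [p mp pr]] := (gallai_DP (rt K)).1 (nontriv_D (comp_nontriv rK)).
  have [[pK padj _] _] := mp; exists p; split=> // x xK xr.
  have xd : ~~ dfree p x.
    apply: contra xr => xd; apply/eqP/(comp_dfree_uniq mp xK rK xd).
    by rewrite /dfree pr eqxx.
  by split; [apply: comp_mate | apply: padj; move: xd; rewrite negb_or => /andP[]].
have [p pP] := choice H2.
pose fr (v : R) : G := match v with inl k => val k | inr (K, i) => rt K end.
pose inK K x := if x == rt K then if n (tri_vtx K ord0) is inl a then val a else x else p K x.
pose m x := if [pick k : kept_vertex G | val k == x] is Some k then fr (n (kept_vtx k))
            else if [pick K : D_component G | x \in val K] is Some K then inK K x else x.
have frl k : fr (kept_vtx k) = val k by [].
have frt K i : fr (tri_vtx K i) = rt K by [].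
have mk k : m (val k) = fr (n (kept_vtx k)).
  rewrite /m; case: pickP => [k' /eqP /val_inj -> //|/(_ k)].
  by rewrite eqxx.
have mK K x : x \in val K -> m x = inK K x.
  move=> xK; rewrite /m; case: pickP => [k /eqP e|_].
    by have := comp_notkept xK; rewrite -e kept_val.
  case: pickP => [K' xK'|/(_ K)]; last by rewrite xK.
  by rewrite (comp_uniq xK xK').
have rK K : rt K \in val K := (rtP K).1.
have mrl K k : n (tri_vtx K ord0) = kept_vtx k -> m (rt K) = val k.
  by move=> e; rewrite (mK _ _ (rK K)) /inK eqxx e.
have mrt K K' i : n (tri_vtx K ord0) = tri_vtx K' i -> m (rt K) = rt K.
  by move=> e; rewrite (mK _ _ (rK K)) /inK eqxx e.
have mp K x : x \in val K -> x != rt K -> m x = p K x.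
  by move=> xK /negPf xr; rewrite (mK _ _ xK) /inK xr.
clearbody fr m; clear mK inK.
have nsym v w : n v = w -> n w = v by move=> <-; rewrite nK.
have nlt k K i : n (kept_vtx k) = tri_vtx K i -> n (tri_vtx K ord0) = kept_vtx k.
  move=> e; have := nadj (kept_vtx k); rewrite e => /(_ isT).
  by rewrite adj_kept_tri => /andP[/eqP i0 _]; rewrite -i0; apply: nsym.
have cases x : (exists k, val k = x) \/ exists K, x \in val K.
  by case xk: (kept x); [left; apply: kept_lift | right; apply: comp_ex; exact: negbFE].
exists m; split.
- split=> // x; case: (cases x) => [[k <-]|[K xK]].
  + rewrite mk; case: (R_cases (n (kept_vtx k))) => [[k' e]|[K [i e]]]; rewrite e.
      by rewrite frl mk (nsym _ _ e).
    by rewrite frt; apply: mrl (nlt _ _ _ e).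
  + case: (altP (x =P rt K)) => [->|xr].
      case: (R_cases (n (tri_vtx K ord0))) => [[k e]|[K' [i e]]].
        by rewrite (mrl _ _ e) mk (nsym _ _ e) frt.
      by rewrite !(mrt _ _ _ e).
    have [pK pr pin] := pP K; have [px _] := pin x xK xr.
    rewrite (mp K x) // (mp K) //; apply: contra xr => /eqP e.
    by rewrite -(pK x) e pr.
  + rewrite mk; case: (R_cases (n (kept_vtx k))) => [[k' e]|[K [i e]]]; rewrite e.
      rewrite frl => ne; rewrite -adj_kept_kept -e; apply: nadj; rewrite e.
      by apply: contra ne => /eqP[->].
    by rewrite frt => _; apply: (rtP K).2; apply: nlt e.
  + case: (altP (x =P rt K)) => [->|xr].
      case: (R_cases (n (tri_vtx K ord0))) => [[k e]|[K' [i e]]].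
        by rewrite (mrl _ _ e) adj_sym => _; apply: (rtP K).2.
      by rewrite (mrt _ _ _ e) eqxx.
    by have [_ _ pin] := pP K; have [_] := pin x xK xr; rewrite (mp K x).
- apply: leq_trans (leq_imset_card fr _); apply: subset_leq_card; apply/subsetP => x.
  rewrite /free in_set => /andP[_ /eqP mx].
  suff [v [nv <-]] : exists v, n v = v /\ fr v = x.
    by apply/imsetP; exists v; rewrite // in_set in_setT nv eqxx.
  case: (cases x) mx => [[k <-]|[K xK]] mx.
    exists (kept_vtx k); split=> //; rewrite mk in mx.
    case: (R_cases (n (kept_vtx k))) mx => [[k' e]|[K [i e]]]; rewrite e ?frl ?frt => mx.
      by rewrite (val_inj mx).
    by have := comp_notkept (rK K); rewrite mx kept_val.
  have xr : x = rt K.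
    apply/eqP/negPn/negP => xr; have [_ _ pin] := pP K; have [_] := pin x xK xr.
    by rewrite -(mp K x) // mx adj_irrefl.
  (* [rt K] is exposed only when no matching edge leaves the triangle; then [n] acts on its three
     vertices, and an involution of three points has a fixed point. *)
  suff [i ni] : exists i, n (tri_vtx K i) = tri_vtx K i by exists (tri_vtx K i); rewrite frt.
  case: (R_cases (n (tri_vtx K ord0))) => [[k e]|[K' [j e]]].
    by have := comp_notkept xK; rewrite -mx xr (mrl _ _ e) kept_val.
  have inT i : exists j', n (tri_vtx K i) = tri_vtx K j'.
    case: (altP (n (tri_vtx K i) =P tri_vtx K i)) => [->|ne]; first by exists i.
    have := nadj _ ne; case: (R_cases (n (tri_vtx K i))) => [[k ei]|[K2 [j' ei]]]; rewrite ei.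
      by have := nlt _ _ _ (nsym _ _ ei); rewrite e.
    by rewrite adj_tri_tri => /andP[/eqP <- _]; exists j'.
  apply: contrapT => nf.
  have nf' i : n (tri_vtx K i) <> tri_vtx K i by move=> h; apply: nf; exists i.
  have [f fP] := choice inT.
  have fK : involutive f.
    by move=> i; have := nK (tri_vtx K i); rewrite !fP => -[].
  have fne i : f i <> i by move=> h; apply: (nf' i); rewrite fP h.
  have := fne ord0; have := fne o1; have := fne o2; have := fK ord0; have := fK o1;
    have := fK o2.
  move/eqP: o12; move/eqP: o01; move/eqP: o02.
  by case: (oP (f ord0)) => ->; case: (oP (f o1)) => ->; case: (oP (f o2)) => ->; congruence.
- by move=> k k' e; rewrite mk e frl.
- by move=> k K i e; rewrite mk e frt.
Qed.

End Reduced.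

(** * Transfers between a graph and its reduced form *)

Section ReducedTransfer.
Variable G : sgraph.
Notation R := (reduced_form G).
Notation D := (gallai_D G).
Notation A := (gallai_A G).
Notation D' := (gallai_D R).
Notation A' := (gallai_A R).
Implicit Types (x y : G) (K : D_component G) (k : kept_vertex G) (v : R).

(** Neither construction increases the number of exposed vertices, so a better matching of the
    reduced form would translate back into one better than [m]. *)
Lemma maxmatch_reduced (toR : G -> R) m : maxmatch setT m ->
  (forall k, toR (val k) = kept_vtx k) ->
  (forall K x, x \in val K -> toR x = tri_vtx K ord0) -> exists2 n : R -> R, maxmatch setT n &
  [/\ forall k, n (kept_vtx k) = toR (m (val k)),
      forall K x, x \in val K -> m x = x -> n (tri_vtx K ord0) = tri_vtx K ord0 &
      forall K, n (tri_vtx K (inord 1)) = tri_vtx K (inord 2) ].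
Proof.
move=> mm tk tK; have [n [fn cn h1 h2 h3]] := to_reduced mm tk tK; exists n => //.
split=> // n' fn'; have [m' [fm' cm' _ _]] := of_reduced fn'.
by apply: leq_trans cn (leq_trans _ cm'); apply: mm.2.
Qed.

Lemma maxmatch_unreduced (n : R -> R) : maxmatch setT n -> exists2 m : G -> G, maxmatch setT m &
  (forall k k', n (kept_vtx k) = kept_vtx k' -> m (val k) = val k') /\
  (forall k K i, n (kept_vtx k) = tri_vtx K i -> m (val k) \in val K).
Proof.
move=> nn; have [fn _] := nn; have [m [fm cm h1 h2]] := of_reduced fn; exists m => //.
split=> // m' fm'; have [m0 mm0] := maxmatch_ex G.
have [toR [tk tK]] := to_reduced_vertex G; have [n0 [fn0 cn0 _ _ _]] := to_reduced mm0 tk tK.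
apply: leq_trans cm (leq_trans (nn.2 _ fn0) (leq_trans cn0 _)).
exact: mm0.2.
Qed.

Lemma kept_vtx_D k : (kept_vtx k \in D') = (val k \in D).
Proof.
have [toR [tk tK]] := to_reduced_vertex G.
apply/idP/idP => /gallai_DP[_ [m mm mk]]; apply/gallai_DP; split=> //.
  have [m' mm' [h _]] := maxmatch_unreduced mm; exists m' => //; exact: h.
by have [n nn [h _ _]] := maxmatch_reduced mm tk tK; exists n; rewrite // h mk tk.
Qed.

(** A maximum matching can miss the vertex 0 and match the other two together; one exchange inside
    the triangle then exposes either of these. *)
Lemma tri_vtx_D K i : tri_vtx K i \in D'.
Proof.
have [toR [tk tK]] := to_reduced_vertex G; have [x xK] := comp_neq0 K.
have [_ [m mm mx]] := (gallai_DP x).1 (nontriv_D (comp_nontriv xK)).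
have [n nn [_ h0 h1]] := maxmatch_reduced mm tk tK.
have n0 := h0 K x xK mx; have n1 := h1 K; have [[nK _ _] _] := nn.
have n2 : n (tri_vtx K (inord 2)) = tri_vtx K (inord 1) by rewrite -n1 nK.
have free0 (j : 'I_3) : j != ord0 -> n (tri_vtx K j) \in D'.
  move=> j0; apply/gallai_DP; split=> //.
  have [|n' [nn' h _ _ _]] := exchangeE nn n0 (in_setT _) (in_setT (tri_vtx K j)).
    by rewrite adj_tri_tri eqxx eq_sym.
  by exists n'.
case: i => -[|[|[|//]]] p.
- rewrite (_ : Ordinal p = ord0); last exact: val_inj.
  by apply/gallai_DP; split=> //; exists n.
- rewrite (_ : Ordinal p = inord 1); last by apply: val_inj; rewrite /= inordK.
  by rewrite -n2; apply: free0; rewrite -val_eqE /= inordK.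
- rewrite (_ : Ordinal p = inord 2); last by apply: val_inj; rewrite /= inordK.
  by rewrite -n1; apply: free0; rewrite -val_eqE /= inordK.
Qed.

Lemma tri_vtx_nontriv K i : nontriv (tri_vtx K i).
Proof.
apply/nontrivP; split; first exact: tri_vtx_D.
have [j ij] : exists j : 'I_3, i != j.
  case: (altP (i =P ord0)) => [->|i0]; last by exists ord0.
  by exists ord_max.
by exists (tri_vtx K j); [exact: tri_vtx_D | rewrite adj_tri_tri eqxx].
Qed.

Lemma adj_kept_tri_A k K i : adj (kept_vtx k) (tri_vtx K i) -> val k \in A.
Proof. by rewrite adj_kept_tri in_setI => /and3P[]. Qed.

Lemma kept_vtx_kept k : kept (kept_vtx k).
Proof.
apply/negP => /nontrivP[]; rewrite kept_vtx_D => kD [v vD];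
  case: (R_cases v) vD => [[k' ->]|[K [i ->]]].
  rewrite kept_vtx_D adj_kept_kept => k'D kk'; have := kept_val k; rewrite /kept => /negP;
    apply.
  by apply/nontrivP; split=> //; exists (val k').
by move=> _ /adj_kept_tri_A; apply/negP/D_notA.
Qed.

Lemma kept_vtx_ex v : kept v -> exists k, v = kept_vtx k.
Proof.
case: (R_cases v) => [[k ->]|[K [i ->]]]; first by exists k.
by rewrite /kept tri_vtx_nontriv.
Qed.

Lemma kept_vtx_A k : (kept_vtx k \in A') = (val k \in A).
Proof.
rewrite /gallai_A !in_setD kept_vtx_D; case kD: (val k \in D); first by [].
rewrite [~~ false]/= !andTb.
apply/nbhdP/nbhdP => [[v]|[y yD ky]].
  case: (R_cases v) => [[k' ->]|[K [i ->]]].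
    by rewrite kept_vtx_D adj_kept_kept => k'D kk'; exists (val k').
  by move=> _ /adj_kept_tri_A; rewrite /gallai_A in_setD kD => /nbhdP.
case yk : (kept y).
  have [k' e] := kept_lift yk; rewrite -e in yD ky.
  by exists (kept_vtx k'); rewrite ?kept_vtx_D ?adj_kept_kept.
have [K yK] := comp_ex (negbFE yk); exists (tri_vtx K ord0); first exact: tri_vtx_D.
have kA : val k \in A by apply: comp_adj_A yK _ (kept_val k); rewrite adj_sym.
rewrite adj_kept_tri eqxx in_setI kA andbT andTb.
by apply/nbhdP; exists y.
Qed.

Lemma transfer_reduced : exists phi : G -> R, transfer phi.
Proof.
have [toR [tk tK]] := to_reduced_vertex G; exists toR; split.
- move=> x y /kept_lift[k <-] /kept_lift[k' <-].
  by rewrite !tk => -[->].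
- by move=> x /kept_lift[k <-]; rewrite tk kept_vtx_kept.
- by move=> v /kept_vtx_ex[k ->]; exists (val k); [exact: kept_val | exact: tk].
- by move=> x y /kept_lift[k <-] /kept_lift[k' <-]; rewrite !tk.
- by move=> x /kept_lift[k <-]; rewrite tk kept_vtx_D.
- by move=> x /kept_lift[k <-]; rewrite tk kept_vtx_A.
- move=> m mm; have [n nn [h _ _]] := maxmatch_reduced mm tk tK.
  exists n => // x /kept_lift[k <-]; rewrite tk h; split=> // /negbNE /comp_ex[K mK].
  by rewrite (tK _ _ mK) /kept negbK tri_vtx_nontriv.
Qed.

Lemma transfer_unreduced : exists phi : R -> G, transfer phi.
Proof.
have H v : exists x, forall k, v = kept_vtx k -> x = val k.
  case: (R_cases v) => [[k ->]|[K [i ->]]]; first by exists (val k) => k' [->].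
  by have [x xK] := comp_neq0 K; exists x.
have [phi phiP] := choice H; have pk k : phi (kept_vtx k) = val k by apply: phiP.
exists phi; split.
- move=> v w /kept_vtx_ex[k ->] /kept_vtx_ex[k' ->].
  by rewrite !pk => /val_inj ->.
- by move=> v /kept_vtx_ex[k ->]; rewrite pk kept_val.
- by move=> x /kept_lift[k <-]; exists (kept_vtx k); [exact: kept_vtx_kept | exact: pk].
- by move=> v w /kept_vtx_ex[k ->] /kept_vtx_ex[k' ->]; rewrite !pk.
- by move=> v /kept_vtx_ex[k ->]; rewrite pk kept_vtx_D.
- by move=> v /kept_vtx_ex[k ->]; rewrite pk kept_vtx_A.
- move=> n nn; have [m mm [h1 h2]] := maxmatch_unreduced nn.
  exists m => // v /kept_vtx_ex[k ->]; rewrite pk.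
  case: (R_cases (n (kept_vtx k))) => [[k' e]|[K [i e]]]; rewrite e.
    by rewrite (h1 _ _ e) pk kept_vtx_kept.
  rewrite {1}/kept tri_vtx_nontriv; split=> // _; exact: comp_notkept (h2 _ _ _ e).
Qed.

End ReducedTransfer.

Theorem theorem4p8 (G : sgraph) :
  sterboul_deming G <-> sterboul_deming (reduced_form G).
Proof.
have [phi phiT] := transfer_reduced G; have [psi psiT] := transfer_unreduced G.
by split; [apply: sterboul_deming_transfer phiT | apply: sterboul_deming_transfer psiT].
Qed.
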